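(* Let $n\ge 1$. Suppose $u\in C(\mathbb C^n)$ is complex-valued and satisfies $u(0)=1$ and $$|u(z)|\le e^{C_0|z|},\qquad |z|\gg 1,$$ for some $C_0>0$, and $$\bar\partial u=Vu\quad\text{on }\mathbb C^n$$ in the sense of distributions for some $(0,1)$-form $V\in L^\infty(\mathbb C^n)$. Then there exists a positive constant $C$ depending only on $n$, $C_0$ and $\|V\|_{L^\infty(\mathbb C^n)}$ such that $$\inf_{|z_0|=R}\ \sup_{|z-z_0|<1}|u(z)|\ \ge\ e^{-CR\ln R},\qquad R\gg 1 .$$
   Context: For a measurable $(0,1)$-form $V=\sum_{j=1}^n V_j\,d\bar z_j$ on an open subset of $\mathbb C^n$, $|V|=(\sum_j|V_j|^2)^{1/2}$ pointwise, and $V\in L^\infty$ means $|V|$ is essentially bounded, $\|V\|_{L^\infty}=\operatorname{ess\,sup}|V|$. The equation $\bar\partial u=Vu$ means $\partial u/\partial\bar z_j=V_ju$ for all $j=1,\dots,n$. ''$|z|\gg1$'' means for all $z$ with $|z|$ sufficiently large, and ''$R\gg1$'' means for all sufficiently large $R$. *)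

(* Defs.v *)
From HB Require Import structures.
From mathcomp Require Import all_boot all_order all_algebra.
From mathcomp Require Import complex.
From mathcomp Require Import all_classical all_reals all_analysis ess_sup_inf.
Import Order.TTheory GRing.Theory Num.Theory.
Import numFieldNormedType.Exports.

Set Implicit Arguments.
Unset Strict Implicit.
Unset Printing Implicit Defensive.

Local Open Scope classical_set_scope.
Local Open Scope complex_scope.
Local Open Scope ring_scope.

(* The topology of R[i] is the one of its modulus; the topology of
   'rV[R[i]]_n, the model of C^n below, is then the product topology. *)
HB.instance Definition _ (R : realType) := NormedModule.copy R[i] R[i]^o.

Section lebesgue_measure_Cn.
Context (R : realType).

Local Notation R2 := (measurableTypeR R * measurableTypeR R)%type.

Lemma sigma_finite_product d1 d2 (T1 : measurableType d1)
    (T2 : measurableType d2) (m1 : {measure set T1 -> \bar R})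
    (m2 : {sigma_finite_measure set T2 -> \bar R}) :
  sigma_finite setT m1 -> sigma_finite setT (m1 \x m2)%E.
Proof.
move=> /sigma_finiteP[F [TF ndF Foo]].
have /sigma_finiteP[G [TG ndG Goo]] := sigma_finiteT m2.
exists (fun k => F k `*` G k).
  rewrite -setXTT TF TG predeqE => -[x y]; split.
    move=> [/= [k _ Fkx] [l _ Gly]]; exists (maxn k l) => //; split.
    - by move: x Fkx; exact/subsetPset/ndF/leq_maxl.
    - by move: y Gly; exact/subsetPset/ndG/leq_maxr.
  by move=> [k _ []/= ? ?]; split; exists k.
move=> k; have [? ?] := Foo k; have [? ?] := Goo k.
split; first exact: measurableX.
by rewrite product_measure1E// lte_mul_pinfty// ge0_fin_numE.
Qed.

Definition leb_R2 : set R2 -> \bar R :=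
  (@lebesgue_measure R \x @lebesgue_measure R)%E.

HB.instance Definition _ := Measure.copy leb_R2
  (@lebesgue_measure R \x @lebesgue_measure R)%E.

Let leb_R2_sigma_finite : sigma_finite setT leb_R2.
Proof. exact/sigma_finite_product/sigma_finiteT. Qed.

HB.instance Definition _ := Measure_isSigmaFinite.Build _ _ _ leb_R2
  leb_R2_sigma_finite.

Section step.
Context (n : nat) (mu : {sigma_finite_measure set (n.-tuple R2) -> \bar R}).

Definition tuple_cons (p : R2 * n.-tuple R2) : n.+1.-tuple R2 :=
  [the n.+1.-tuple R2 of p.1 :: p.2].

Lemma measurable_tuple_cons : measurable_fun [set: _] tuple_cons.
Proof. exact: measurable_cons. Qed.

Definition leb_step : set (n.+1.-tuple R2) -> \bar R :=
  pushforward (leb_R2 \x mu)%E tuple_cons.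

Let leb_step0 : leb_step set0 = 0%E.
Proof. by rewrite /leb_step /pushforward preimage_set0 measure0. Qed.

Let leb_step_ge0 A : (0 <= leb_step A)%E.
Proof. by rewrite /leb_step /pushforward; exact: measure_ge0. Qed.

Let leb_step_sigma_additive : semi_sigma_additive leb_step.
Proof.
move=> F mF tF mUF; rewrite /leb_step /pushforward preimage_bigcup.
apply: measure_semi_sigma_additive.
- by move=> k; rewrite -[X in measurable X]setTI; exact: measurable_tuple_cons.
- apply/trivIsetP => /= i j _ _ ij; rewrite -preimage_setI.
  by move/trivIsetP : tF => /(_ _ _ _ _ ij) ->//; rewrite preimage_set0.
- by rewrite -preimage_bigcup -[X in measurable X]setTI;
    exact: measurable_tuple_cons.
Qed.

HB.instance Definition _ := isMeasure.Build _ _ _ leb_step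
  leb_step0 leb_step_ge0 leb_step_sigma_additive.

Let leb_step_sigma_finite : sigma_finite setT leb_step.
Proof.
have [F TF mF] := sigma_finite_product mu (sigma_finiteT leb_R2).
pose g (t : n.+1.-tuple R2) : R2 * n.-tuple R2 := (thead t, [tuple of behead t]).
have mg : measurable_fun [set: _] g.
  by apply: measurable_fun_pair; [exact: measurable_tnth|exact: measurable_behead].
have consK : cancel tuple_cons g.
  by move=> [x t]; rewrite /g /tuple_cons; congr pair; exact: val_inj.
exists (fun k => g @^-1` F k).
  by rewrite -preimage_bigcup -TF preimage_setT.
move=> k; split; first by rewrite -[X in measurable X]setTI; apply: mg => //;
  exact: (mF k).1.
rewrite /leb_step /pushforward -comp_preimage.
by rewrite (_ : g \o tuple_cons = id) ?preimage_id ?(mF k).2//; apply/funext.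
Qed.

HB.instance Definition _ := Measure_isSigmaFinite.Build _ _ _ leb_step
  leb_step_sigma_finite.

End step.

(* Lebesgue measure on (R^2)^n, as an iterated product measure; C^n is
   identified with (R^2)^n by [Cn_of_R2] below. *)
Fixpoint leb_Cn n : {sigma_finite_measure set (n.-tuple R2) -> \bar R} :=
  match n with
  | 0 => dirac ([tuple] : 0.-tuple R2)
  | n.+1 => leb_step (leb_Cn n)
  end.

End lebesgue_measure_Cn.

Section Cn.
Context (R : realType) (n : nat).

Local Notation R2 := (measurableTypeR R * measurableTypeR R)%type.
Local Notation C := R[i].
Local Notation Cn := 'rV[R[i]]_n.

Definition cabs (a : C) : R := ComplexField.Normc.normc a.

Definition cnorm (z : Cn) : R := Num.sqrt (\sum_j cabs (z 0 j) ^+ 2).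

Definition Cn_of_R2 (t : n.-tuple R2) : Cn :=
  \row_j ((tnth t j).1 +i* (tnth t j).2).

Definition ae_Cn (P : Cn -> Prop) : Prop :=
  \forall t \ae leb_Cn R n, P (Cn_of_R2 t).

Definition borel_Cn (f : Cn -> C) : Prop :=
  measurable_fun [set: n.-tuple R2] (fun t => complex.Re (f (Cn_of_R2 t))) /\
  measurable_fun [set: n.-tuple R2] (fun t => complex.Im (f (Cn_of_R2 t))).

(* Lebesgue (as opposed to Borel) measurability: the sigma-algebra of
   [leb_Cn] is not complete. *)
Definition lebesgue_measurable_Cn (f : Cn -> C) : Prop :=
  exists2 g : Cn -> C, borel_Cn g & ae_Cn (fun z => f z = g z).

(* The library integral is defined for every function, from the suprema of the
   integrals of the Borel simple functions below its positive and negative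
   parts; so it is also the Lebesgue integral for integrands that are merely
   Lebesgue measurable. *)
Definition Cintegral (f : Cn -> C) : C :=
  (\int[leb_Cn R n]_t complex.Re (f (Cn_of_R2 t)))%R +i*
  (\int[leb_Cn R n]_t complex.Im (f (Cn_of_R2 t)))%R.

Definition Linfty_norm (V : Cn -> Cn) : \bar R :=
  ess_sup (leb_Cn R n) (fun t => (cnorm (V (Cn_of_R2 t)))%:E).

(* The real coordinate directions: (j, false) is d/dx_j, (j, true) is d/dy_j,
   where z_j = x_j + i y_j. *)
Definition rdir (d : 'I_n * bool) : Cn :=
  (if d.2 then 0 +i* 1 else 1 : C) *: delta_mx 0 d.1.

Definition rline (f : Cn -> R) (d : 'I_n * bool) (z : Cn) : R -> R :=
  fun s => f (z + s%:C *: rdir d).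

Definition rpartial (d : 'I_n * bool) (f : Cn -> R) : Cn -> R :=
  fun z => derive1 (rline f d z) 0.

Fixpoint rCk (k : nat) (f : Cn -> R) : Prop :=
  match k with
  | 0 => continuous f
  | k.+1 => continuous f /\
      forall d, (forall z, derivable (rline f d z) 0 1) /\ rCk k (rpartial d f)
  end.

Definition cpartial (d : 'I_n * bool) (phi : Cn -> C) : Cn -> C :=
  fun z => rpartial d (fun w => complex.Re (phi w)) z +i*
           rpartial d (fun w => complex.Im (phi w)) z.

Definition smooth (phi : Cn -> C) : Prop :=
  forall k, rCk k (fun w => complex.Re (phi w)) /\
            rCk k (fun w => complex.Im (phi w)).

Definition test_function (phi : Cn -> C) : Prop :=
  smooth phi /\ compact (closure [set z | phi z != 0]).

Definition dzbar (j : 'I_n) (phi : Cn -> C) : Cn -> C :=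
  fun z => 2^-1 * (cpartial (j, false) phi z +
                   (0 +i* 1) * cpartial (j, true) phi z).

(* A (0,1)-form V = \sum_j V_j d\bar z_j is given by its coefficients,
   V_j z = V z 0 j. *)
Definition measurable_form (V : Cn -> Cn) : Prop :=
  forall j, lebesgue_measurable_Cn (fun z => V z 0 j).

(* \bar\partial u = V u in the sense of distributions on C^n. *)
Definition dbar_eq (u : Cn -> C) (V : Cn -> Cn) : Prop :=
  forall (j : 'I_n) (phi : Cn -> C), test_function phi ->
    - Cintegral (fun z => u z * dzbar j phi z) =
    Cintegral (fun z => V z 0 j * u z * phi z).

End Cn.

(* Main.v *)
(* Restrict to the complex line through 0 and z0.  As u need not be
   differentiable, it is first mollified: convolving u and V u with a smooth
   product kernel gives on the line a function U, uniformly close to u, with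
   dbar U = a U up to a small error and |a| <= A, where A depends only on n and
   the norm of V.  If w solves dbar w = a on a large disc, then U e^{-w} is
   almost holomorphic and |w| = O(A R).  Apply the Cauchy-Pompeiu formula at 0 to
   U e^{-w} (z - R)^{-N} eta, the kernel being truncated near R and eta a cutoff
   equal to 1 on |z - R| <= 2R: the singularity contributes at most
   (2R)^N e^{O(R)} sup_{|z - z0| < 1} |u|, the cutoff at most e^{O(R)} 2^{-N}
   by the growth of u, and N ~ R makes the latter negligible.
   Cauchy integrals in the plane are avoided: w and the representation
   formula are Riemann sums in polar coordinates, with errors going to 0 for
   functions with Lipschitz first derivatives. *)
Require Import Defs.
From HB Require Import structures.
From mathcomp Require Import all_boot all_order all_algebra.
From mathcomp Require Import complex ring lra.
From mathcomp Require Import all_classical all_reals all_analysis.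
From mathcomp Require Import measurable_realfun ess_sup_inf.
Import Order.TTheory GRing.Theory Num.Theory.
Import numFieldNormedType.Exports.

Set Implicit Arguments.
Unset Strict Implicit.
Unset Printing Implicit Defensive.

Local Open Scope classical_set_scope.
Local Open Scope complex_scope.
Local Open Scope ring_scope.

Local Notation Re := complex.Re.
Local Notation Im := complex.Im.

(** * The Wirtinger calculus *)

(** A complex line is a null set, so V cannot be restricted to it; this is why the mollification is
    done in C^n first. No regularity of V is required: the mollification of V u differs from the
    product of the mollifications by a quantity that is small on compact sets, because u is
    uniformly continuous there. The error is a parameter d. The mollification radius, the number of
    nodes of the Riemann sums and all Lipschitz constants may blow up as d tends to 0; only A, the
    growth bound of u and N survive in the limit. At 0 the weight (z - R)^-N has modulus R^-N, on
    the cutoff annulus at most (2R)^-N. The gain 2^-N has to beat e^{O(R)}, hence N ~ R, and the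
    price (2R)^N paid at the singularity is the origin of R ln R. A discrete Cauchy transform is a
    finite sum of translates, so its dbar-derivative is the discrete transform of the
    dbar-derivative. One discrete Cauchy-Pompeiu formula therefore serves twice: it shows that w
    nearly solves dbar w = a, and it represents the value at 0. *)

Section cabs_theory.
Context {R : realType}.
Implicit Types (a b z : R[i]) (x y : R).

Lemma cabs_ge0 z : 0 <= cabs z.
Proof. by case: z => x y; exact: sqrtr_ge0. Qed.

Lemma cabsM a b : cabs (a * b) = cabs a * cabs b.
Proof. exact: ComplexField.Normc.normcM. Qed.

Lemma cabsD a b : cabs (a + b) <= cabs a + cabs b.
Proof. exact: le_normcD. Qed.

Lemma cabsN a : cabs (- a) = cabs a.
Proof. exact: normcN. Qed.

Lemma cabs0 : cabs (0 : R[i]) = 0.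
Proof. exact: ComplexField.Normc.normc0. Qed.

Lemma cabs1 : cabs (1 : R[i]) = 1.
Proof. exact: ComplexField.Normc.normc1. Qed.

Lemma cabsV a : cabs a^-1 = (cabs a)^-1.
Proof. exact: ComplexField.Normc.normcV. Qed.

Lemma cabsX a n : cabs (a ^+ n) = cabs a ^+ n.
Proof. by elim: n => [|n IH]; rewrite ?expr0 ?cabs1// !exprS cabsM IH. Qed.

Lemma cabsBC a b : cabs (a - b) = cabs (b - a).
Proof. by rewrite -cabsN opprB. Qed.

Lemma cabsB a b : cabs (a - b) <= cabs a + cabs b.
Proof. by rewrite -(cabsN b); exact: cabsD. Qed.

Lemma cabsJ a : cabs a^* = cabs a.
Proof. by case: a => x y; rewrite /cabs/= sqrrN. Qed.

Lemma cabs_sqr a : cabs a ^+ 2 = Re a ^+ 2 + Im a ^+ 2.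
Proof. by case: a => x y /=; rewrite sqr_sqrtr// addr_ge0// sqr_ge0. Qed.

Lemma cabs_real x : cabs x%:C = `|x|.
Proof. by rewrite /cabs/= expr0n addr0 sqrtr_sqr. Qed.

Lemma cabs_i : cabs ('i : R[i]) = 1.
Proof. by rewrite /cabs/= expr0n add0r expr1n sqrtr1. Qed.

Lemma norm_Re_le a : `|Re a| <= cabs a.
Proof.
by rewrite -(@ler_pXn2r _ 2) ?nnegrE ?cabs_ge0// cabs_sqr real_normK ?num_real//
  lerDl sqr_ge0.
Qed.

Lemma norm_Im_le a : `|Im a| <= cabs a.
Proof.
by rewrite -(@ler_pXn2r _ 2) ?nnegrE ?cabs_ge0// cabs_sqr real_normK ?num_real//
  lerDr sqr_ge0.
Qed.

Lemma cabs_le_ReIm a : cabs a <= `|Re a| + `|Im a|.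
Proof.
rewrite -(@ler_pXn2r _ 2) ?nnegrE ?addr_ge0 ?cabs_ge0// cabs_sqr sqrrD.
rewrite !real_normK ?num_real// lerD2r lerDl mulrn_wge0// mulr_ge0//.
Qed.

Lemma cabs_sum (I : Type) (r : seq I) (P : pred I) (F : I -> R[i]) :
  cabs (\sum_(i <- r | P i) F i) <= \sum_(i <- r | P i) cabs (F i).
Proof.
elim/big_rec2: _ => [|i x y _ IH]; first by rewrite cabs0.
by apply: le_trans (cabsD _ _) _; rewrite lerD2l.
Qed.

Lemma cabsM_le a b x y : cabs a <= x -> cabs b <= y -> cabs (a * b) <= x * y.
Proof. by move=> ? ?; rewrite cabsM ler_pM// cabs_ge0. Qed.

Lemma cabsD_le a b x y : cabs a <= x -> cabs b <= y -> cabs (a + b) <= x + y.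
Proof. by move=> ? ?; apply: le_trans (cabsD _ _) _; rewrite lerD. Qed.

Lemma cabsB_le a b x y : cabs a <= x -> cabs b <= y -> cabs (a - b) <= x + y.
Proof. by rewrite -(cabsN b); exact: cabsD_le. Qed.

Lemma cabs_tri a b : cabs a <= cabs b + cabs (a - b).
Proof. by have := cabsD b (a - b); rewrite addrC subrK. Qed.

Lemma mulcJ a : a * a^* = (cabs a ^+ 2)%:C.
Proof.
rewrite cabs_sqr; case: a => x y /=; apply/eqP; rewrite eq_complex /=.
by rewrite !(mulrN, opprK) -!expr2 eqxx (mulrC y) addNr eqxx.
Qed.

Lemma conjcM a b : (a * b)^* = a^* * b^*.
Proof. exact: rmorphM. Qed.

Lemma conjcD a b : (a + b)^* = a^* + b^*.
Proof. exact: rmorphD. Qed.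

Lemma conjcN a : (- a)^* = - a^*.
Proof. exact: rmorphN. Qed.

Lemma conjc_realC x : (x%:C)^* = x%:C.
Proof. exact: conjc_real. Qed.

End cabs_theory.

Section quadratic_class.
Context {R : realType}.
Implicit Types (S : R[i] -> Prop) (f g p q : R[i] -> R[i]) (z h : R[i]).

(* A quantitative C^{1,1} condition: [p] and [q] are the Wirtinger derivatives
   [dg/dz] and [dg/d\bar z] of [g] on [S]. *)
Definition wirtinger (K : R) S g p q :=
  forall z, S z -> [/\ cabs (g z) <= K, cabs (p z) <= K & cabs (q z) <= K] /\
    forall h, S (z + h) ->
      [/\ cabs (g (z + h) - g z) <= K * cabs h,
          cabs (p (z + h) - p z) <= K * cabs h,
          cabs (q (z + h) - q z) <= K * cabs h &
          cabs (g (z + h) - g z - p z * h - q z * h^*) <= K * cabs h ^+ 2].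

Lemma wirtinger_le K L S g p q : K <= L ->
  wirtinger K S g p q -> wirtinger L S g p q.
Proof.
move=> KL H z Sz; have [[h1 h2 h3] H2] := H _ Sz.
split; first by split; exact: le_trans KL.
move=> h Sh; have [k1 k2 k3 k4] := H2 _ Sh.
by split; apply: le_trans; (try eassumption); rewrite ler_wpM2r ?exprn_ge0 ?cabs_ge0.
Qed.

Lemma wirtinger_sub K S T g p q : (forall z, T z -> S z) ->
  wirtinger K S g p q -> wirtinger K T g p q.
Proof.
move=> TS H z Tz; have [H1 H2] := H _ (TS _ Tz).
by split => // h Th; exact: (H2 _ (TS _ Th)).
Qed.

Lemma wirtinger_ext K S g p q g' p' q' :
  g =1 g' -> p =1 p' -> q =1 q' -> wirtinger K S g p q -> wirtinger K S g' p' q'.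
Proof. by move=> /funext -> /funext -> /funext ->. Qed.

Lemma wirtingerD K L S f p q g p' q' :
  wirtinger K S f p q -> wirtinger L S g p' q' ->
  wirtinger (K + L) S (fun z => f z + g z) (fun z => p z + p' z)
    (fun z => q z + q' z).
Proof.
move=> F G z Sz; have [[f1 f2 f3] F2] := F _ Sz; have [[g1 g2 g3] G2] := G _ Sz.
split; first by split; exact: cabsD_le.
move=> h Sh; have [k1 k2 k3 k4] := F2 _ Sh; have [l1 l2 l3 l4] := G2 _ Sh.
rewrite !mulrDl; split.
- by rewrite opprD addrACA; exact: cabsD_le.
- by rewrite opprD addrACA; exact: cabsD_le.
- by rewrite opprD addrACA; exact: cabsD_le.
- have -> : f (z + h) + g (z + h) - (f z + g z) - (p z * h + p' z * h) -
     (q z * h^* + q' z * h^*) = (f (z + h) - f z - p z * h - q z * h^*) +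
     (g (z + h) - g z - p' z * h - q' z * h^*) by ring.
  exact: cabsD_le.
Qed.

Lemma wirtingerM K L S f p q g p' q' : 0 <= K -> 0 <= L ->
  wirtinger K S f p q -> wirtinger L S g p' q' ->
  wirtinger (4 * (K * L)) S (fun z => f z * g z)
    (fun z => p z * g z + f z * p' z) (fun z => q z * g z + f z * q' z).
Proof.
move=> K0 L0 F G.
have KL0 : 0 <= K * L by rewrite mulr_ge0.
have aux (a b a' b' c d c' d' : R[i]) (x : R) : 0 <= x ->
  cabs b' <= L -> cabs (a' - a) <= K * x -> cabs a <= K -> cabs (b' - b) <= L * x ->
  cabs d' <= L -> cabs (c' - c) <= K * x -> cabs c <= K -> cabs (d' - d) <= L * x ->
  cabs (a' * b' + c' * d' - (a * b + c * d)) <= 4 * (K * L) * x.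
  move=> x0 h1 h2 h3 h4 h5 h6 h7 h8.
  have -> : a' * b' + c' * d' - (a * b + c * d) =
    (a' - a) * b' + a * (b' - b) + ((c' - c) * d' + c * (d' - d)) by ring.
  apply: (@le_trans _ _ (K * x * L + K * (L * x) + (K * x * L + K * (L * x)))).
    by apply: cabsD_le; apply: cabsD_le; apply: cabsM_le.
  by rewrite le_eqVlt; apply/orP; left; apply/eqP; ring.
move=> z Sz; have [[f1 f2 f3] F2] := F _ Sz; have [[g1 g2 g3] G2] := G _ Sz.
split.
  split.
  - apply: (le_trans (cabsM_le f1 g1)); lra.
  - apply: (le_trans (cabsD_le (cabsM_le f2 g1) (cabsM_le f1 g2))); lra.
  - apply: (le_trans (cabsD_le (cabsM_le f3 g1) (cabsM_le f1 g3))); lra.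
move=> h Sh; have [k1 k2 k3 k4] := F2 _ Sh; have [l1 l2 l3 l4] := G2 _ Sh.
have [[f1' f2' f3'] _] := F _ Sh; have [[g1' g2' g3'] _] := G _ Sh.
have h0 := cabs_ge0 h.
split.
- have -> : f (z + h) * g (z + h) - f z * g z =
    (f (z + h) - f z) * g (z + h) + f z * (g (z + h) - g z) by ring.
  apply: (le_trans (cabsD_le (cabsM_le k1 g1') (cabsM_le f1 l1))).
  have : 0 <= K * L * cabs h by rewrite mulr_ge0.
  lra.
- by apply: aux.
- by apply: aux.
- have -> : f (z + h) * g (z + h) - f z * g z - (p z * g z + f z * p' z) * h -
      (q z * g z + f z * q' z) * h^* =
    (f (z + h) - f z - p z * h - q z * h^*) * g z +
    f z * (g (z + h) - g z - p' z * h - q' z * h^*) +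
    (f (z + h) - f z) * (g (z + h) - g z) by ring.
  apply: (le_trans (cabsD_le (cabsD_le (cabsM_le k4 g1) (cabsM_le f1 l4))
    (cabsM_le k1 l1))).
  have : 0 <= K * L * cabs h ^+ 2 by rewrite mulr_ge0 ?exprn_ge0.
  lra.
Qed.

Lemma wirtinger_cst S c : wirtinger (cabs c) S (fun=> c) (fun=> 0) (fun=> 0).
Proof.
move=> z _; rewrite cabs0 !cabs_ge0; split => // h _.
by rewrite subrr !mul0r !subr0 cabs0 !mulr_ge0 ?exprn_ge0 ?cabs_ge0.
Qed.

Lemma wirtingerZ K S c f p q : 0 <= K -> wirtinger K S f p q ->
  wirtinger (cabs c * K) S (fun z => c * f z) (fun z => c * p z)
    (fun z => c * q z).
Proof.
move=> K0 F z Sz; have [[f1 f2 f3] F2] := F _ Sz.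
split; first by split; rewrite cabsM ler_wpM2l ?cabs_ge0.
move=> h Sh; have [k1 k2 k3 k4] := F2 _ Sh.
rewrite -!mulrA -!mulrBr !cabsM.
by split; rewrite ler_wpM2l ?cabs_ge0.
Qed.

Lemma wirtinger_sum (I : Type) (r : seq I) (K : I -> R) S (f p q : I -> R[i] -> R[i]) :
  (forall i, wirtinger (K i) S (f i) (p i) (q i)) ->
  wirtinger (\sum_(i <- r) K i) S (fun z => \sum_(i <- r) f i z)
    (fun z => \sum_(i <- r) p i z) (fun z => \sum_(i <- r) q i z).
Proof.
move=> F; elim: r => [|i r IH].
  apply: (@wirtinger_ext _ _ (fun=> 0) (fun=> 0) (fun=> 0)) => [z|z|z|];
    rewrite ?big_nil//; have := @wirtinger_cst S 0; rewrite cabs0; exact.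
rewrite big_cons; apply: wirtinger_ext (wirtingerD (F i) IH) => z;
  by rewrite big_cons.
Qed.

Lemma wirtinger_translate K S f p q c : wirtinger K S f p q ->
  wirtinger K (fun z => S (z + c)) (fun z => f (z + c)) (fun z => p (z + c))
    (fun z => q (z + c)).
Proof.
move=> F z Sz; have [F1 F2] := F _ Sz; split => // h; rewrite addrAC => Sh.
exact: F2.
Qed.

(** The real counterpart of [wirtinger], for the outer function of a composition. It asks for a
    Lipschitz derivative only, so piecewise formulas with matching first derivatives qualify. *)
Definition quadratic (L : R) (I : R -> Prop) (phi dphi : R -> R) :=
  forall s, I s -> [/\ `|phi s| <= L & `|dphi s| <= L] /\
    forall t, I (s + t) ->
      [/\ `|phi (s + t) - phi s| <= L * `|t|,
          `|dphi (s + t) - dphi s| <= L * `|t| &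
          `|phi (s + t) - phi s - dphi s * t| <= L * `|t| ^+ 2].

(** Expanding phi at r(z) leaves L (K|h|)^2, and replacing the increment of r by its linear part
    leaves L K |h|^2; together with the bound L of the values this gives the constant. *)
Lemma wirtinger_comp K L S I (r : R[i] -> R) p q phi dphi : 0 <= K -> 0 <= L ->
  wirtinger K S (fun z => (r z)%:C) p q -> quadratic L I phi dphi ->
  (forall z, S z -> I (r z)) ->
  wirtinger (L * (K ^+ 2 + K + 1)) S (fun z => (phi (r z))%:C)
    (fun z => (dphi (r z))%:C * p z) (fun z => (dphi (r z))%:C * q z).
Proof.
move=> K0 L0 F P SI z Sz; have [[f1 f2 f3] F2] := F _ Sz.
have [[g1 g2] P2] := P _ (SI _ Sz).
have LK0 : 0 <= L * K by rewrite mulr_ge0.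
have LKK0 : 0 <= L * K ^+ 2 by rewrite mulr_ge0 ?exprn_ge0.
split.
  split; rewrite ?cabs_real.
  - apply: (le_trans g1); lra.
  - have : cabs ((dphi (r z))%:C * p z) <= L * K by apply: cabsM_le; rewrite ?cabs_real.
    lra.
  - have : cabs ((dphi (r z))%:C * q z) <= L * K by apply: cabsM_le; rewrite ?cabs_real.
    lra.
move=> h Sh; have [k1 k2 k3 k4] := F2 _ Sh.
have [[f1' f2' f3'] _] := F _ Sh.
have e : r z + (r (z + h) - r z) = r (z + h) by rewrite addrC subrK.
have := P2 (r (z + h) - r z); rewrite e => /(_ (SI _ Sh))[l1 l2 l3].
have [[g1' g2'] _] := P _ (SI _ Sh).
have dr : `|r (z + h) - r z| <= K * cabs h.
  by rewrite -cabs_real rmorphB.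
have h0 := cabs_ge0 h.
have l1' : `|phi (r (z + h)) - phi (r z)| <= L * (K * cabs h).
  by apply: le_trans l1 _; rewrite ler_wpM2l.
have l2' : `|dphi (r (z + h)) - dphi (r z)| <= L * (K * cabs h).
  by apply: le_trans l2 _; rewrite ler_wpM2l.
have l3' : `|phi (r (z + h)) - phi (r z) - dphi (r z) * (r (z + h) - r z)| <=
    L * (K * cabs h) ^+ 2.
  by apply: le_trans l3 _; rewrite ler_wpM2l// lerXn2r ?nnegrE ?mulr_ge0.
have LKh : 0 <= L * K * cabs h by rewrite mulr_ge0.
have LKKh : 0 <= L * K ^+ 2 * cabs h by rewrite mulr_ge0.
have Lh : 0 <= L * cabs h by rewrite mulr_ge0.
have dp (a a' : R[i]) : cabs a' <= K -> cabs (a' - a) <= K * cabs h ->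
  cabs ((dphi (r (z + h)))%:C * a' - (dphi (r z))%:C * a) <=
   L * (K ^+ 2 + K + 1) * cabs h.
  move=> a1 a2; rewrite (_ : _ - _ = (dphi (r (z + h)) - dphi (r z))%:C * a' +
    (dphi (r z))%:C * (a' - a)); last by rewrite rmorphB/=; ring.
  apply: (le_trans (cabsD_le (cabsM_le (x := L * (K * cabs h)) _ a1)
    (cabsM_le (x := L) _ a2))); rewrite ?cabs_real//.
  lra.
split; [|exact: dp|exact: dp|].
  rewrite -rmorphB cabs_real; apply: (le_trans l1'); lra.
have -> : (phi (r (z + h)))%:C - (phi (r z))%:C - (dphi (r z))%:C * p z * h -
    (dphi (r z))%:C * q z * h^* =
  (phi (r (z + h)) - phi (r z) - dphi (r z) * (r (z + h) - r z))%:C +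
  (dphi (r z))%:C * ((r (z + h))%:C - (r z)%:C - p z * h - q z * h^*).
  by rewrite !(rmorphB, rmorphM)/=; ring.
apply: (le_trans (cabsD_le (x := L * (K * cabs h) ^+ 2) _ (cabsM_le (x := L) _ k4)));
  rewrite ?cabs_real//.
have : 0 <= L * cabs h ^+ 2 by rewrite mulr_ge0 ?exprn_ge0.
lra.
Qed.

Lemma wirtinger_id S D : 1 <= D -> (forall z, S z -> cabs z <= D) ->
  wirtinger D S id (fun=> 1) (fun=> 0).
Proof.
move=> D1 SD z Sz; have D0 : 0 <= D by lra.
rewrite cabs0 cabs1 SD//; split => // h Sh.
rewrite !subrr mul1r mul0r [z + h]addrC addrK subrr subr0 cabs0.
have h0 := cabs_ge0 h.
by split; rewrite ?mulr_ge0 ?exprn_ge0 // -{1}(mul1r (cabs h)) ler_wpM2r.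
Qed.

Lemma wirtinger_conj S D : 1 <= D -> (forall z, S z -> cabs z <= D) ->
  wirtinger D S (fun z => z^*) (fun=> 0) (fun=> 1).
Proof.
move=> D1 SD z Sz; have D0 : 0 <= D by lra.
rewrite cabs0 cabs1 cabsJ SD//; split => // h Sh.
rewrite !subrr mul1r mul0r rmorphD [_ + h^*]addrC addrK subr0 subrr cabs0.
have h0 := cabs_ge0 h.
by split; rewrite ?mulr_ge0 ?exprn_ge0 // cabsJ -{1}(mul1r (cabs h)) ler_wpM2r.
Qed.

End quadratic_class.

Section mean_value_bounds.
Context {R : realType}.
Implicit Types (f df ddf : R -> R) (x y t L : R).

Lemma le_derive_bound f df L x y : (forall c, is_derive c (1 : R) f (df c)) ->
  (forall c, Num.min x y <= c <= Num.max x y -> `|df c| <= L) ->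
  `|f y - f x| <= L * `|y - x|.
Proof.
move=> fdf; wlog xy : x y / x <= y => [wh H|H].
  have [|/ltW] := leP x y; first by move=> /wh; exact.
  by move=> /wh; rewrite minC maxC => /(_ H); rewrite distrC (distrC x).
have cf : {within `[x, y], continuous f}.
  apply: derivable_within_continuous => z _.
  by have := fdf z => -[].
have [c cI ->] := MVT_segment xy (fun z _ => fdf z) cf.
by rewrite normrM ler_wpM2r// H// min_l// max_r//; rewrite in_itv/= in cI.
Qed.

Lemma le_taylor2 f df ddf L x t : (forall c, is_derive c (1 : R) f (df c)) ->
  (forall c, is_derive c (1 : R) df (ddf c)) ->
  (forall c, Num.min x (x + t) <= c <= Num.max x (x + t) -> `|ddf c| <= L) ->
  `|f (x + t) - f x - df x * t| <= L * `|t| ^+ 2.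
Proof.
move=> fdf dfddf H.
have H2 c : Num.min x (x + t) <= c <= Num.max x (x + t) ->
    `|df c - df x| <= L * `|t|.
  move=> cI; have L0 : 0 <= L by apply: le_trans (H _ cI).
  apply: (@le_trans _ _ (L * `|c - x|)).
    apply: le_derive_bound => // d dI; apply: H; move: cI dI.
    rewrite !ge_min !le_max => /andP[/orP[]? /orP[]?] /andP[/orP[]? /orP[]?];
      apply/andP; split; apply/orP; try (by left; lra); try (by right; lra).
  rewrite ler_wpM2l//; move: cI; rewrite ge_min le_max ler_norml.
  have := ler_norm t; have := ler_norm (- t); rewrite normrN.
  by move=> ? ? /andP[/orP[]? /orP[]?]; apply/andP; split; lra.
(* The tangent at x is subtracted: between x and x + t the derivative of [g] is at most L|t|, and
   the mean value bound gives L|t|^2, without the factor 1/2. *)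
pose g := fun z => f z - df x * z.
have gE : f (x + t) - f x - df x * t = g (x + t) - g x by rewrite /g; ring.
rewrite gE expr2 mulrA.
have := @le_derive_bound g (fun c => df c - df x) (L * `|t|) x (x + t).
rewrite [x + t - x]addrC addKr; apply => // c.
rewrite /g; apply: is_deriveB.
by rewrite -[X in is_derive _ _ _ X]mulr1; exact: is_deriveZ.
Qed.

End mean_value_bounds.

Section complex_exponential.
Context {R : realType}.
Implicit Types (x y t : R) (z w h : R[i]).

Definition cexp z : R[i] := (expR (Re z))%:C * (cos (Im z) +i* sin (Im z)).

Lemma cexpD z w : cexp (z + w) = cexp z * cexp w.
Proof.
case: z w => [a b] [c d]; rewrite /cexp/= expRD cosD sinD rmorphM/=.
rewrite -mulrACA; congr (_ * _); apply/eqP; rewrite eq_complex/=.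
by rewrite eqxx addrC eqxx.
Qed.

Lemma cexp0 : cexp 0 = 1.
Proof. by rewrite /cexp/= expR0 cos0 sin0 mul1r. Qed.

Lemma cabs_cexp z : cabs (cexp z) = expR (Re z).
Proof.
rewrite /cexp cabsM cabs_real ger0_norm ?expR_ge0//.
by rewrite /cabs/= cos2Dsin2 sqrtr1 mulr1.
Qed.

Lemma norm_cosB1 y : `|cos y - 1| <= y ^+ 2.
Proof.
have := @le_taylor2 _ cos (fun y => - sin y) (fun y => - cos y) 1 0 y.
rewrite add0r cos0 sin0 oppr0 mul0r subr0 mul1r real_normK ?num_real//; apply.
by move=> c _; rewrite normrN cos_max.
Qed.

Lemma norm_sinB y : `|sin y - y| <= y ^+ 2.
Proof.
have := @le_taylor2 _ sin cos (fun y => - sin y) 1 0 y.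
rewrite add0r cos0 sin0 subr0 mul1r mul1r real_normK ?num_real//; apply.
by move=> c _; rewrite normrN sin_max.
Qed.

Lemma norm_expRB1 D x : `|x| <= D -> `|expR x - 1| <= expR D * `|x|.
Proof.
move=> xD; have := @le_derive_bound _ expR expR (expR D) 0 x.
rewrite expR0 subr0; apply=> c.
rewrite ger0_norm ?expR_ge0// ler_expR => /andP[_]; rewrite le_max.
have := ler_norm x; have := normr_ge0 x.
by move=> ? ? /orP[?|?]; lra.
Qed.

Lemma norm_expRB1B D x : `|x| <= D -> `|expR x - 1 - x| <= expR D * x ^+ 2.
Proof.
move=> xD; have := @le_taylor2 _ expR expR expR (expR D) 0 x.
rewrite add0r expR0 mul1r real_normK ?num_real//.
apply=> c.
rewrite ger0_norm ?expR_ge0// ler_expR => /andP[_]; rewrite le_max.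
have := ler_norm x; have := normr_ge0 x.
by move=> ? ? /orP[?|?]; lra.
Qed.

Lemma cabs_cexpB1B D h : cabs h <= D ->
  cabs (cexp h - 1 - h) <= 3 * expR D * cabs h ^+ 2.
Proof.
move=> hD; have := le_trans (norm_Re_le h) hD; rewrite cabs_sqr.
have := cabs_le_ReIm (cexp h - 1 - h); case: h {hD} => x y; rewrite /cexp/=.
rewrite !mul0r !subr0 addr0 => H xD; apply: le_trans H _.
have D0 : 0 <= D by exact: le_trans xD.
have eD : 1 <= expR D by rewrite -expR0 ler_expR.
have ex : expR x <= expR D by rewrite ler_expR (le_trans (ler_norm x)).
have -> : expR x * cos y - 1 - x = expR x * (cos y - 1) + (expR x - 1 - x) by ring.
have -> : expR x * sin y - y = expR x * (sin y - y) + (expR x - 1) * y by ring.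
apply: le_trans (lerD (ler_normD _ _) (ler_normD _ _)) _.
rewrite !normrM (ger0_norm (expR_ge0 x)).
have h1 : expR x * `|cos y - 1| <= expR D * y ^+ 2.
  by apply: ler_pM => //; rewrite ?expR_ge0// norm_cosB1.
have h2 : expR x * `|sin y - y| <= expR D * y ^+ 2.
  by apply: ler_pM => //; rewrite ?expR_ge0// norm_sinB.
have h3 := norm_expRB1B xD.
have h4 : `|expR x - 1| * `|y| <= expR D * `|x| * `|y|.
  by rewrite ler_wpM2r// norm_expRB1.
have h5 : expR D * (`|x| * `|y|) <= expR D * (x ^+ 2 + y ^+ 2).
  rewrite ler_wpM2l ?expR_ge0// -(real_normK (num_real x)) -(real_normK (num_real y)).
  have := sqr_ge0 (`|x| - `|y|); have := sqr_ge0 (`|x| + `|y|).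
  rewrite sqrrB sqrrD; lra.
have ? : 0 <= expR D * x ^+ 2 by rewrite mulr_ge0 ?expR_ge0 ?sqr_ge0.
rewrite mulrA in h5; lra.
Qed.

(** The functional equation turns the increment of e^g into e^{g(z)} (e^d - 1) with d = g(z + h) -
    g(z). As |d| <= 2K on S, the second-order bound for the exponential at 0 applies uniformly. *)
Lemma wirtinger_cexp K S g p q : 0 <= K -> wirtinger K S g p q ->
  exists2 L, 0 <= L & wirtinger L S (fun z => cexp (g z))
    (fun z => cexp (g z) * p z) (fun z => cexp (g z) * q z).
Proof.
move=> K0 G; set E := expR (2 * K).
have E0 : 0 <= E by exact: expR_ge0.
have E1 : 1 <= E by rewrite -[leLHS]expR0 ler_expR; lra.
have bE z : S z -> cabs (cexp (g z)) <= E.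
  move=> Sz; rewrite cabs_cexp ler_expR.
  have [[g1 _ _] _] := G _ Sz.
  by apply: (le_trans (ler_norm _)); apply: (le_trans (norm_Re_le _)); lra.
set L1 := E * (3 * E * (2 * K) * K + K).
have K2 : 0 <= K ^+ 2 by rewrite exprn_ge0.
have L10 : 0 <= L1 by rewrite /L1 mulr_ge0// addr_ge0// !mulr_ge0.
have EE0 : 0 <= E * E by exact: mulr_ge0.
have inc z h : S z -> S (z + h) ->
    cabs (cexp (g (z + h)) - cexp (g z)) <= L1 * cabs h /\
    cabs (cexp (g (z + h)) - cexp (g z) - cexp (g z) * p z * h -
      cexp (g z) * q z * h^*) <= (E * (3 * E * K ^+ 2 + K)) * cabs h ^+ 2.
  move=> Sz Sh; have [[g1 _ _] G2] := G _ Sz; have [k1 _ _ k4] := G2 _ Sh.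
  have [[g1' _ _] _] := G _ Sh.
  set d := g (z + h) - g z.
  have dK : cabs d <= 2 * K by apply: (le_trans (cabsB_le g1' g1)); lra.
  have ed := cabs_cexpB1B dK.
  have -> : cexp (g (z + h)) = cexp (g z) * cexp d by rewrite -cexpD /d [g z + _]addrC subrK.
  have h0 := cabs_ge0 h; have d0 := cabs_ge0 d; split.
    have -> : cexp (g z) * cexp d - cexp (g z) = cexp (g z) * ((cexp d - 1 - d) + d).
      by ring.
    rewrite /L1 -mulrA; apply: cabsM_le (bE _ Sz) _.
    rewrite mulrDl; apply: (cabsD_le _ k1).
    apply: le_trans ed _; rewrite expr2 -!mulrA ler_wpM2l// ler_wpM2l//.
    have := ler_pM d0 d0 dK k1; lra.
  have -> : cexp (g z) * cexp d - cexp (g z) - cexp (g z) * p z * h -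
     cexp (g z) * q z * h^* =
     cexp (g z) * ((cexp d - 1 - d) + (d - p z * h - q z * h^*)) by ring.
  rewrite -mulrA; apply: cabsM_le (bE _ Sz) _.
  rewrite mulrDl; apply: cabsD_le k4.
  apply: le_trans ed _; rewrite -!mulrA ler_wpM2l// ler_wpM2l//.
  have -> : K * (K * cabs h ^+ 2) = (K * cabs h) ^+ 2 by ring.
  by rewrite ler_pXn2r// nnegrE// mulr_ge0.
set L2 := (E * (3 * E * K ^+ 2 + K)).
have L20 : 0 <= L2 by rewrite /L2 mulr_ge0// addr_ge0// !mulr_ge0.
have EK0 : 0 <= E * K by exact: mulr_ge0.
have L1K0 : 0 <= L1 * K by exact: mulr_ge0.
exists (E + E * K + L1 + L1 * K + L2) => [|z Sz]; first by rewrite !addr_ge0.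
have [[g1 g2 g3] G2] := G _ Sz; split.
  have := bE _ Sz; have := cabsM_le (bE _ Sz) g2; have := cabsM_le (bE _ Sz) g3.
  by split; lra.
move=> h Sh; have [k1 k2 k3 k4] := G2 _ Sh; have [i1 i2] := inc _ _ Sz Sh.
have [[g1' g2' g3'] _] := G _ Sh; have h0 := cabs_ge0 h.
have aux a a' : cabs a' <= K -> cabs (a' - a) <= K * cabs h ->
   cabs (cexp (g (z + h)) * a' - cexp (g z) * a) <=
   (E + E * K + L1 + L1 * K + L2) * cabs h.
  move=> a1 a2; have -> : cexp (g (z + h)) * a' - cexp (g z) * a =
    (cexp (g (z + h)) - cexp (g z)) * a' + cexp (g z) * (a' - a) by ring.
  apply: (le_trans (cabsD_le (cabsM_le i1 a1) (cabsM_le (bE _ Sz) a2))).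
  rewrite -subr_ge0.
  rewrite (_ : _ - _ = E * cabs h + L1 * cabs h + L2 * cabs h); last by ring.
  by rewrite !addr_ge0// mulr_ge0.
split; [|exact: aux|exact: aux|].
  apply: (le_trans i1); rewrite ler_wpM2r//; lra.
by apply: (le_trans i2); rewrite ler_wpM2r ?exprn_ge0//; rewrite -/L2; lra.
Qed.

End complex_exponential.

(** * The discrete Cauchy-Pompeiu formula *)

Section discrete_cauchy_pompeiu.
Context {R : realType}.
Implicit Types (L r : R) (z w h zeta : R[i]) (J : nat).

Definition unit_root J : R[i] := cexp (0 +i* (pi *+ 2 / J%:R)).

(* A Riemann sum, in polar coordinates centred at [zeta] and with [J] steps in
   each variable, for the Cauchy transform
   [- 1/pi \int a(z) / (z - zeta) dA(z)] over the disc of radius [L]; the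
   Jacobian [r] cancels the singularity of the kernel. *)
Definition cauchy_sum J L (a : R[i] -> R[i]) zeta : R[i] :=
  \sum_(j < J) \sum_(k < J)
    ((- (2 * L / J%:R ^+ 2))%:C * (unit_root J ^+ k)^*) *
    a (zeta + (j.+1%:R * (L / J%:R))%:C * unit_root J ^+ k).

Lemma cabs_unit_root J k : cabs (unit_root J ^+ k) = 1.
Proof. by rewrite cabsX cabs_cexp expR0 expr1n. Qed.

Lemma unit_rootX J k :
  unit_root J ^+ k = cexp (0 +i* (k%:R * (pi *+ 2 / J%:R))) :> R[i].
Proof.
elim: k => [|k IH]; first by rewrite expr0 mul0r cexp0.
rewrite exprSr IH /unit_root -cexpD; congr cexp; apply/eqP.
rewrite eq_complex/= addr0 eqxx/=; set x := _ / _.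
by rewrite -natr1 [(_ + _) * _]mulrDl mul1r.
Qed.

Lemma unit_root1 J : (0 < J)%N -> unit_root J ^+ J = 1 :> R[i].
Proof.
move=> J0; rewrite unit_rootX mulrC divfK ?pnatr_eq0 -?lt0n//.
rewrite /cexp/= expR0 rmorph1 mul1r; apply/eqP; rewrite eq_complex/=.
by rewrite cos2pi sin2pi !eqxx.
Qed.

Lemma unit_rootB J : cabs (unit_root J - 1 - (0 +i* (pi *+ 2 / J%:R))) <=
  2 * (pi *+ 2 / J%:R) ^+ 2 :> R.
Proof.
apply: le_trans (cabs_le_ReIm _) _; rewrite /unit_root /cexp/= expR0.
rewrite !(mul0r, mul1r, subr0, addr0).
have := norm_cosB1 (pi *+ 2 / J%:R : R); have := norm_sinB (pi *+ 2 / J%:R : R).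
lra.
Qed.

Lemma cabs_cexp_iB1 (x : R) : 0 <= x -> cabs (cexp (0 +i* x) - 1) <= 2 * x :> R.
Proof.
move=> x0; apply: le_trans (cabs_le_ReIm _) _; rewrite /cexp/= expR0.
rewrite !(mul0r, mul1r, subr0, addr0).
have c1 : `|cos x - 1| <= x.
  have := @le_derive_bound _ cos (fun y => - sin y) 1 0 x.
  rewrite cos0 subr0 mul1r (ger0_norm x0); apply => [c _].
  by rewrite normrN sin_max.
have s1 : `|sin x| <= x.
  have := @le_derive_bound _ sin cos 1 0 x.
  by rewrite sin0 !subr0 mul1r (ger0_norm x0); apply => [c _]; exact: cos_max.
lra.
Qed.

Lemma pi_le4 : pi <= 4 :> R.
Proof. by have := @pihalf_lt2 R; lra. Qed.

Lemma cabs_cauchy_sum J L A a zeta : (0 < J)%N -> 0 <= L ->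
  (forall z, cabs (z - zeta) <= L -> cabs (a z) <= A) ->
  cabs (cauchy_sum J L a zeta) <= 2 * L * A.
Proof.
move=> J0 L0 aA.
have J0' : (0 : R) < J%:R by rewrite ltr0n.
have A0 : 0 <= A by apply: le_trans (aA zeta _); rewrite ?cabs_ge0// subrr cabs0.
have -> : 2 * L * A = \sum_(j < J) \sum_(k < J) (2 * L / J%:R ^+ 2 * A).
  rewrite !sumr_const !card_ord -[RHS]mulrnA -[RHS]mulr_natr natrM.
  by field; rewrite gt_eqF.
apply: le_trans (cabs_sum _ _ _) _; apply: ler_sum => j _.
apply: le_trans (cabs_sum _ _ _) _; apply: ler_sum => k _.
apply: cabsM_le.
  rewrite cabsM cabs_real cabsJ cabs_unit_root mulr1 normrN ger0_norm//.
  by rewrite divr_ge0 ?mulr_ge0// exprn_ge0// ltW.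
apply: aA; rewrite addrC addKr cabsM cabs_unit_root mulr1 cabs_real.
rewrite ger0_norm; last by rewrite mulr_ge0// divr_ge0// ltW.
rewrite mulrCA ler_piMr// ler_pdivrMr// mul1r ler_nat; exact: ltn_ord.
Qed.

Section estimate.
Variables (J : nat) (L K : R) (S : R[i] -> Prop) (g p q : R[i] -> R[i]) (zeta : R[i]).
Hypothesis J0 : (0 < J)%N.
Hypothesis L0' : 0 < L.
Hypothesis K0 : 0 <= K.
Hypothesis gpq : wirtinger K S g p q.
Hypothesis SL : forall z, cabs (z - zeta) <= L -> S z.

Let L0 : 0 <= L. Proof. exact: ltW. Qed.
Let w := unit_root J.
Let al : R := pi *+ 2 / J%:R.
Let hr : R := L / J%:R.
Let pt (j k : nat) : R[i] := zeta + (j%:R * hr)%:C * w ^+ k.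
(* radial and tangential derivatives of [g] *)
Let Dr (j k : nat) : R[i] := p (pt j k) * w ^+ k + q (pt j k) * (w ^+ k)^*.
Let Dt (j k : nat) : R[i] := 'i * (p (pt j k) * w ^+ k - q (pt j k) * (w ^+ k)^*).

Let J0' : (0 : R) < J%:R. Proof. by rewrite ltr0n. Qed.
Let hr0 : 0 <= hr. Proof. by rewrite divr_ge0// ltW. Qed.
Let al0 : 0 <= al. Proof. by apply: divr_ge0; [rewrite mulrn_wge0// pi_ge0|exact: ltW]. Qed.
Let wk k : cabs (w ^+ k) = 1. Proof. exact: cabs_unit_root. Qed.
Let Jal : J%:R * al = pi *+ 2. Proof. by rewrite /al mulrC divfK ?gt_eqF. Qed.
Let Jhr : J%:R * hr = L. Proof. by rewrite /hr mulrC divfK ?gt_eqF. Qed.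

Let Spt j k : (j <= J)%N -> S (pt j k).
Proof.
move=> jJ; apply: SL; rewrite /pt [zeta + _]addrC addrK cabsM wk mulr1 cabs_real.
by rewrite ger0_norm ?mulr_ge0// -Jhr ler_wpM2r// ler_nat.
Qed.

(** The derivatives are sampled at the outer end [pt j.+1 k] of each step, so the first-order
    expansion is taken backwards, with increment - hr w^k; the differences telescope along the
    ray. *)
Let radial k : cabs (\sum_(j < J) Dr j.+1 k * hr%:C - (g (pt J k) - g (pt 0 k))) <=
  K * L * hr.
Proof.
have -> : g (pt J k) - g (pt 0 k) = \sum_(j < J) (g (pt j.+1 k) - g (pt j k)).
  by rewrite -(big_mkord xpredT (fun j => g (pt j.+1 k) - g (pt j k))) telescope_sumr.
rewrite -sumrB; apply: le_trans (cabs_sum _ _ _) _.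
have -> : K * L * hr = \sum_(j < J) (K * hr ^+ 2).
  by rewrite sumr_const card_ord -[RHS]mulr_natr -Jhr; ring.
apply: ler_sum => j _.
have [_ /(_ (- (hr%:C * w ^+ k)))] := gpq (@Spt j.+1 k (ltn_ord j)).
have -> : pt j.+1 k + - (hr%:C * w ^+ k) = pt j k.
  by rewrite /pt -natr1 mulrDl mul1r rmorphD/= mulrDl addrA addrK.
case/(_ (Spt k (ltnW (ltn_ord j)))) => _ _ _.
rewrite cabsN cabsM wk mulr1 cabs_real ger0_norm//.
have -> : (- (hr%:C * w ^+ k))^* = - (hr%:C * (w ^+ k)^*).
  by rewrite conjcN conjcM conjc_realC.
congr (cabs _ <= _); rewrite /Dr; ring.
Qed.

(** The differences around a full circle telescope to 0 because w^J = 1. All errors of one step,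
    including the one in w - 1 = i al + O(al^2), carry a factor r, which can be divided out; r is
    positive since the radial nodes start at index 1. *)
Let tangential j : (j < J)%N ->
  cabs (\sum_(k < J) Dt j.+1 k * al%:C) <= 2 * pi * al * K * (4 * (L + 1)).
Proof.
move=> jJ; set r := j.+1%:R * hr.
have r0 : 0 <= r by rewrite mulr_ge0.
have rL : r <= L by rewrite -Jhr ler_wpM2r// ler_nat.
have step k : cabs (Dt j.+1 k * (r * al)%:C - (g (pt j.+1 k.+1) - g (pt j.+1 k))) <=
    r * (K * al ^+ 2 * (4 * (L + 1))).
  have e : pt j.+1 k.+1 = pt j.+1 k + r%:C * (w ^+ k * (w - 1)).
    by rewrite /pt exprSr -/r; ring.
  have [[_ p1 q1] /(_ (r%:C * (w ^+ k * (w - 1))))] := gpq (Spt k jJ).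
  rewrite -e => /(_ (Spt k.+1 jJ))[_ _ _ H].
  set d := w - 1 - (0 +i* al); have dle : cabs d <= 2 * al ^+ 2 by exact: unit_rootB.
  have w1 : cabs (w - 1) <= 2 * al.
    rewrite /w /unit_root -/al; exact: cabs_cexp_iB1.
  have -> : Dt j.+1 k * (r * al)%:C - (g (pt j.+1 k.+1) - g (pt j.+1 k)) =
    - (g (pt j.+1 k.+1) - g (pt j.+1 k) - p (pt j.+1 k) * (r%:C * (w ^+ k * (w - 1)))
      - q (pt j.+1 k) * (r%:C * (w ^+ k * (w - 1)))^*) -
    r%:C * (p (pt j.+1 k) * (w ^+ k * d) + q (pt j.+1 k) * (w ^+ k * d)^*).
    have -> : w - 1 = 'i * al%:C + d.
      have -> : 'i * al%:C = 0 +i* al.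
        by apply/eqP; rewrite eq_complex/=; apply/andP; split; apply/eqP; ring.
      by rewrite /d [RHS]addrC subrK.
    have iJ : ('i : R[i])^* = - 'i.
      by apply/eqP; rewrite eq_complex/= oppr0 !eqxx.
    have rJ : (r%:C)^* = r%:C by exact: conjc_real.
    have aJ : (al%:C)^* = al%:C by exact: conjc_real.
    rewrite [(r * al)%:C]rmorphM !(conjcM, conjcD) rJ aJ iJ /Dt; ring.
  have a0 : 0 <= al ^+ 2 by rewrite exprn_ge0.
  apply: (@le_trans _ _ (K * (r * (2 * al)) ^+ 2 + r * (K * (2 * al ^+ 2) + K * (2 * al ^+ 2)))).
    apply: cabsB_le.
      rewrite cabsN; apply: (le_trans H); rewrite ler_wpM2l//.
      have hh : cabs (r%:C * (w ^+ k * (w - 1))) <= r * (2 * al).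
        by rewrite cabsM cabs_real ger0_norm// ler_wpM2l// cabsM wk mul1r.
      by rewrite ler_pXn2r ?nnegrE ?cabs_ge0// (le_trans (cabs_ge0 _) hh).
    apply: cabsM_le; first by rewrite cabs_real ger0_norm.
    by apply: cabsD_le; apply: cabsM_le; rewrite ?cabsJ ?cabsM ?wk ?mul1r.
  rewrite -subr_ge0 (_ : _ - _ = 4 * (r * (K * al ^+ 2 * (L - r)))); last by ring.
  have Lr : 0 <= L - r by rewrite subr_ge0.
  by have := mulr_ge0 r0 (mulr_ge0 (mulr_ge0 K0 a0) Lr); lra.
have rgt0 : 0 < r by rewrite mulr_gt0// divr_gt0.
have sum_r : r * cabs (\sum_(k < J) Dt j.+1 k * al%:C) <=
    r * (2 * pi * al * K * (4 * (L + 1))).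
  rewrite -{1}(ger0_norm r0) -cabs_real -cabsM mulr_sumr.
  have -> : \sum_(k < J) r%:C * (Dt j.+1 k * al%:C) =
    \sum_(k < J) (Dt j.+1 k * (r * al)%:C - (g (pt j.+1 k.+1) - g (pt j.+1 k))).
    rewrite sumrB -(big_mkord xpredT (fun k => g (pt j.+1 k.+1) - g (pt j.+1 k))).
    rewrite telescope_sumr// /pt expr0 unit_root1// subrr subr0.
    by apply: eq_bigr => k _; rewrite [(r * al)%:C]rmorphM mulrCA.
  apply: le_trans (cabs_sum _ _ _) _.
  have -> : r * (2 * pi * al * K * (4 * (L + 1))) =
     \sum_(k < J) (r * (K * al ^+ 2 * (4 * (L + 1)))).
    rewrite sumr_const card_ord -[RHS]mulr_natr.
    have -> : 2 * pi = J%:R * al by rewrite Jal mulr2n; ring.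
    ring.
  by apply: ler_sum => k _; exact: step.
by rewrite -(ler_pM2l rgt0).
Qed.

(** Pointwise [Dr] + i [Dt] = 2 (dbar g) conj(w^k), so the sum splits into radial and tangential
    differences. Along each ray these telescope to 0 - g(zeta), as g vanishes on the circle; around
    each circle they cancel. *)
Lemma cauchy_pompeiu_error : (forall z, cabs (z - zeta) = L -> g z = 0) ->
  cabs (cauchy_sum J L q zeta - g zeta) <= K * L * (33 * L + 32) / J%:R.
Proof.
move=> gL.
have gJ k : g (pt J k) = 0.
  apply: gL; rewrite /pt [zeta + _]addrC addrK cabsM wk mulr1 cabs_real Jhr.
  by rewrite ger0_norm.
have g0 k : g (pt 0 k) = g zeta by rewrite /pt !mul0r addr0.
have p0 : (0 : R) < pi by exact: pi_gt0.
(* [T1] and [T2] are the accumulated errors of the radial and of the tangential telescoping. *)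
pose T1 := \sum_(k < J) (\sum_(j < J) Dr j.+1 k * hr%:C - (g (pt J k) - g (pt 0 k))) * al%:C.
pose T2 := \sum_(j < J) (\sum_(k < J) Dt j.+1 k * al%:C) * hr%:C.
have T1le : cabs T1 <= (2 * pi) * (K * L * hr).
  apply: le_trans (cabs_sum _ _ _) _.
  have -> : 2 * pi * (K * L * hr) = \sum_(k < J) (K * L * hr * al).
    rewrite sumr_const card_ord -[RHS]mulr_natr.
    have -> : 2 * pi = J%:R * al by rewrite Jal mulr2n; ring.
    ring.
  apply: ler_sum => k _; apply: cabsM_le; first exact: radial.
  by rewrite cabs_real ger0_norm.
have T2le : cabs T2 <= 2 * pi * al * K * (4 * (L + 1)) * L.
  apply: le_trans (cabs_sum _ _ _) _.
  have -> : 2 * pi * al * K * (4 * (L + 1)) * L =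
    \sum_(k < J) (2 * pi * al * K * (4 * (L + 1)) * hr).
    by rewrite sumr_const card_ord -[RHS]mulr_natr -Jhr; ring.
  apply: ler_sum => j _; apply: cabsM_le; first exact: tangential.
  by rewrite cabs_real ger0_norm.
have e : cauchy_sum J L q zeta - g zeta = (- (2 * pi)^-1)%:C * (T1 + 'i * T2).
  have -> : T1 = \sum_(k < J) \sum_(j < J) Dr j.+1 k * hr%:C * al%:C +
      g zeta * (2 * pi)%:C.
    rewrite /T1; under eq_bigr do rewrite gJ g0 sub0r opprK mulrDl mulr_suml.
    rewrite big_split/=; congr (_ + _).
    rewrite sumr_const card_ord -[LHS]mulr_natr -mulrA; congr (_ * _).
    by rewrite -(rmorph_nat (real_complex R)) -rmorphM/= mulrC Jal mulr2n; congr (_%:C); ring.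
  rewrite exchange_big/= /T2 mulr_sumr addrAC -big_split/=.
  have c1 : (- (2 * pi)^-1)%:C * (2 * pi)%:C = -1 :> R[i].
    by rewrite -rmorphM/= mulNr mulVf ?gt_eqF ?mulr_gt0// rmorphN rmorph1.
  rewrite mulrDr (mulrCA _ (g zeta)) c1 mulrN1; congr (_ - _).
  rewrite /cauchy_sum mulr_sumr; apply: eq_bigr => j _.
  rewrite mulr_suml mulr_sumr -big_split mulr_sumr/=; apply: eq_bigr => k _.
  rewrite -/w -/hr -/(pt j.+1 k).
  (* The weight of a node is - 1/(2 pi) times 2 [hr] [al]; the 2 is the one in [Dr] + i [Dt] = 2 q
     conj(w^k). *)
  have -> : - (2 * L / J%:R ^+ 2) = - (2 * pi)^-1 * (2 * (hr * al)).
    by rewrite /hr /al; move: (pi : R) (p0) => x x0; field; rewrite !gt_eqF.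
  rewrite /Dr /Dt [(_ * (2 * (hr * al)))%:C]rmorphM/= ![(2 * _)%:C]rmorphM/=.
  rewrite (rmorph_nat (real_complex R) 2) rmorphM/=.
  have : 'i * 'i = -1 :> R[i] by rewrite -expr2 sqr_i.
  set x := (- _^-1)%:C; set ii := 'i; move=> ii1.
  transitivity (x * (p (pt j.+1 k) * w ^+ k * (1 + ii * ii) +
     q (pt j.+1 k) * (w ^+ k)^* * (1 - ii * ii)) * (hr%:C * al%:C)); last by ring.
  by rewrite ii1; ring.
rewrite e; apply: le_trans (cabsM_le (lexx _) (cabsD_le T1le
  (y := 2 * pi * al * K * (4 * (L + 1)) * L) _)) _.
- by rewrite cabsM cabs_i mul1r.
have ip0 : 0 <= (2 * pi)^-1 :> R by rewrite invr_ge0 mulr_ge0// ltW.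
rewrite cabs_real normrN (ger0_norm ip0).
have -> : (2 * pi)^-1 * (2 * pi * (K * L * hr) + 2 * pi * al * K * (4 * (L + 1)) * L) =
    K * L * (hr + al * (4 * (L + 1))).
  by move: (al) (pi : R) (p0) => y x x0; field; rewrite gt_eqF.
have a8 : al <= 8 / J%:R.
  rewrite /al ler_wpM2r//.
  by have := pi_le4; lra.
(* [hr] is L/J and [al] is at most 8/J, as pi <= 4; 33 L + 32 is L + 32 (L + 1). *)
have -> : K * L * (33 * L + 32) / J%:R = K * L * (hr + 8 / J%:R * (4 * (L + 1))).
  by rewrite /hr; field; rewrite gt_eqF.
have L1 : 0 <= 4 * (L + 1) by rewrite mulr_ge0// addr_ge0.
by rewrite ler_wpM2l ?mulr_ge0// lerD2l ler_wpM2r.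
Qed.

End estimate.

End discrete_cauchy_pompeiu.

(** * The estimate in one complex variable *)

Section wirtinger_functions.
Context {R : realType}.
Implicit Types (S : R[i] -> Prop) (f g p q : R[i] -> R[i]) (z h c : R[i]).

(** The constant is hidden: it depends on the mollification and on N, but enters only the errors of
    the Riemann sums, which a large number of nodes makes small. *)
Definition has_wirtinger S g p q := exists2 K : R, 0 <= K & wirtinger K S g p q.

Lemma has_wirtinger_ext S g p q g' p' q' :
  g =1 g' -> p =1 p' -> q =1 q' -> has_wirtinger S g p q -> has_wirtinger S g' p' q'.
Proof. by move=> /funext -> /funext -> /funext ->. Qed.

Lemma has_wirtinger_sub S T g p q : (forall z, T z -> S z) ->
  has_wirtinger S g p q -> has_wirtinger T g p q.
Proof. by move=> TS [K K0 H]; exists K => //; exact: wirtinger_sub TS H. Qed.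

Lemma has_wirtingerD S f p q g p' q' :
  has_wirtinger S f p q -> has_wirtinger S g p' q' ->
  has_wirtinger S (fun z => f z + g z) (fun z => p z + p' z) (fun z => q z + q' z).
Proof.
move=> [K K0 H] [L L0 G]; exists (K + L); first exact: addr_ge0.
exact: wirtingerD.
Qed.

Lemma has_wirtingerM S f p q g p' q' :
  has_wirtinger S f p q -> has_wirtinger S g p' q' ->
  has_wirtinger S (fun z => f z * g z) (fun z => p z * g z + f z * p' z)
    (fun z => q z * g z + f z * q' z).
Proof.
move=> [K K0 H] [L L0 G]; exists (4 * (K * L)); first by rewrite !mulr_ge0.
exact: wirtingerM.
Qed.

Lemma has_wirtinger_cst S c : has_wirtinger S (fun=> c) (fun=> 0) (fun=> 0).
Proof. by exists (cabs c); [exact: cabs_ge0|exact: wirtinger_cst]. Qed.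

Lemma has_wirtingerZ S c f p q : has_wirtinger S f p q ->
  has_wirtinger S (fun z => c * f z) (fun z => c * p z) (fun z => c * q z).
Proof.
move=> [K K0 H]; exists (cabs c * K); first by rewrite mulr_ge0 ?cabs_ge0.
exact: wirtingerZ.
Qed.

Lemma has_wirtingerX S f p q n : has_wirtinger S f p q ->
  has_wirtinger S (fun z => f z ^+ n) (fun z => n%:R * f z ^+ n.-1 * p z)
    (fun z => n%:R * f z ^+ n.-1 * q z).
Proof.
move=> H; elim: n => [|n IH].
  apply: has_wirtinger_ext (has_wirtinger_cst S 1) => z //=; ring.
case: n IH => [_|n IH].
  by apply: has_wirtinger_ext H => z; rewrite ?expr1 ?expr0 ?mul1r.
apply: has_wirtinger_ext (has_wirtingerM H IH) => z /=;
  rewrite -?[n.+2%:R]natr1 !exprS; ring.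
Qed.

Lemma has_wirtinger_cexp S g p q : has_wirtinger S g p q ->
  has_wirtinger S (fun z => cexp (g z)) (fun z => cexp (g z) * p z)
    (fun z => cexp (g z) * q z).
Proof. by move=> [K K0 G]; exact: wirtinger_cexp K0 G. Qed.

Lemma has_wirtinger_comp L S I (r : R[i] -> R) p q phi dphi : 0 <= L ->
  has_wirtinger S (fun z => (r z)%:C) p q -> quadratic L I phi dphi ->
  (forall z, S z -> I (r z)) ->
  has_wirtinger S (fun z => (phi (r z))%:C)
    (fun z => (dphi (r z))%:C * p z) (fun z => (dphi (r z))%:C * q z).
Proof.
move=> L0 [K K0 H] Q SI; exists (L * (K ^+ 2 + K + 1)).
  by rewrite mulr_ge0// !addr_ge0// exprn_ge0.
exact: wirtinger_comp H Q SI.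
Qed.

Definition disc (D : R) z : Prop := cabs z <= D.

Lemma has_wirtinger_subr D c : has_wirtinger (disc D) (fun z => z - c) (fun=> 1) (fun=> 0).
Proof.
have H : has_wirtinger (disc D) id (fun=> 1) (fun=> 0).
  exists (Num.max 1 D); first by rewrite le_max ler01.
  by apply: wirtinger_id => [|z zD]; rewrite le_max ?lexx//; apply/orP; right.
by apply: has_wirtinger_ext (has_wirtingerD H (has_wirtinger_cst _ (- c))) => z //=;
  rewrite addr0.
Qed.

Lemma has_wirtinger_conj_subr D c :
  has_wirtinger (disc D) (fun z => (z - c)^*) (fun=> 0) (fun=> 1).
Proof.
have H : has_wirtinger (disc D) (fun z => z^*) (fun=> 0) (fun=> 1).
  exists (Num.max 1 D); first by rewrite le_max ler01.
  by apply: wirtinger_conj => [|z zD]; rewrite le_max ?lexx//; apply/orP; right.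
apply: has_wirtinger_ext (has_wirtingerD H (has_wirtinger_cst _ (- c)^*)) => z //=;
  by rewrite ?addr0 ?conjcD.
Qed.

Lemma has_wirtinger_sqr_cabs D c :
  has_wirtinger (disc D) (fun z => (cabs (z - c) ^+ 2)%:C)
    (fun z => (z - c)^*) (fun z => z - c).
Proof.
apply: has_wirtinger_ext (has_wirtingerM (has_wirtinger_subr D c)
  (has_wirtinger_conj_subr D c)) => z /=; first by rewrite mulcJ.
  by rewrite mul1r mulr0 addr0.
by rewrite mul0r mulr1 add0r.
Qed.

(** A function with Lipschitz derivative that vanishes on a half-line: enough to build cutoffs in
    the class [wirtinger]. *)
Definition sqr_pos (s : R) : R := Num.max 0 s ^+ 2.

Lemma quadratic_sqr_pos D : 1 <= D ->
  quadratic (2 * D ^+ 2) (fun s => `|s| <= D) sqr_pos (fun s => 2 * Num.max 0 s).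
Proof.
move=> D1; have DD : D <= D ^+ 2 by rewrite expr2 ler_peMl//; lra.
rewrite /sqr_pos => s; rewrite ler_norml => /andP[s1 s2].
have mD (x : R) : - D <= x -> x <= D -> 0 <= Num.max 0 x <= D.
  by move=> _ ?; rewrite le_max lexx ge_max; apply/andP; split => //; apply/andP; split; lra.
have /andP[m1 m2] := mD _ s1 s2.
have sq (x : R) : 0 <= x -> x <= D -> x ^+ 2 <= D ^+ 2.
  by move=> ? ?; rewrite ler_pXn2r ?nnegrE//; lra.
split.
  rewrite ger0_norm ?exprn_ge0// ger0_norm ?mulr_ge0//.
  by have := sq _ m1 m2; split; lra.
move=> t; rewrite ler_norml => /andP[t1 t2].
have /andP[n1 n2] := mD _ t1 t2.
have lip : `|Num.max 0 (s + t) - Num.max 0 s| <= `|t|.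
  by case: (leP 0 (s + t)) => ?; case: (leP 0 s) => ?; rewrite ler_norml;
    have := ler_norm t; have := ler_norm (- t); rewrite normrN => ? ?;
    apply/andP; split; lra.
have t0 := normr_ge0 t.
have DDt : D * `|t| <= D ^+ 2 * `|t| by rewrite ler_wpM2r.
have D1t : `|t| <= D * `|t| by rewrite ler_peMl.
split.
- rewrite subr_sqr normrM (ger0_norm (addr_ge0 n1 m1)).
  have : `|Num.max 0 (s + t) - Num.max 0 s| * (Num.max 0 (s + t) + Num.max 0 s) <=
    `|t| * (2 * D) by rewrite ler_pM// ?addr_ge0//; lra.
  lra.
- rewrite -mulrBr normrM ger0_norm//; lra.
- have t20 : 0 <= t ^+ 2 by exact: sqr_ge0.
  have DDt2 : t ^+ 2 <= D ^+ 2 * t ^+ 2 by rewrite ler_peMl//; lra.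
  rewrite (real_normK (num_real t)).
  suff : `|Num.max 0 (s + t) ^+ 2 - Num.max 0 s ^+ 2 - 2 * Num.max 0 s * t| <= t ^+ 2.
    lra.
  by rewrite ler_norml; case: (leP 0 (s + t)) => ?; case: (leP 0 s) => ?;
    apply/andP; split; nra.
Qed.

(* A cutoff function: it is [m (1 - m t)] with [m s = max(0, s)^2] and
   [t = (|z - c|^2 / r^2 - a^2) / (b^2 - a^2)]. *)
Lemma cutoff_exists D c (r a b : R) : 0 < r -> 0 <= a -> a < b ->
  exists f p q, [/\ has_wirtinger (disc D) f p q,
    forall z, cabs (f z) <= 1,
    forall z, cabs (z - c) <= a * r -> f z = 1 /\ q z = 0,
    forall z, b * r <= cabs (z - c) -> f z = 0 /\ q z = 0 &
    forall z, cabs (q z) <= 4 * b / ((b ^+ 2 - a ^+ 2) * r)].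
Proof.
move=> r0 a0 ab.
have e0 : 0 < b ^+ 2 - a ^+ 2 by rewrite subr_gt0 ltr_pXn2r// nnegrE//; lra.
set k := ((b ^+ 2 - a ^+ 2) * r ^+ 2)^-1.
have k0 : 0 < k by rewrite invr_gt0 mulr_gt0// exprn_gt0.
pose t z := k * (cabs (z - c) ^+ 2 - (a * r) ^+ 2).
have Ht : has_wirtinger (disc D) (fun z => (t z)%:C) (fun z => k%:C * (z - c)^*)
    (fun z => k%:C * (z - c)).
  apply: has_wirtinger_ext (has_wirtingerZ k%:C (has_wirtingerD
    (has_wirtinger_sqr_cabs D c) (has_wirtinger_cst _ (- ((a * r) ^+ 2)%:C)))) => z /=;
    by rewrite ?addr0// -rmorphN -rmorphD -rmorphM.
pose D1 := Num.max 1 (k * ((Num.max 0 D + cabs c) ^+ 2 + (a * r) ^+ 2)).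
have tD z : disc D z -> `|t z| <= D1.
  move=> zD; rewrite le_max; apply/orP; right.
  rewrite /t normrM (ger0_norm (ltW k0)) ler_pM2l//.
  apply: le_trans (ler_normB _ _) _; rewrite !(ger0_norm (sqr_ge0 _)).
  rewrite lerD2r ler_pXn2r ?nnegrE ?addr_ge0 ?cabs_ge0 ?le_max ?lexx//.
  by apply: le_trans (cabsB _ _) _; rewrite lerD2r le_max; apply/orP; right; exact: zD.
have D11 : 1 <= D1 by rewrite le_max lexx.
have L0 : 0 <= 2 * D1 ^+ 2 by rewrite mulr_ge0// sqr_ge0.
have H1 := has_wirtinger_comp L0 Ht (quadratic_sqr_pos D11) tD.
have H2 : has_wirtinger (disc D) (fun z => (1 - sqr_pos (t z))%:C)
    (fun z => - ((2 * Num.max 0 (t z))%:C * (k%:C * (z - c)^*)))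
    (fun z => - ((2 * Num.max 0 (t z))%:C * (k%:C * (z - c)))).
  apply: has_wirtinger_ext (has_wirtingerD (has_wirtinger_cst _ 1)
    (has_wirtingerZ (-1) H1)) => z /=; rewrite ?mulN1r ?add0r//.
  by rewrite rmorphB rmorph1.
have sle z : 0 <= sqr_pos (t z) by exact: sqr_ge0.
pose D2 := 1 + D1 ^+ 2.
have D12 : 1 <= D2 by rewrite lerDl sqr_ge0.
have tD2 z : disc D z -> `|1 - sqr_pos (t z)| <= D2.
  move=> zD; apply: le_trans (ler_normB _ _) _; rewrite normr1 lerD2l.
  have m0 : 0 <= Num.max 0 (t z) by rewrite le_max lexx.
  have D10 : 0 <= D1 by lra.
  have m1 : Num.max 0 (t z) <= D1.
    by rewrite ge_max D10 (le_trans (ler_norm _) (tD _ zD)).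
  by rewrite ger0_norm// /sqr_pos ler_pXn2r.
have L2 : 0 <= 2 * D2 ^+ 2 by rewrite mulr_ge0// sqr_ge0.
have H3 := has_wirtinger_comp L2 H2 (quadratic_sqr_pos D12) tD2.
have max_le1 z : 0 <= Num.max 0 (1 - sqr_pos (t z)) <= 1.
  by rewrite le_max lexx ge_max ler01/=; have := sle z; lra.
have tge z : b * r <= cabs (z - c) -> 1 <= t z.
  move=> zb; have : (b * r) ^+ 2 <= cabs (z - c) ^+ 2.
    by rewrite ler_pXn2r ?nnegrE ?cabs_ge0// mulr_ge0//; lra.
  move=> H; rewrite /t /k mulrC ler_pdivlMr ?mulr_gt0 ?exprn_gt0//.
  by rewrite !exprMn in H *; lra.
have tge0 z : b * r <= cabs (z - c) -> Num.max 0 (1 - sqr_pos (t z)) = 0.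
  move=> /tge t1; apply/max_idPl; rewrite subr_le0 /sqr_pos max_r; last lra.
  by rewrite exprn_ege1.
have tle z : cabs (z - c) <= a * r -> Num.max 0 (t z) = 0.
  move=> zb; have : cabs (z - c) ^+ 2 <= (a * r) ^+ 2.
    by rewrite ler_pXn2r ?nnegrE ?cabs_ge0// mulr_ge0//; lra.
  by move=> H; apply/max_idPl; rewrite /t pmulr_rle0// subr_le0.
do 3 eexists; split; [exact: H3| | | |] => z; cbv beta.
- rewrite cabs_real ger0_norm ?sqr_ge0// [X in X <= _]/sqr_pos.
  by have /andP[? ?] := max_le1 z; rewrite exprn_ile1.
- move=> /tle tz; rewrite /sqr_pos tz expr0n/= subr0 mulr0 mul0r oppr0 mulr0.
  by rewrite max_r ?ler01// expr1n.
- by move=> /tge0 tz; rewrite {1}/sqr_pos tz expr0n mulr0 mul0r.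
- have [zb|/tge0 tz] := ltP (cabs (z - c)) (b * r); last first.
    rewrite tz mulr0 mul0r cabs0 divr_ge0//; first by rewrite mulr_ge0//; lra.
    by rewrite mulr_ge0// ltW.
  have /andP[m0 m1] := max_le1 z.
  have t1 : 0 <= Num.max 0 (t z) <= 1.
    rewrite le_max lexx ge_max ler01/= /t /k mulrC ler_pdivrMr ?mulr_gt0 ?exprn_gt0//.
    have : cabs (z - c) ^+ 2 <= (b * r) ^+ 2.
      have br : 0 <= b * r by rewrite mulr_ge0//; lra.
      by rewrite ler_pXn2r ?nnegrE ?cabs_ge0//; exact: ltW.
    by rewrite !exprMn; lra.
  have /andP[n0 n1] := t1.
  (* The chain rule through the two [sqr_pos] gives two factors 2 max(0, .) <= 2, and k |z - c| <= k
     b r remains. *)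
  rewrite (_ : 4 * b / _ = 2 * (2 * (k * (b * r)))); last first.
    by rewrite /k; field; rewrite !gt_eqF.
  apply: cabsM_le; first by rewrite cabs_real ger0_norm ?mulr_ge0//; lra.
  rewrite cabsN; apply: cabsM_le; first by rewrite cabs_real ger0_norm ?mulr_ge0//; lra.
  by apply: cabsM_le; [rewrite cabs_real ger0_norm// ltW|exact: ltW].
Qed.

End wirtinger_functions.

Section singular_kernel.
Context {R : realType}.
Implicit Types (f g p q : R[i] -> R[i]) (z h c : R[i]).

(** 2 - s is the tangent of 1/s at s = 1, so the derivative is Lipschitz across the junction. With s
    = |z - c|^2, multiplication by conj(z - c) gives 1/(z - c) outside the unit disc and stays
    bounded inside. *)
Definition inv_ext (s : R) : R := if 1 <= s then s^-1 else 2 - s.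

Lemma quadratic_inv_ext : quadratic 2 (fun s : R => 0 <= s) inv_ext
  (fun s => if 1 <= s then - s^-1 ^+ 2 else -1).
Proof.
have inv_bd (s : R) : 1 <= s -> [/\ 0 < s^-1, s^-1 <= 1 & s * s^-1 = 1].
  move=> s1; have s0 : 0 < s by lra.
  by rewrite invr_gt0 s0 invf_le1// divff// gt_eqF.
move=> s s0; rewrite /inv_ext; split.
  have [/inv_bd[x0 x1 _]|s1] := leP 1 s; last by rewrite !ler_norml; split; lra.
  rewrite normrN !ger0_norm ?exprn_ge0//; [|exact: ltW..].
  by split; [lra|]; rewrite expr2; have := ler_pM (ltW x0) (ltW x0) x1 x1; lra.
move=> t t0; have nt := normr_ge0 t; have nt2 := sqr_ge0 `|t|.
have tt : `|t| ^+ 2 = t ^+ 2 by rewrite real_normK ?num_real.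
rewrite tt in nt2 *.
have [s1|s1] := leP 1 s; have [t1|t1] := leP 1 (s + t).
- have [x0 x1 xs] := inv_bd _ s1; have [y0 y1 ys] := inv_bd _ t1.
  move: (s^-1) ((s + t)^-1) => x y in x0 x1 xs y0 y1 ys *.
  have e : y - x = - t * (x * y).
    have : y - x = y * (s * x) - x * ((s + t) * y) by rewrite xs ys; ring.
    by move=> ->; ring.
  have xy0 : 0 <= x * y by rewrite mulr_ge0// ltW.
  have xy1 : x * y <= 1 by have := ler_pM (ltW x0) (ltW y0) x1 y1; lra.
  split.
  + rewrite e normrM normrN (ger0_norm xy0).
    have := ler_wpM2l nt xy1; lra.
  + have -> : - y ^+ 2 - - x ^+ 2 = t * (x * y * (x + y)).
      have -> : - y ^+ 2 - - x ^+ 2 = - (y - x) * (x + y) by ring.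
      by rewrite e; ring.
    rewrite normrM mulrC ler_wpM2r// ger0_norm; last first.
      by rewrite mulr_ge0// addr_ge0// ltW.
    have : x * y * (x + y) <= 1 * (x + y) by rewrite ler_wpM2r// addr_ge0// ltW.
    lra.
  + have -> : y - x - - x ^+ 2 * t = t ^+ 2 * (x * (x * y)).
      transitivity (- t * x * (y - x)); first by rewrite {1}e; ring.
      by rewrite e; ring.
    have xxy : 0 <= x * (x * y) by rewrite mulr_ge0// ltW.
    rewrite ger0_norm; last by rewrite mulr_ge0.

    rewrite mulrC ler_wpM2r//.
    have : x * (x * y) <= 1 * 1 by rewrite ler_pM// ltW.
    lra.
- have [x0 x1 xs] := inv_bd _ s1.
  move: (s^-1) => x in x0 x1 xs *.
  have nte : `|t| = - t by rewrite ler0_norm//; lra.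
  rewrite nte.
  (* The two points lie on different sides of the junction 1, at distances [a] and [b], so |t| = a +
     b. *)
  set a := 1 - (s + t); set b := s - 1.
  have bE : 1 - x = b * x by rewrite /b mulrBl xs mul1r.
  have a0 : 0 < a by rewrite subr_gt0.
  have b0 : 0 <= b by rewrite subr_ge0.
  have tE : t = - (a + b) by rewrite /a /b; ring.
  have bx0 : 0 <= b * x by rewrite mulr_ge0// ltW.
  have bx : b * x <= b by rewrite ler_piMr.
  split.
  + by rewrite (_ : _ - _ = a + b * x); [rewrite ger0_norm; lra|rewrite -bE /a; ring].
  + rewrite (_ : _ - _ = - (b * x * (1 + x))); last by rewrite -bE; ring.
    rewrite normrN ger0_norm; last by rewrite mulr_ge0//; lra.
    have : b * x * (1 + x) <= b * x * 2 by rewrite ler_wpM2l//; lra.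
    lra.
  + rewrite (_ : _ - _ = a * (b * x) * (1 + x) + (b * x) ^+ 2); last first.
      transitivity (a + (1 - x) - x ^+ 2 * (a + b)); first by rewrite /a /b; ring.
      transitivity (a * (1 - x) * (1 + x) + (1 - x) + - x * (b * x)); first by ring.
      by rewrite -bE; ring.
    rewrite ger0_norm; last first.
      by rewrite addr_ge0 ?sqr_ge0// !mulr_ge0 ?(ltW a0)//; lra.
    have h1 : a * (b * x) * (1 + x) <= a * b * 2.
      apply: ler_pM; [by rewrite mulr_ge0// ltW|lra|by rewrite ler_wpM2l// ltW|lra].
    have h2 : (b * x) ^+ 2 <= b ^+ 2 by rewrite ler_pXn2r.
    have : 0 <= a ^+ 2 by exact: sqr_ge0.
    have : 0 <= b ^+ 2 by exact: sqr_ge0.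
    have : 0 <= a * b by rewrite mulr_ge0// ltW.
    rewrite tE; lra.
- have [y0 y1 ys] := inv_bd _ t1.
  move: ((s + t)^-1) => y in y0 y1 ys *.
  have nte : `|t| = t by rewrite ger0_norm//; lra.
  rewrite nte.
  set b := s + t - 1.
  have bE : 1 - y = b * y by rewrite /b mulrBl ys mul1r.
  have b0 : 0 <= b by rewrite subr_ge0.
  have bt : b <= t by rewrite /b; lra.
  have by0 : 0 <= b * y by rewrite mulr_ge0// ltW.
  have byb : b * y <= b by rewrite ler_piMr.
  split.
  + rewrite (_ : _ - _ = - ((1 - y) + (1 - s))); last by ring.
    by rewrite bE normrN ger0_norm; [rewrite /b in bt byb *; lra|lra].
  + rewrite (_ : _ - _ = b * y * (1 + y)); last by rewrite -bE; ring.
    rewrite ger0_norm; last by rewrite mulr_ge0//; lra.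
    have : b * y * (1 + y) <= b * y * 2 by rewrite ler_wpM2l//; lra.
    lra.
  + rewrite (_ : _ - _ = b * (b * y)); last first.
      transitivity (b - (1 - y)); first by rewrite /b; ring.
      have -> : b * (b * y) = b * (1 - y) by rewrite bE.
      by rewrite {1}bE; ring.
    rewrite ger0_norm; last by rewrite mulr_ge0.
    have : b * (b * y) <= t * t by rewrite ler_pM//; lra.
    by rewrite -expr2; lra.
- rewrite (_ : 2 - _ - _ = - t); last by ring.
  rewrite (_ : -1 - _ = 0); last by ring.
  rewrite (_ : - t - _ = 0); last by ring.
  by rewrite normrN normr0; split; lra.
Qed.

(* [1/(z - c)], modified inside the unit disc around [c] *)
Lemma kernel_exists D c : exists f p q,
  [/\ has_wirtinger (disc D) f p q,
    forall z, cabs (f z) <= 2,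
    forall z, 1 <= cabs (z - c) -> cabs (f z) = (cabs (z - c))^-1 /\ q z = 0 &
    forall z, cabs (q z) <= 2].
Proof.
have H1 := has_wirtinger_comp (ler0n _ 2) (has_wirtinger_sqr_cabs D c)
  quadratic_inv_ext (fun z _ => sqr_ge0 _).
have H2 := has_wirtingerM (has_wirtinger_conj_subr D c) H1.
do 3 eexists; split; [exact: H2| | |] => z; cbv beta; move: (cabs_ge0 (z - c));
  rewrite /inv_ext ?mul1r; set s := cabs (z - c) => s0.
- have [|] := leP 1 (s ^+ 2) => s1.
    have s1' : 1 <= s by rewrite -(@ler_pXn2r _ 2) ?nnegrE ?expr1n// ler01.
    apply: (@le_trans _ _ 1); last by lra.
    rewrite cabsM cabsJ cabs_real ger0_norm ?invr_ge0 ?sqr_ge0// -/s.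
    rewrite expr2 invfM mulrA mulfV ?mul1r ?invf_le1//; lra.
  have s1' : s <= 1.
    by rewrite -(@ler_pXn2r _ 2) ?nnegrE ?expr1n// ?ler01// ltW.
  rewrite -[leRHS]mul1r; apply: cabsM_le; first by rewrite cabsJ.
  by rewrite cabs_real ger0_norm; have := sqr_ge0 s; lra.
- move=> s1; have ss1 : 1 <= s ^+ 2 by rewrite exprn_ege1.
  rewrite ss1; split.
    rewrite cabsM cabsJ cabs_real ger0_norm ?invr_ge0 ?sqr_ge0// -/s.
    by rewrite expr2 invfM mulrA mulfV ?mul1r//; lra.
  (* With s = |z - c|^2, the dbar-derivative of conj(z - c) phi(s) is phi(s) + s phi'(s), which is 0
     for phi = 1/s. *)
  rewrite mulrCA [_^* * _]mulrC mulcJ -/s -rmorphM -rmorphD mulNr expr2.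
  by rewrite -mulrA mulVf ?mulr1 ?subrr//; lra.
- rewrite mulrCA [_^* * _]mulrC mulcJ -/s -rmorphM -rmorphD cabs_real.
  have [|] := leP 1 (s ^+ 2) => s1.
    by rewrite mulNr expr2 -mulrA mulVf ?mulr1 ?subrr ?normr0//; lra.
  by rewrite ger0_norm; have := sqr_ge0 s; lra.
Qed.

End singular_kernel.

Section planar_estimate.
Context {R : realType}.
Implicit Types (f g p q U a : R[i] -> R[i]) (z h c : R[i]).

(** The sum is a finite combination of translates by vectors of length at most L, so the derivatives
    pass inside; the last component makes the dbar-derivative of w accessible to
    [cauchy_pompeiu_error]. *)
Lemma has_wirtinger_cauchy_sum J L D f p q : 0 <= L ->
  has_wirtinger (disc (D + L)) f p q ->
  has_wirtinger (disc D) (cauchy_sum J L f) (cauchy_sum J L p) (cauchy_sum J L q).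
Proof.
move=> L0 [K K0 H].
pose k (j l : 'I_J) := (- (2 * L / J%:R ^+ 2))%:C * (unit_root J ^+ l)^* : R[i].
exists (\sum_(j < J) \sum_(l < J) (cabs (k j l) * K)).
  by apply: sumr_ge0 => j _; apply: sumr_ge0 => l _; rewrite mulr_ge0 ?cabs_ge0.
apply: wirtinger_sum => j; apply: wirtinger_sum => l; apply: wirtingerZ => //.
apply: wirtinger_sub (@wirtinger_translate _ _ _ _ _ _ _ H) => z zD; rewrite /disc.
apply: cabsD_le => //; rewrite cabsM cabs_unit_root mulr1 cabs_real.
rewrite ger0_norm; last by rewrite mulr_ge0// divr_ge0.
have J0 : (0 : R) < J%:R by rewrite ltr0n; case: J {k} j l => // -[].
rewrite mulrCA ler_piMr// ler_pdivrMr// mul1r ler_nat; exact: ltn_ord.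
Qed.

Lemma archi_div (x d : R) : 0 < d -> exists2 J : nat, (0 < J)%N & x / J%:R <= d.
Proof.
move=> d0; pose J := (Num.truncn (x / d)).+1; exists J => //.
have J0 : (0 : R) < J%:R by rewrite ltr0n.
by rewrite ler_pdivrMr// mulrC -ler_pdivrMr// ltW// truncnS_gt.
Qed.

(** In the application r is the norm of z0, tau the smallness near z0 and B the growth bound. There
    is one approximate pair U, a for each d, and the conclusion mentions neither, so d can tend to
    0. One factor E and the power r^N come from dividing by the lower bound at 0. *)
Lemma planar_inequality (r A B tau : R) (N : nat) :
  1 <= r -> 0 <= A -> 0 <= B -> 0 <= tau ->
  (forall d, 0 < d -> exists U pU qU a pa qa,
    [/\ has_wirtinger (disc (20 * r)) U pU qU,
        has_wirtinger (disc (20 * r)) a pa qa &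
        [/\ forall z, disc (20 * r) z -> cabs (a z) <= A,
            forall z, disc (20 * r) z -> cabs (qU z - a z * U z) <= d,
            forall z, disc (20 * r) z -> cabs (U z) <= B,
            1 - d <= cabs (U 0) &
            forall z, cabs (z - r%:C) < 1 -> cabs (U z) <= tau + d]]) ->
  1 <= 10 * r * expR (20 * r * A) ^+ 2 *
       (tau * N%:R * (2 * r) ^+ N + 3 * B / 2 ^+ N).
Proof.
move=> r1 A0 B0 tau0 H; set E := expR _; set X := leRHS.
have r0 : 0 < r by lra.
have r0' : 0 <= r by lra.
have E0 : 0 < E by exact: expR_gt0.
have E0' := ltW E0.
have rN0 : 0 < r ^+ N by rewrite exprn_gt0.
have N0 : (0 : R) <= N%:R by [].
have tN0 : (0 : R) < 2 ^+ N by rewrite exprn_gt0.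
(* A bound for the dbar-derivative of g, one term for each cause: the equations for U and w hold up
   to d; the kernel is not holomorphic on the unit disc around r; the second cutoff varies on 2r <=
   |z - r| <= 3r, where |k|^N <= (2r)^-N. *)
pose Q d := (1 + B) * d * E * 2 ^+ N + (tau + d) * E * (N%:R * 2 ^+ N) +
  B * E * ((2 * r)^-1 ^+ N * 3).
have key d : 0 < d -> (1 - d) * (E^-1 * r^-1 ^+ N) <= 10 * r * Q d + d.
  move=> d0.
  have B1d : 0 <= (1 + B) * d by rewrite mulr_ge0 ?addr_ge0// ltW.
  have td0 : 0 <= tau + d by rewrite addr_ge0// ltW.
  have r2 : r <= 2 * r by lra.
  have r12 : 1 <= 2 * r by lra.
  have [U [pU [qU [a [pa [qa [HU Ha [aA qUa UB U0 Utau]]]]]]]] := H _ d0.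
  have D0 : disc (20 * r) 0 by rewrite /disc cabs0 mulr_ge0.
  (* This cutoff is 1 on |z| <= 4r, which contains the support of the next one, and 0 from 5r on. So
     x a vanishes on every circle of radius 10r centred in |z| <= 5r, as the Cauchy-Pompeiu formula
     requires. *)
  have [x [px [qx [Hx x_le1 x_in x_out _]]]] :=
    @cutoff_exists _ (20 * r) 0 r 4 5 r0 (ler0n _ 4) ltac:(lra).
  have [e [pe [qe [He e_le1 e_in e_out qe_le]]]] :=
    @cutoff_exists _ (20 * r) r%:C r 2 3 r0 (ler0n _ 2) ltac:(lra).
  have [k [pk [qk [Hk k_le2 k_out qk_le2]]]] := @kernel_exists _ (20 * r) r%:C.
  have [K1 K10 Hxa] := has_wirtingerM Hx Ha.
  have [J1 J10 J1d] := archi_div (K1 * (10 * r) * (33 * (10 * r) + 32)) d0.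
  have L10 : 0 < 10 * r by rewrite mulr_gt0.
  set xa := (fun z => x z * a z) in Hxa.
  set qxa := (fun z => qx z * a z + x z * qa z) in Hxa.
  (* The dbar-derivative of [w] is [qw], the transform of that of x a; on |z| <= 5r it is within d
     of x a. *)
  pose w := cauchy_sum J1 (10 * r) xa.
  pose qw := cauchy_sum J1 (10 * r) qxa.
  have disc10 z y : disc (5 * r) z -> cabs (y - z) <= 10 * r -> disc (20 * r) y.
    rewrite /disc => z5 yz; have := cabs_tri y z; lra.
  have qwE z : disc (5 * r) z -> cabs (qw z - xa z) <= d.
    move=> z5; apply: (le_trans _ J1d).
    apply: (cauchy_pompeiu_error J10 L10 K10 Hxa) => y yz; first exact: disc10 z5 yz.
    have y5 : 5 * r <= cabs (y - 0).
      rewrite subr0; move: z5; rewrite /disc => z5.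
      by have := cabsB y z; rewrite yz; lra.
    by rewrite /xa (x_out _ y5).1 mul0r.
  have wA z : disc (5 * r) z -> cabs (w z) <= 20 * r * A.
    move=> z5; have -> : 20 * r * A = 2 * (10 * r) * A by ring.
    apply: cabs_cauchy_sum => //; first exact: ltW.
    move=> y /(disc10 _ _ z5) y20; rewrite -[A]mul1r.
    by apply: cabsM_le; [exact: x_le1|exact: aA].
  have Hw : has_wirtinger (disc (5 * r)) w (cauchy_sum J1 (10 * r)
      (fun z => px z * a z + x z * pa z)) qw.
    apply: has_wirtinger_cauchy_sum; first exact: ltW.
    apply: has_wirtinger_sub (ex_intro2 _ _ K1 K10 Hxa) => z.
    by rewrite /disc; lra.
  have sub5 z : disc (5 * r) z -> disc (20 * r) z by rewrite /disc; lra.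
  have Hew := has_wirtinger_cexp (has_wirtingerZ (-1) Hw).
  have ewE z : disc (5 * r) z -> cabs (cexp (-1 * w z)) <= E.
    move=> z5; rewrite cabs_cexp ler_expR mulN1r.
    apply: le_trans (ler_norm _) _; apply: le_trans (norm_Re_le _) _.
    by rewrite cabsN; exact: wA.
  (* The product g = U e^{-w} k^N e vanishes on |z| = 5r, so its value at 0 is recovered from its
     dbar-derivative. *)
  have Hg := has_wirtingerM
    (has_wirtingerM (has_wirtinger_sub sub5 HU) Hew)
    (has_wirtingerM (has_wirtinger_sub sub5 (has_wirtingerX N Hk))
                    (has_wirtinger_sub sub5 He)).
  case: Hg => Kg Kg0; set g := (X in wirtinger Kg _ X); set qg := (X in wirtinger Kg _ _ _ X).
  move=> Hg.
  have [J2 J20 J2d] := archi_div (Kg * (5 * r) * (33 * (5 * r) + 32)) d0.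
  have L20 : 0 < 5 * r by rewrite mulr_gt0.
  have Q1 : 0 <= (1 + B) * d * E * 2 ^+ N.
    by rewrite mulr_ge0 ?(ltW tN0)// mulr_ge0.
  have Q2 : 0 <= (tau + d) * E * (N%:R * 2 ^+ N).
    by rewrite mulr_ge0 ?mulr_ge0 ?(ltW tN0).
  have r20 : 0 <= (2 * r)^-1 by rewrite invr_ge0 mulr_ge0.
  have Q3 : 0 <= B * E * ((2 * r)^-1 ^+ N * 3).
    by rewrite mulr_ge0 ?mulr_ge0// exprn_ge0.
  (* The second cutoff has a dbar-derivative of at most 12/(5r), which is at most 3 as r >= 1. *)
  have b4 : 4 * 3 <= 3 * ((3 ^+ 2 - 2 ^+ 2) * r) by rewrite !expr2; lra.
  have qgQ z : disc (5 * r) z -> cabs (qg z) <= Q d.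
    move=> z5; rewrite /qg /Q.
    have [z3|z3] := leP (3 * r) (cabs (z - r%:C)).
      have [-> ->] := e_out _ z3; rewrite !(mulr0, addr0, mul0r) cabs0.
      by rewrite !addr_ge0.
    have z4 : cabs (z - 0) <= 4 * r.
      rewrite subr0; have := cabs_tri z r%:C; rewrite cabs_real ger0_norm//; lra.
    have qwa : cabs (qw z - a z) <= d.
      by have := qwE _ z5; rewrite /xa (x_in _ z4).1 mul1r.
    (* The term a U is inserted: U e^{-w} has the dbar-derivative ((qU - a U) - U (qw - a)) e^{-w},
       where |qU - a U| and |qw - a| are at most d. *)
    have -> : (qU z * cexp (-1 * w z) + U z * (cexp (-1 * w z) * (-1 * qw z))) *
      (k z ^+ N * e z) + U z * cexp (-1 * w z) *
      (N%:R * k z ^+ N.-1 * qk z * e z + k z ^+ N * qe z) =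
      (qU z - a z * U z - U z * (qw z - a z)) * cexp (-1 * w z) * (k z ^+ N * e z) +
      U z * cexp (-1 * w z) * (N%:R * k z ^+ N.-1 * qk z * e z) +
      U z * cexp (-1 * w z) * (k z ^+ N * qe z) by ring.
    have z20 := sub5 _ z5.
    apply: cabsD_le; first apply: cabsD_le.
    - rewrite -[leRHS]mulr1 -[leRHS]mulrA; apply: cabsM_le.
        apply: (cabsM_le _ (ewE _ z5)).
        have -> : (1 + B) * d = d + B * d by ring.
        by apply: cabsB_le; [exact: qUa|apply: cabsM_le => //; exact: UB].
      apply: (cabsM_le _ (e_le1 _)); rewrite cabsX.
      by rewrite lerXn2r ?nnegrE ?cabs_ge0.
    - have [z1|z1] := leP 1 (cabs (z - r%:C)).
        by rewrite (k_out _ z1).2 !(mulr0, mul0r) cabs0.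
      rewrite -[N%:R * 2 ^+ N]mulr1; apply: cabsM_le.
        by apply: (cabsM_le _ (ewE _ z5)); exact: Utau.
      apply: (cabsM_le _ (e_le1 _)).
      have -> : N%:R * 2 ^+ N = N%:R * 2 ^+ N.-1 * 2 :> R.
        by case: (N) => [|m]; rewrite ?mul0r// exprS -[2 * _]mulrC mulrA.
      apply: (cabsM_le _ (qk_le2 _)); apply: cabsM_le.
        by rewrite -(rmorph_nat (real_complex R)) cabs_real ger0_norm.
      by rewrite cabsX lerXn2r ?nnegrE ?cabs_ge0.
    - have [z2|z2] := leP (cabs (z - r%:C)) (2 * r).
        by rewrite (e_in _ z2).2 !(mulr0, mul0r) cabs0.
      apply: cabsM_le; first by apply: (cabsM_le _ (ewE _ z5)); exact: UB.
      apply: cabsM_le.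
        have z1 := le_trans r12 (ltW z2).
        have ii : (cabs (z - r%:C))^-1 <= (2 * r)^-1 by rewrite lef_pV2 ?posrE ?(ltW z2) ?(lt_le_trans _ z1) ?(lt_le_trans _ r12).
        rewrite cabsX (k_out _ z1).1.
        by apply: lerXn2r; rewrite // nnegrE invr_ge0 cabs_ge0.
      apply: le_trans (qe_le _) _.
      by rewrite ler_pdivrMr// mulr_gt0// subr_gt0 !expr2; lra.
  have z50 : disc (5 * r) 0 by rewrite /disc cabs0 mulr_ge0.
  have CP : cabs (cauchy_sum J2 (5 * r) qg 0 - g 0) <= d.
    apply: (le_trans _ J2d); apply: (cauchy_pompeiu_error J20 L20 Kg0 Hg) => z.
      by rewrite subr0.
    rewrite subr0 => z5.
    have z3 : 3 * r <= cabs (z - r%:C).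
      by have := cabs_tri z r%:C; rewrite cabs_real ger0_norm// z5; lra.
    by rewrite /g (e_out _ z3).1 !mulr0.
  have CS : cabs (cauchy_sum J2 (5 * r) qg 0) <= 2 * (5 * r) * Q d.
    apply: cabs_cauchy_sum => //; first exact: ltW.
    by move=> z; rewrite subr0 => z5; exact: qgQ.
  have g0 : (1 - d) * (E^-1 * r^-1 ^+ N) <= cabs (g 0).
    have c0r : cabs (0 - r%:C) = r by rewrite sub0r cabsN cabs_real ger0_norm.
    have c2r : cabs (0 - r%:C) <= 2 * r by rewrite c0r.
    have rr1 : 1 <= cabs (0 - r%:C) by rewrite c0r.
    have -> : cabs (g 0) = cabs (U 0) * cabs (cexp (-1 * w 0)) * r^-1 ^+ N.
      by rewrite /g (e_in _ c2r).1 mulr1 cabsM (cabsM (U 0)) cabsX (k_out _ rr1).1 c0r.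
    rewrite [leLHS]mulrA.
    have rV0 : 0 <= r^-1 ^+ N by rewrite exprn_ge0// invr_ge0.
    have EV : E^-1 <= cabs (cexp (-1 * w 0)).
      rewrite cabs_cexp -expRN ler_expR mulN1r lerNl.
      apply: le_trans (ler_norm _) _; rewrite -normrN opprK.
      by apply: le_trans (norm_Re_le _) _; rewrite cabsN; exact: wA.
    have EV0 : 0 <= E^-1 by rewrite invr_ge0.
    have H1 : (1 - d) * E^-1 <= cabs (U 0) * E^-1 by rewrite ler_wpM2r.
    have H2 : cabs (U 0) * E^-1 <= cabs (U 0) * cabs (cexp (-1 * w 0)).
      by rewrite ler_wpM2l// cabs_ge0.
    by rewrite ler_wpM2r// (le_trans H1).
  apply: le_trans g0 _; have := cabs_tri (g 0) (cauchy_sum J2 (5 * r) qg 0).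
  rewrite cabsBC; lra.
(* Multiplying [key] by E r^N turns the part of its right-hand side without d into X. Y - 1 collects
   the coefficients of d there, and the 1 accounts for 1 - d on the left. *)
pose Y := 1 + 10 * r * E ^+ 2 * r ^+ N * ((1 + B) * 2 ^+ N + N%:R * 2 ^+ N) + E * r ^+ N.
have Y1 : 1 <= Y.
  by rewrite /Y -addrA lerDl addr_ge0// !mulr_ge0 ?exprn_ge0// addr_ge0// mulr_ge0//; lra.
have fin d : 0 < d -> 1 <= X + d * Y.
  move=> /key k.
  have : (1 - d) * (E^-1 * r^-1 ^+ N) * (E * r ^+ N) <= (10 * r * Q d + d) * (E * r ^+ N).
    by rewrite ler_wpM2r// mulr_ge0// ltW.
  rewrite (_ : (1 - d) * (E^-1 * r^-1 ^+ N) * (E * r ^+ N) = 1 - d); last first.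
    by rewrite exprVn; field; rewrite !gt_eqF.
  have -> : (10 * r * Q d + d) * (E * r ^+ N) =
     X + d * (Y - 1).
    rewrite /X /Y /Q exprVn !exprMn; field.
    by rewrite !gt_eqF.
  lra.
(* If X < 1, the choice d = (1 - X)/(2Y) would give 1 <= (1 + X)/2. *)
rewrite leNgt; apply/negP => X1.
have Y0 : 0 < 2 * Y by lra.
have := fin ((1 - X) / (2 * Y)); rewrite divr_gt0//; last by rewrite subr_gt0.
rewrite (_ : (1 - X) / (2 * Y) * Y = (1 - X) / 2); last by field; rewrite gt_eqF//; lra.
by move=> /(_ isT); lra.
Qed.

End planar_estimate.

(** * Mollification *)

Section bump_function.
Context {R : realType}.
Implicit Types (f g : R -> R) (x y t : R) (k : nat).

Fixpoint smooth1 k f : Prop :=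
  match k with
  | 0 => continuous f
  | k.+1 => (forall x, derivable f x (1 : R)) /\ smooth1 k (derive1 f)
  end.

Lemma smooth1P k f df : (forall x, is_derive x (1 : R) f (df x)) ->
  smooth1 k df -> smooth1 k.+1 f.
Proof.
move=> fdf sdf; split; first by move=> x; have [] := fdf x.
by rewrite (_ : (derive1 f) = df)//; apply/funext => x; rewrite derive1E; have [_ ->] := fdf x.
Qed.

Lemma smooth1_is_derive k f x : smooth1 k.+1 f -> is_derive x (1 : R) f ((derive1 f) x).
Proof. by move=> [df _]; rewrite derive1E; exact: derivableP. Qed.

Lemma smooth1_continuous k f : smooth1 k f -> continuous f.
Proof.
case: k => [//|k [df _]] x.
exact/differentiable_continuous/derivable1_diffP.
Qed.

Lemma smooth1_pred k f : smooth1 k.+1 f -> smooth1 k f.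
Proof.
elim: k f => [|k IH] f; first exact: smooth1_continuous.
by move=> [df sf]; split => //; exact: IH.
Qed.

Lemma smooth1D k f g : smooth1 k f -> smooth1 k g -> smooth1 k (fun x => f x + g x).
Proof.
elim: k f g => [|k IH] f g sf sg.
  by move=> x; apply: cvgD; [exact: sf|exact: sg].
apply: (@smooth1P _ _ (fun x => (derive1 f) x + (derive1 g) x)); last exact: IH sf.2 sg.2.
by move=> x; apply: is_deriveD; [exact: smooth1_is_derive sf|exact: smooth1_is_derive sg].
Qed.

Lemma smooth1Z k c f : smooth1 k f -> smooth1 k (fun x => c * f x).
Proof.
elim: k f => [|k IH] f sf.
  by move=> x; apply: cvgM; [exact: cvg_cst|exact: sf].
apply: (@smooth1P _ _ (fun x => c * (derive1 f) x)); last exact: IH sf.2.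
by move=> x; apply: is_deriveZ; exact: smooth1_is_derive sf.
Qed.

Lemma smooth1M k f g : smooth1 k f -> smooth1 k g -> smooth1 k (fun x => f x * g x).
Proof.
elim: k f g => [|k IH] f g sf sg.
  by move=> x; apply: cvgM; [exact: sf|exact: sg].
apply: (@smooth1P _ _ (fun x => f x * (derive1 g) x + g x * (derive1 f) x)).
  by move=> x; apply: is_deriveM; [exact: smooth1_is_derive sf|exact: smooth1_is_derive sg].
apply: smooth1D; apply: IH.
- exact: smooth1_pred.
- exact: sg.2.
- exact: smooth1_pred.
- exact: sf.2.
Qed.

Lemma smooth1_affine k f a c : smooth1 k f -> smooth1 k (fun x => f (a * x + c)).
Proof.
have ad x : is_derive x (1 : R) (fun x => a * x + c) a.
  have := is_deriveD (is_deriveZ a (is_derive_id x (1 : R))) (is_derive_cst c x (1 : R)).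
  rewrite addr0 [a *: 1]mulr1; exact.
elim: k f => [|k IH] f sf.
  move=> x; apply: continuous_comp; last exact: sf.
  by have [/derivable1_diffP/differentiable_continuous] := ad x.
apply: (@smooth1P _ _ (fun x => a * (derive1 f) (a * x + c))); last exact/smooth1Z/IH/sf.2.
move=> x; rewrite mulrC.
have := @is_derive1_comp _ f (fun x => a * x + c) x _ _ (smooth1_is_derive _ sf) (ad x).
exact.
Qed.

(** [flat 0] is the classical e^{-1/x}. The powers of 1/x are carried along because the family is
    then closed under differentiation, so smoothness follows by an induction over all k at once. *)
Definition flat k x : R := if 0 < x then x^-1 ^+ k * expR (- x^-1) else 0.

(** From e^y >= y^(k+2)/(k+2)! at y = 1/x. The quadratic order is what makes the difference quotient
    at 0 vanish in the limit. *)
Lemma flat_bound k x : 0 < x -> flat k x <= (k.+2)`!%:R * x ^+ 2.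
Proof.
move=> x0; rewrite /flat x0.
have y0 : 0 < x^-1 by rewrite invr_gt0.
have := @expR_ge1Dxn R x^-1 k.+1 (ltW y0).
rewrite expRN => H.
have f0 : (0 : R) < (k.+2)`!%:R by rewrite ltr0n fact_gt0.
have e0 := expR_gt0 x^-1.
have H2 : x^-1 ^+ k.+2 / (k.+2)`!%:R <= expR x^-1 by lra.
rewrite ler_pdivrMr// -ler_pdivrMl//; last by rewrite mulr_gt0// exprn_gt0.
apply: le_trans H2; rewrite le_eqVlt; apply/orP; left; apply/eqP.
rewrite !exprS !exprVn; field.
by rewrite !gt_eqF// ?exprn_gt0.
Qed.

Lemma flat_ge0 k x : 0 <= flat k x.
Proof.
rewrite /flat; case: ltP => // x0.
by rewrite mulr_ge0 ?expR_ge0// exprn_ge0// invr_ge0 ltW.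
Qed.

Lemma is_derive0_quadratic f C : f 0 = 0 -> (forall x, `|f x| <= C * x ^+ 2) ->
  is_derive (0 : R) (1 : R) f 0.
Proof.
move=> f0 fC.
have C0 : 0 <= C by have := fC 1; rewrite expr1n mulr1; exact: le_trans.
have H : h^-1 *: (f (h *: (1 : R) + 0) - f 0) @[h --> (0 : R)^'] --> (0 : R).
  apply/cvgr0Pnorm_le => e e0; near=> h.
  have h0 : h != 0 by near: h; exact: nbhs_dnbhs_neq.
  rewrite addr0 f0 subr0 [h *: 1]mulr1 normrM normfV.
  rewrite ler_pdivrMl ?normr_gt0//; apply: le_trans (fC h) _.
  rewrite -(real_normK (num_real h)) expr2 mulrCA ler_wpM2l//.
  have hC : `|h| <= e / (C + 1) by near: h; apply: dnbhs0_le; rewrite divr_gt0//; lra.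
  have : (C + 1) * `|h| <= e by rewrite mulrC -ler_pdivlMr//; lra.
  have := normr_ge0 h; lra.
by apply: DeriveDef; [apply/cvg_ex; exists 0|apply/cvg_lim].
Unshelve. all: by end_near. Qed.

Lemma is_derive_flat k x : is_derive x (1 : R) (flat k) (flat k.+2 x - k%:R * flat k.+1 x).
Proof.
have flat_le0 j y : y <= 0 -> flat j y = 0 by move=> y0; rewrite /flat ltNge y0.
have [x0|x0|->] := ltgtP x 0.
- rewrite !flat_le0 ?(ltW x0)// mulr0 subrr.
  have : is_derive x (1 : R) (cst 0 : R -> R) 0 by exact: is_derive_cst.
  apply: near_eq_is_derive; near=> y; rewrite flat_le0//.
  by near: y; exact: lt_le_nbhsl.
- have iv : is_derive x (1 : R) (fun y => y^-1) (- x ^- 2).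
    have := @is_deriveV _ (fun y => y) x 1 1; rewrite gt_eqF//= => /(_ isT _).
    by rewrite scaler1; apply.
  have ie : is_derive x (1 : R) (fun y => expR (- y^-1)) (x ^- 2 * expR (- x^-1)).
    have := @is_derive1_comp _ expR (fun y => - y^-1) x _ _ _ (is_deriveN iv).
    by rewrite opprK [_ * expR _]mulrC; apply.
  have ik : is_derive x (1 : R) (fun y => y^-1 ^+ k) (k%:R * x^-1 ^+ k.-1 * - x ^- 2).
    have := is_deriveX k iv; rewrite /GRing.scale/=.
    rewrite (_ : (fun y : R => y^-1) ^+ k = (fun y => y^-1 ^+ k)); first exact.
    by apply/funext => y; rewrite exprfctE.
  have iM := is_deriveM ik ie.
  have -> : flat k.+2 x - k%:R * flat k.+1 x =
    x^-1 ^+ k *: (x ^- 2 * expR (- x^-1)) + expR (- x^-1) *: (k%:R * x^-1 ^+ k.-1 * - x ^- 2).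
    rewrite /flat x0 /GRing.scale/= -exprVn; case: k {ik iM} => [|k] /=.
      by rewrite !expr0; ring.
    by rewrite !exprS; ring.
  move: iM; apply: near_eq_is_derive; near=> y; rewrite /flat.
  suff -> : 0 < y by [].
  by near: y; exact: lt_nbhsr.
- rewrite !flat_le0// mulr0 subrr.
  apply: (@is_derive0_quadratic _ (k.+2)`!%:R); first by rewrite flat_le0.
  move=> y; have [y0|y0] := ltP 0 y; first by rewrite ger0_norm ?flat_ge0// flat_bound.
  by rewrite flat_le0// normr0 mulr_ge0// sqr_ge0.
Unshelve. all: by end_near. Qed.

Lemma smooth1_flat m k : smooth1 m (flat k).
Proof.
elim: m k => [|m IH] k.
  move=> x; apply/differentiable_continuous/derivable1_diffP.
  by have [] := is_derive_flat k x.
apply: (smooth1P (is_derive_flat k)).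
rewrite (_ : (fun _ => _) = (fun x => flat k.+2 x + (- k%:R) * flat k.+1 x)).
  by apply: smooth1D => //; exact: smooth1Z.
by apply/funext => x; rewrite mulNr.
Qed.

Definition smooth_bump x := flat 0 (1 + x) * flat 0 (1 - x).

Lemma smooth_bump_ge0 x : 0 <= smooth_bump x.
Proof. by rewrite mulr_ge0 ?flat_ge0. Qed.

Lemma bump_out x : 1 <= `|x| -> smooth_bump x = 0.
Proof.
rewrite ler_normr /smooth_bump /flat => /orP[x1|x1].
  by rewrite [0 < 1 - x]ltNge (_ : 1 - x <= 0) ?mulr0// subr_le0.
rewrite [0 < 1 + x]ltNge (_ : 1 + x <= 0) ?mul0r//.
lra.
Qed.

Lemma smooth1_bump k : smooth1 k smooth_bump.
Proof.
have h1 := smooth1_affine 1 1 (smooth1_flat k 0).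
have h2 := smooth1_affine (-1) 1 (smooth1_flat k 0).
have := smooth1M h1 h2; rewrite (_ : (fun _ => _) = smooth_bump)//.
by apply/funext => x; rewrite /smooth_bump mul1r mulN1r addrC [- x + 1]addrC.
Qed.

(** The inequality is strict so that f vanishes in a neighbourhood of x; in this form the lemma can
    be iterated to higher derivatives. *)
Lemma derive1_out f : (forall x, 1 < `|x| -> f x = 0) ->
  forall x, 1 < `|x| -> (derive1 f) x = 0.
Proof.
move=> f0 x x1; rewrite derive1E.
have : is_derive x (1 : R) (cst 0 : R -> R) 0 by exact: is_derive_cst.
move=> H; have [_ //] : is_derive x (1 : R) f 0.
apply: near_eq_is_derive H; near=> y; rewrite f0//.
near: y; have : (`|y : R^o| @[y --> x] --> `|x : R^o|) by apply: cvg_norm; exact: cvg_id.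
by move/cvgr_gt; exact.
Unshelve. all: by end_near. Qed.

Lemma bounded_of_support f : continuous f -> (forall x, 1 < `|x| -> f x = 0) ->
  exists2 L, 0 <= L & forall x, `|f x| <= L.
Proof.
move=> cf f0.
have cn : {within `[-1, 1], continuous (fun x => `|f x|)}.
  apply: continuous_subspaceT => x.
  by apply: cvg_norm; exact: cf.
have [|c _ fc] := EVT_max _ cn; first by lra.
exists `|f c| => // x; have [x1|x1] := leP `|x| 1; last by rewrite f0// normr0.
by apply: fc; rewrite in_itv/= -ler_norml.
Qed.

Lemma quadratic_bump : exists2 L, 0 <= L & quadratic L (fun=> True) smooth_bump (derive1 smooth_bump).
Proof.
have b0 x : 1 < `|x| -> smooth_bump x = 0 by move=> /ltW; exact: bump_out.
have b1 := derive1_out b0; have b2 := derive1_out b1.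
have s3 := smooth1_bump 3.
have s2 : smooth1 2 (derive1 smooth_bump) by exact: s3.2.
have s1 : smooth1 1 (derive1 (derive1 smooth_bump)) by exact: s2.2.
have [L0 L00 B0] := bounded_of_support (smooth1_continuous s3) b0.
have [L1 L10 B1] := bounded_of_support (smooth1_continuous s2) b1.
have [L2 L20 B2] := bounded_of_support (smooth1_continuous s1) b2.
have d0 c : is_derive c (1 : R) smooth_bump (derive1 smooth_bump c) by exact: smooth1_is_derive s3.
have d1 c : is_derive c (1 : R) (derive1 smooth_bump) (derive1 (derive1 smooth_bump) c).
  exact: smooth1_is_derive s2.
exists (L0 + L1 + L2); first by rewrite !addr_ge0.
move=> s _; split; first by have := B0 s; have := B1 s; split; lra.
move=> t _; have t0 := normr_ge0 t; have tE : s + t - s = t by rewrite addrC addKr.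
have e1 : `|smooth_bump (s + t) - smooth_bump s| <= L1 * `|t|.
  by rewrite -{2}tE; apply: (le_derive_bound d0) => c _; exact: B1.
have e2 : `|derive1 smooth_bump (s + t) - derive1 smooth_bump s| <= L2 * `|t|.
  by rewrite -{2}tE; apply: (le_derive_bound d1) => c _; exact: B2.
have e3 : `|smooth_bump (s + t) - smooth_bump s - derive1 smooth_bump s * t| <= L2 * `|t| ^+ 2.
  by apply: (le_taylor2 d0 d1) => c _; exact: B2.
split.
- by apply: (le_trans e1); rewrite ler_wpM2r//; lra.
- by apply: (le_trans e2); rewrite ler_wpM2r//; lra.
- by apply: (le_trans e3); rewrite ler_wpM2r ?exprn_ge0//; lra.
Qed.

End bump_function.

Section topology_Cn.
Context {R : realType} {n : nat}.
Local Notation C := R[i].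
Local Notation Cn := 'rV[C]_n.
Implicit Types (z w : Cn) (u : Cn -> C).

Definition coordR (d : 'I_n * bool) z : R :=
  if d.2 then Im (z 0 d.1) else Re (z 0 d.1).

Lemma norm_cabs (a : C) : `|a| = (cabs a)%:C.
Proof. by rewrite normc_def; case: a. Qed.

Lemma ball_cabs (a b : C) (e : R) : ball a e%:C b <-> cabs (a - b) < e.
Proof. by rewrite -ball_normE /ball_/= norm_cabs ltcR. Qed.

(** Radii of balls in R[i] are positive for its partial order, hence real. *)
Lemma pos_complexP (e : C) : 0 < e -> 0 < Re e /\ e = (Re e)%:C.
Proof. by case: e => a b; rewrite ltcE/= => /andP[/eqP -> ?]. Qed.

Lemma nbhs_CnP z (A : set Cn) : nbhs z A <-> exists2 d : R, 0 < d &
  forall w, (forall j, cabs (z 0 j - w 0 j) < d) -> A w.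
Proof.
split=> [/nbhs_ballP[d d0 dP]|[d d0 dP]].
  have [d1 dE] := pos_complexP d0; exists (Re d) => // w zw.
  by apply: dP; split => // i j; rewrite ord1 dE; apply/ball_cabs; exact: zw.
apply/nbhs_ballP; exists d%:C; first by rewrite /= ltcR.
by move=> w [_ zw]; apply: dP => j; apply/ball_cabs; exact: zw.
Qed.

Lemma continuous_CnP u : continuous u <-> forall z (e : R), 0 < e ->
  exists2 d : R, 0 < d & forall w, (forall j, cabs (z 0 j - w 0 j) < d) -> cabs (u z - u w) < e.
Proof.
split=> [cu z e e0|H z].
  have e0' : 0 < e%:C by rewrite ltcR.
  have := @cu z; move=> /cvgrPdist_lt /(_ _ e0') /nbhs_CnP[d d0 dP].
  by exists d => // w /dP; rewrite /= norm_cabs ltcR.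
have FF : Filter (nbhs z) by exact: nbhs_filter.
apply/(@cvgrPdist_lt _ _ _ (nbhs z) FF u (u z)) => e /pos_complexP[e1 ->].
have [d d0 dP] := H z _ e1.
by apply/nbhs_CnP; exists d => // w /dP; rewrite norm_cabs ltcR.
Qed.

Lemma continuous_CnRP (f : Cn -> R) : continuous f <-> forall z (e : R), 0 < e ->
  exists2 d : R, 0 < d & forall w, (forall j, cabs (z 0 j - w 0 j) < d) -> `|f z - f w| < e.
Proof.
split=> [cf z e e0|H z].
  have := @cf z; move=> /cvgrPdist_lt /(_ _ e0) /nbhs_CnP[d d0 dP].
  by exists d.
have FF : Filter (nbhs z) by exact: nbhs_filter.
apply/(@cvgrPdist_lt _ _ _ (nbhs z) FF f (f z)) => e e0.
have [d d0 dP] := H z _ e0.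
by apply/nbhs_CnP; exists d.
Qed.

Lemma continuous_coordR d : continuous (coordR d).
Proof.
apply/continuous_CnRP => z e e0; exists e => // w zw.
apply: le_lt_trans (zw d.1); rewrite /coordR; case: d.2.
- by rewrite -raddfB norm_Im_le.
- by rewrite -raddfB norm_Re_le.
Qed.

Definition box (c : Cn) (r : R) : set Cn :=
  [set w | forall d, `|coordR d (w - c)| <= r].

Lemma coordRB d z w : coordR d (z - w) = coordR d z - coordR d w.
Proof. by rewrite /coordR !mxE; case: d.2; rewrite raddfB. Qed.

Lemma compact_box c r : compact (box c r).
Proof.
pose A (j : 'I_n) : set C := (fun p : R * R => p.1 +i* p.2) @`
  (`[Re (c 0 j) - r, Re (c 0 j) + r]%classic `*` `[Im (c 0 j) - r, Im (c 0 j) + r]%classic).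
have -> : box c r = [set v : Cn | forall j, A j (v ord0 j)].
  apply/seteqP; split => w wc j.
    exists (Re (w 0 j), Im (w 0 j)); last by case: (w 0 j).
    have := wc (j, false); have := wc (j, true).
    by rewrite /coordR/= !mxE !raddfB/= !in_itv/= !ler_norml; split; lra.
  case: j => j b; rewrite /coordR !mxE !raddfB/= ; have [[x y] /= + <-] := wc j.
  by rewrite !in_itv/= => -[? ?]; case: b; rewrite ler_norml; lra.
apply: rV_compact => j; apply: continuous_compact.
  apply: continuous_subspaceT => -[x y] B /nbhs_ballP[e e0 eB].
  have [e1 eE] := pos_complexP e0.
  have e2 : 0 < Re e / 2 by rewrite divr_gt0.
  apply/nbhs_ballP; exists (Re e / 2) => // -[x' y'] [/= bx by'].
  apply: eB; rewrite eE; apply/ball_cabs.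
  apply: le_lt_trans (cabs_le_ReIm _) _; rewrite /=.
  move: bx by'; rewrite -!ball_normE /ball_/=; lra.
by apply: compact_setX; exact: segment_compact.
Qed.

Lemma box_bounded u c r : continuous u -> exists2 B, 0 <= B &
  forall z, box c r z -> cabs (u z) <= B.
Proof.
move=> /continuous_CnP cu; have /compact_near_coveringP ck := @compact_box c r.
pose P (k : R) z := cabs (u z) <= k.
have [|k [_ kP]] := ck _ (pinfty_nbhs R) P _.
  move=> z _; have [d d0 dP] := cu z 1 ltr01.
  exists ([set w : Cn | forall j, cabs (z 0 j - w 0 j) < d], [set k | cabs (u z) + 1 < k]).
    split => /=.
      by apply/nbhs_CnP; exists d.
    by exists (cabs (u z) + 1); split; [exact: num_real|].
  move=> [w k] /= [zw kz]; rewrite /P; have := cabs_tri (u w) (u z).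
  by rewrite cabsBC; have := dP _ zw; lra.
have kP1 := kP (Num.max 0 k + 1).
exists (Num.max 0 k + 1); first by rewrite addr_ge0// le_max lexx.
move=> z bz; apply: kP1 => //; rewrite ltr_pwDr// le_max lexx orbT//.
Qed.

(** Only z is confined to the box: later w ranges over the support of a mollifier centred at z,
    which may stick out. *)
Lemma box_unif_continuous u c r e : continuous u -> 0 < e -> exists2 d, 0 < d &
  forall z w, box c r z -> (forall j, cabs (z 0 j - w 0 j) <= d) -> cabs (u z - u w) <= e.
Proof.
move=> /continuous_CnP cu e0; have /compact_near_coveringP ck := @compact_box c r.
pose P (d : R) z := forall w, (forall j, cabs (z 0 j - w 0 j) <= d) -> cabs (u z - u w) <= e.
have e2 : 0 < e / 2 by rewrite divr_gt0.
have [|D /= D0 DP] := ck _ (0^'+ : set_system R) P _.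
  move=> z _; have [d d0 dP] := cu z _ e2.
  have d2 : 0 < d / 2 by rewrite divr_gt0.
  exists ([set w : Cn | forall j, cabs (z 0 j - w 0 j) < d / 2], [set k | k < d / 2]).
    split => /=.
      by apply/nbhs_CnP; exists (d / 2).
    exact: nbhs_right_lt.
  move=> [w k] /= [zw kd] y wy.
  have h1 : cabs (u z - u w) < e / 2.
    by apply: dP => j; apply: lt_trans (zw j) _; lra.
  have h2 : cabs (u z - u y) < e / 2.
    apply: dP => j; have := cabsD (z 0 j - w 0 j) (w 0 j - y 0 j).
    rewrite addrA subrK; have := zw j; have := wy j; lra.
  have := cabsD (u w - u z) (u z - u y); rewrite addrA subrK (cabsBC (u w)); lra.
have D2 : 0 < D / 2 by rewrite divr_gt0.
exists (D / 2) => // z w bz; apply: (DP (D / 2)) => //=.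
by rewrite sub0r normrN gtr0_norm//; lra.
Qed.

End topology_Cn.

Section product_test_function.
Context {R : realType} {n : nat}.
Local Notation C := R[i].
Local Notation Cn := 'rV[C]_n.
Local Notation I := ('I_n * bool)%type.
Implicit Types (z w : Cn) (b : I -> R -> R) (d : I).

Definition prodR b w : R := \prod_d b d (coordR d w).

Definition upd b d (f : R -> R) : I -> R -> R := fun d' => if d' == d then f else b d'.

Lemma coordR_rdir d d' z (s : R) :
  coordR d' (z + s%:C *: rdir R d) = coordR d' z + (if d' == d then s else 0).
Proof.
case: d d' => [j c] [j' c']; rewrite /coordR /rdir !mxE eqxx/= xpair_eqE.
case: (eqVneq j' j) => [->|_] /=; last first.
  by rewrite mulr0 mulr0 addr0; case: c'; rewrite addr0.
rewrite mulr1.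
by case: c' => /=; rewrite raddfD; case: c => /=; rewrite ?mul0r ?mulr0 ?mulr1 ?subr0 ?addr0 ?add0r.
Qed.

Lemma prodR_upd b d f w :
  prodR (upd b d f) w = f (coordR d w) * \prod_(d' | d' != d) b d' (coordR d' w).
Proof.
rewrite /prodR (bigD1 d)//= /upd eqxx; congr (_ * _).
by apply: eq_bigr => d' /negbTE ->.
Qed.

Lemma is_derive_rline_prodR b d z : (forall d, smooth1 1 (b d)) ->
  is_derive (0 : R) (1 : R) (rline (prodR b) d z) (prodR (upd b d (derive1 (b d))) z).
Proof.
move=> sb; set k := \prod_(d' | d' != d) b d' (coordR d' z).
have -> : rline (prodR b) d z = fun s => k * b d (1 * s + coordR d z).
  apply/funext => s; rewrite /rline /prodR (bigD1 d)//= coordR_rdir eqxx.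
  rewrite mulrC mul1r [s + _]addrC; congr (_ * _); apply: eq_bigr => d' /negbTE dd.
  by rewrite coordR_rdir dd addr0.
have s1 := smooth1_affine 1 (coordR d z) (sb d).
have H := is_deriveZ k (smooth1_is_derive 0 s1).
suff <- : k *: derive1 (fun s => b d (1 * s + coordR d z)) 0 = prodR (upd b d (derive1 (b d))) z by [].
rewrite prodR_upd mulrC; congr (_ * _).
have -> : coordR d z = 1 * 0 + coordR d z by rewrite mulr0 add0r.
rewrite mulr0 add0r derive1E.
have ad : is_derive (0 : R) (1 : R) (fun s => 1 * s + coordR d z) 1.
  have := is_deriveD (is_deriveZ 1 (is_derive_id (0 : R) (1 : R))) (is_derive_cst (coordR d z) (0 : R) (1 : R)).
  rewrite addr0 [1 *: 1]mulr1; exact.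
have := @is_derive1_comp _ (b d) (fun s => 1 * s + coordR d z) 0 _ _ (smooth1_is_derive _ (sb d)) ad.
by move=> [_ ->]; rewrite mulr1 mulr0 add0r.
Qed.

Lemma rpartial_prodR b d : (forall d, smooth1 1 (b d)) ->
  rpartial d (prodR b) = prodR (upd b d (derive1 (b d))).
Proof.
move=> sb; apply/funext => z; rewrite /rpartial derive1E.
by have [_ ->] := is_derive_rline_prodR d z sb.
Qed.

Lemma continuous_prodR b : (forall d, continuous (b d)) -> continuous (prodR b).
Proof.
move=> cb; suff H (s : seq I) : continuous (fun w => \prod_(d <- s) b d (coordR d w)).
  exact: H.
elim: s => [|d s IH].
  rewrite (_ : (fun w => _) = fun=> 1); last by apply/funext => w; rewrite big_nil.
  exact: cst_continuous.
rewrite (_ : (fun w => _) = fun w => b d (coordR d w) * \prod_(d <- s) b d (coordR d w)); last first.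
  by apply/funext => w; rewrite big_cons.
have c1 : continuous (fun w => b d (coordR d w)).
  by move=> w; apply: (@continuous_comp _ _ _ (coordR d) (b d) w); [exact: continuous_coordR|exact: cb].
by move=> w; apply: (@continuousM _ _ (fun w => b d (coordR d w))); [exact: c1|exact: IH].
Qed.

(** A partial derivative replaces one factor by its derivative and leaves a product of the same
    kind, so the induction on k runs over all families b. *)
Lemma rCk_prodR k b : (forall d, smooth1 k (b d)) -> rCk k (prodR b).
Proof.
elim: k b => [|k IH] b sb.
  exact: continuous_prodR.
have s1 d : smooth1 1 (b d).
  elim: (k) (b d) (sb d) => [//|m IHm] f sf; apply: IHm; exact: smooth1_pred.
split; first by apply: continuous_prodR => d; exact: smooth1_continuous (sb d).
move=> d; split; first by move=> z; have [] := is_derive_rline_prodR d z s1.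
rewrite rpartial_prodR//; apply: IH => d'; rewrite /upd; case: eqP => _.
  by have [] := sb d.
exact: smooth1_pred.
Qed.

Lemma rCk_cst0 k : rCk k (fun _ : Cn => 0 : R).
Proof.
elim: k => [|k IH]; first by exact: cst_continuous.
split; first by exact: cst_continuous.
move=> d; split; first by move=> z; exact: derivable_cst.
rewrite (_ : rpartial d _ = fun=> 0)//.
by apply/funext => z; rewrite /rpartial /rline derive1_cst.
Qed.

Lemma test_function_prodR b c r : (forall k d, smooth1 k (b d)) ->
  (forall d x, r < `|x - coordR d c| -> b d x = 0) ->
  test_function (fun w => (prodR b w)%:C).
Proof.
move=> sb b0; split; first by move=> k; split; [exact: rCk_prodR|exact: rCk_cst0].
have cb : compact (box c r) by exact: compact_box.
apply: (subclosed_compact (@closed_closure _ _) cb).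
have clb : closed (box c r) by apply: compact_closed cb; exact: norm_hausdorff.
rewrite [X in _ `<=` X]((closure_id _).1 clb); apply: closureS => w /= wb d.
rewrite leNgt; apply: contra wb => wd.
rewrite eq_complex/= eqxx andbT /prodR (bigD1 d)//= b0 ?mul0r//.
by rewrite -coordRB.
Qed.

Lemma dzbar_prodR b j w : (forall d, smooth1 1 (b d)) ->
  dzbar j (fun w => (prodR b w)%:C) w =
  2^-1 * ((prodR (upd b (j, false) (derive1 (b (j, false)))) w)%:C +
          'i * (prodR (upd b (j, true) (derive1 (b (j, true)))) w)%:C).
Proof.
move=> sb; have cp d : cpartial d (fun w => (prodR b w)%:C) w =
    (prodR (upd b d (derive1 (b d))) w)%:C.
  rewrite /cpartial/= -rpartial_prodR// /rpartial.
  by rewrite [X in _ +i* X](_ : _ = 0)//= /rline/= derive1_cst.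
by rewrite /dzbar !cp.
Qed.

End product_test_function.

Section mollifier.
Context {R : realType}.
Local Notation C := R[i].

Lemma wirtinger_ext_in K (S : C -> Prop) g p q g' p' q' :
  (forall z, S z -> g z = g' z) -> (forall z, S z -> p z = p' z) ->
  (forall z, S z -> q z = q' z) -> wirtinger K S g p q -> wirtinger K S g' p' q'.
Proof.
move=> gg pp qq H z Sz; have [H1 H2] := H _ Sz.
rewrite -!(gg, pp, qq)//; split => // h Sh.
by have := H2 _ Sh; rewrite -!(gg, pp, qq).
Qed.

(** The constant is chosen before the functions: the factors of the mollifier depend on a point w,
    and the bound has to be uniform in w to survive integration. *)
Lemma wirtinger_prod (I : eqType) (s : seq I) (K : R) : 0 <= K -> uniq s ->
  exists2 L : R, 0 <= L & forall (S : C -> Prop) (f p q : I -> C -> C),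
    (forall i, wirtinger K S (f i) (p i) (q i)) ->
    wirtinger L S (fun z => \prod_(i <- s) f i z)
      (fun z => \sum_(i <- s) p i z * \prod_(j <- s | j != i) f j z)
      (fun z => \sum_(i <- s) q i z * \prod_(j <- s | j != i) f j z).
Proof.
move=> K0; elim: s => [|i s IH] /=.
  move=> _; exists 1 => // S f p q H.
  have H1 := @wirtinger_cst R S 1; rewrite cabs1 in H1.
  by apply: wirtinger_ext H1 => z; rewrite big_nil.
move=> /andP[si us]; have [L L0 H] := IH us.
exists (4 * (K * L)); first by rewrite !mulr_ge0.
move=> S f p q Hi.
have dE (g : I -> C -> C) z : \sum_(k <- i :: s) g k z * \prod_(j <- i :: s | j != k) f j z =
    g i z * \prod_(j <- s) f j z + f i z * \sum_(k <- s) g k z * \prod_(j <- s | j != k) f j z.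
  rewrite big_cons big_cons eqxx/=; congr (_ * _ + _).
    rewrite big_seq_cond [RHS]big_seq; apply: eq_bigl => k.
    by case: (boolP (k \in s)) => //= ks; apply: contraNneq si => <-.
  rewrite mulr_sumr big_seq [RHS]big_seq; apply: eq_bigr => k ks.
  rewrite big_cons (_ : i != k); last by apply: contraNneq si => ->.
  by rewrite mulrCA.
apply: wirtinger_ext (wirtingerM K0 L0 (Hi i) (H S f p q Hi)) => z.
- by rewrite big_cons.
- by rewrite dE.
- by rewrite dE.
Qed.

Context {n : nat}.
Local Notation Cn := 'rV[C]_n.
Local Notation I := ('I_n * bool)%type.
Implicit Types (z w v : Cn) (d : I) (zeta : C).

Definition molb (e : R) z d (x : R) : R := smooth_bump (e^-1 * x + - (e^-1 * coordR d z)).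

Definition mol e z w : R := prodR (molb e z) w.

Definition dmol e d z w : R :=
  prodR (upd (molb e z) d (derive1 (molb e z d))) w.

(** [dcoord v d] and [dbar_coord v d] are the constant Wirtinger derivatives of zeta |-> coordinate
    d of zeta v, read off from Re a = (a + conj a)/2 and Im a = (a - conj a)/(2i). *)
Definition dcoord v d : C :=
  if d.2 then - 2^-1 * 'i * v 0 d.1 else 2^-1 * v 0 d.1.

Definition dbar_coord v d : C :=
  if d.2 then 2^-1 * 'i * (v 0 d.1)^* else 2^-1 * (v 0 d.1)^*.

Lemma smooth1_molb k e z d : smooth1 k (molb e z d).
Proof. exact: smooth1_affine (smooth1_bump k). Qed.

Lemma molb_out e z d x : 0 < e -> e <= `|x - coordR d z| -> molb e z d x = 0.
Proof.
move=> e0 H; rewrite /molb bump_out// -mulrBr normrM normfV (gtr0_norm e0).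
by rewrite ler_pdivlMl// mulr1.
Qed.

Lemma derive1_molb e z d x :
  derive1 (molb e z d) x = e^-1 * derive1 smooth_bump (e^-1 * x + - (e^-1 * coordR d z)).
Proof.
have ad : is_derive x (1 : R) (fun x => e^-1 * x + - (e^-1 * coordR d z)) e^-1.
  have := is_deriveD (is_deriveZ e^-1 (is_derive_id x (1 : R)))
    (is_derive_cst (- (e^-1 * coordR d z)) x (1 : R)).
  rewrite addr0 [e^-1 *: 1]mulr1; exact.
have sb := smooth1_is_derive (e^-1 * x + - (e^-1 * coordR d z)) (smooth1_bump 1).
have := @is_derive1_comp _ smooth_bump (fun x => e^-1 * x + - (e^-1 * coordR d z)) x _ _ sb ad.
by move=> [_ H]; rewrite derive1E [LHS]H mulrC.
Qed.

Lemma coordR_wirtinger v D d : (forall j, cabs (v 0 j) <= 1) -> 0 <= D ->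
  wirtinger (1 + D) (disc D) (fun zeta => (coordR d (zeta *: v))%:C)
    (fun=> dcoord v d) (fun=> dbar_coord v d).
Proof.
move=> v1 D0.
have cE zeta : (coordR d (zeta *: v))%:C = dcoord v d * zeta + dbar_coord v d * zeta^*.
  have ii : 'i * 'i = -1 :> C by rewrite -expr2 sqr_i.
  have h2 : (2 : C) * 2^-1 = 1 by rewrite divff// pnatr_eq0.
  rewrite /coordR /dcoord /dbar_coord !mxE; set x := v 0 d.1; case: d.2.
    have -> : (Im (zeta * x))%:C = ((zeta * x)^* - zeta * x) / 2 * 'i by rewrite -ImJ_sub.
    rewrite conjcM; ring.
  have -> : (Re (zeta * x))%:C = (zeta * x + (zeta * x)^*) / 2 by rewrite -ReJ_add.
  rewrite conjcM; ring.
have half : cabs (2^-1 : C) <= 1.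
  rewrite cabsV (_ : (2 : C) = 2%:C) ?cabs_real ?ger0_norm//; first by lra.
  by rewrite rmorph_nat.
have hx : cabs (2^-1 : C) * cabs (v 0 d.1) <= 1.
  by have := ler_pM (cabs_ge0 _) (cabs_ge0 _) half (v1 d.1); rewrite mulr1.
have d1 : cabs (dcoord v d) <= 1.
  by rewrite /dcoord; case: d.2; rewrite !cabsM ?cabsN ?cabs_i ?mulr1.
have d2 : cabs (dbar_coord v d) <= 1.
  by rewrite /dbar_coord; case: d.2; rewrite !cabsM ?cabs_i ?mulr1 cabsJ.
have cb (h : C) : cabs (coordR d (h *: v))%:C <= cabs h.
  rewrite cabs_real /coordR !mxE.
  have hv : cabs (h * v 0 d.1) <= cabs h by rewrite cabsM ler_piMr// cabs_ge0.
  by case: d.2; apply: le_trans hv; [exact: norm_Im_le|exact: norm_Re_le].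
have cD (a b : C) : coordR d ((a + b) *: v) - coordR d (a *: v) = coordR d (b *: v).
  by rewrite -coordRB -scalerBl addrC addKr.
move=> z zD; split.
  by split; [apply: le_trans (cb z) _; rewrite /disc in zD; lra|lra|lra].
move=> h _; have h0 := cabs_ge0 h; rewrite !subrr cabs0.
have -> : (coordR d ((z + h) *: v))%:C - (coordR d (z *: v))%:C = (coordR d (h *: v))%:C.
  by rewrite -(cD z h) rmorphB.
have := cb h; rewrite cE => chle.
have -> : dcoord v d * h + dbar_coord v d * h^* - dcoord v d * h - dbar_coord v d * h^* = 0.
  by ring.
rewrite cabs0.
have Dh : 0 <= D * cabs h by rewrite mulr_ge0.
have Dh2 : 0 <= (1 + D) * cabs h ^+ 2 by rewrite mulr_ge0 ?exprn_ge0// addr_ge0.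
by split; lra.
Qed.

Lemma dmolE e d z w : dmol e d z w =
  e^-1 * derive1 smooth_bump (e^-1 * coordR d w + - (e^-1 * coordR d z)) *
  \prod_(d' | d' != d) smooth_bump (e^-1 * coordR d' w + - (e^-1 * coordR d' z)).
Proof. by rewrite /dmol prodR_upd derive1_molb. Qed.

Lemma coordR_scale_le v D zeta d : (forall j, cabs (v 0 j) <= 1) -> disc D zeta ->
  `|coordR d (zeta *: v)| <= D.
Proof.
rewrite /disc => v1 zD; rewrite /coordR !mxE.
have hv : cabs (zeta * v 0 d.1) <= cabs zeta by rewrite cabsM ler_piMr// cabs_ge0.
by apply: le_trans (le_trans hv zD); case: d.2; [exact: norm_Im_le|exact: norm_Re_le].
Qed.

(** Some coordinate of w differs from that of zeta v by strictly more than e, so the bump factor in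
    this coordinate vanishes together with its derivative. *)
Lemma mol_out e v D zeta w : 0 < e -> (forall j, cabs (v 0 j) <= 1) ->
  disc D zeta -> ~ box 0 (D + e) w ->
  mol e (zeta *: v) w = 0 /\ forall d, dmol e d (zeta *: v) w = 0.
Proof.
move=> e0 v1 zD /existsNP[d0]; rewrite subr0 => /negP; rewrite -ltNge => wB.
have far : e < `|coordR d0 w - coordR d0 (zeta *: v)|.
  have := ler_normD (coordR d0 w - coordR d0 (zeta *: v)) (coordR d0 (zeta *: v)).
  by rewrite subrK; have := coordR_scale_le d0 v1 zD; lra.
have rfar : 1 < `|e^-1 * coordR d0 w + - (e^-1 * coordR d0 (zeta *: v))|.
  move: far; rewrite -mulrBr normrM normfV (gtr0_norm e0) => H.
  by rewrite ltr_pdivlMl// mulr1.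
have b0 : smooth_bump (e^-1 * coordR d0 w + - (e^-1 * coordR d0 (zeta *: v))) = 0.
  exact/bump_out/ltW.
have b1 : derive1 smooth_bump (e^-1 * coordR d0 w + - (e^-1 * coordR d0 (zeta *: v))) = 0.
  by apply: derive1_out rfar => x /ltW; exact: bump_out.
split; first by rewrite /mol /prodR (bigD1 d0)//= /molb b0 mul0r.
move=> d; rewrite dmolE; have [->|dd] := eqVneq d d0; first by rewrite b1 mulr0 mul0r.
by rewrite (bigD1 d0) 1?eq_sym//= b0 mul0r mulr0.
Qed.

(** The kernel depends on w - zeta v, so its zeta-derivatives are minus combinations of its
    w-derivatives, which is what the weak equation can be tested with. The constant is uniform in w:
    outside a box everything vanishes, and inside it the arguments of the bumps are bounded. *)
Lemma mol_wirtinger e v D : 0 < e -> (forall j, cabs (v 0 j) <= 1) -> 0 <= D ->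
  exists2 K, 0 <= K & forall w, wirtinger K (disc D)
    (fun zeta => (mol e (zeta *: v) w)%:C)
    (fun zeta => - \sum_d dcoord v d * (dmol e d (zeta *: v) w)%:C)
    (fun zeta => - \sum_d dbar_coord v d * (dmol e d (zeta *: v) w)%:C).
Proof.
move=> e0 v1 D0; have eV0 : 0 <= e^-1 by rewrite invr_ge0 ltW.
have [L L0 HL] := @quadratic_bump R.
pose B := D + e.
pose Kr := (e^-1 * B + e^-1 * (1 + D)).
have B0 : 0 <= B by rewrite addr_ge0// ltW.
have D10 : 0 <= 1 + D by rewrite addr_ge0.
have Kr0 : 0 <= Kr by rewrite addr_ge0// mulr_ge0.
pose Kb := L * (Kr ^+ 2 + Kr + 1).
have Kb0 : 0 <= Kb by rewrite mulr_ge0//; have := sqr_ge0 Kr; lra.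
have [K K0 HK] := wirtinger_prod Kb0 (index_enum_uniq (I : finType)).
exists K => // w.
have molE zeta : (mol e (zeta *: v) w)%:C =
    \prod_d (smooth_bump (e^-1 * coordR d w + - (e^-1 * coordR d (zeta *: v))))%:C.
  by rewrite /mol /prodR rmorph_prod.
have dmolCE zeta d : (dmol e d (zeta *: v) w)%:C =
    (e^-1)%:C * (derive1 smooth_bump (e^-1 * coordR d w + - (e^-1 * coordR d (zeta *: v))))%:C *
    \prod_(d' | d' != d) (smooth_bump (e^-1 * coordR d' w + - (e^-1 * coordR d' (zeta *: v))))%:C.
  by rewrite dmolE !rmorphM/= rmorph_prod.
have [wB|wB] := pselect (box 0 B w); last first.
  have s0 (k : I -> C) zeta : disc D zeta -> - \sum_d k d * (dmol e d (zeta *: v) w)%:C = 0.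
    move=> zD; have [_ m0] := mol_out e0 v1 zD wB.
    by rewrite big1 ?oppr0// => d _; rewrite m0 mulr0.
  apply: (@wirtinger_ext_in _ _ (fun=> 0) (fun=> 0) (fun=> 0)) => [z zD|z zD|z zD|].
  - by have [-> _] := mol_out e0 v1 zD wB.
  - by rewrite (s0 (dcoord v) _ zD).
  - by rewrite (s0 (dbar_coord v) _ zD).
  by apply: wirtinger_le (@wirtinger_cst R (disc D) 0); rewrite cabs0.
have {}wB d : `|coordR d w| <= B by have := wB d; rewrite subr0.
have Hr d : wirtinger Kr (disc D)
    (fun zeta => (e^-1 * coordR d w + - (e^-1 * coordR d (zeta *: v)))%:C)
    (fun=> - (e^-1)%:C * dcoord v d) (fun=> - (e^-1)%:C * dbar_coord v d).
  have H1 := @wirtinger_cst R (disc D) (e^-1 * coordR d w)%:C.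
  have H2 := wirtingerZ (- (e^-1)%:C) D10 (coordR_wirtinger d v1 D0).
  have := wirtingerD H1 H2; rewrite cabsN !cabs_real (ger0_norm eV0) normrM (ger0_norm eV0) => H.
  have := wirtinger_le (_ : _ <= Kr) H; rewrite lerD2r ler_wpM2l// => /(_ isT).
  apply: wirtinger_ext => z; rewrite ?add0r//.
  by rewrite rmorphD rmorphN !rmorphM mulNr.
have Hb d := wirtinger_comp Kr0 L0 (Hr d) HL (fun _ _ => Logic.I).
apply: wirtinger_ext (HK _ _ _ _ Hb) => z.
- by rewrite molE.
- rewrite -sumrN; apply: eq_bigr => d _; rewrite dmolCE; ring.
- rewrite -sumrN; apply: eq_bigr => d _; rewrite dmolCE; ring.
Qed.

End mollifier.

(** * Integration on C^n *)

Section measurability.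
Context {R : realType} {n : nat}.
Local Notation R2 := (measurableTypeR R * measurableTypeR R)%type.
Local Notation C := R[i].
Local Notation Cn := 'rV[C]_n.
Local Notation T := (n.-tuple R2).

Definition gridR (k : nat) (m : int) : R := m%:~R / k.+1%:R.

Lemma gridR_floor k x : `|x - gridR k (Num.floor (x * k.+1%:R))| <= k.+1%:R^-1.
Proof.
have k0 : (0 : R) < k.+1%:R by rewrite ltr0n.
set y := x * _; have /andP[y1 y2] := floor_itv y.
rewrite /gridR (_ : x = y / k.+1%:R); last by rewrite /y mulfK// gt_eqF.
rewrite -mulrBl normrM [X in _ * X]ger0_norm ?invr_ge0 ?ler0n// ler_piMl ?invr_ge0 ?ler0n//.
by rewrite ger0_norm ?subr_ge0//; move: y2; rewrite intrD; lra.
Qed.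

Lemma measurable_floor_fiber k (m : int) :
  measurable [set x : measurableTypeR R | Num.floor (x * k.+1%:R) = m].
Proof.
have -> : [set x : measurableTypeR R | Num.floor (x * k.+1%:R) = m] =
    (fun x : R => x * k.+1%:R) @^-1` `[m%:~R, (m + 1)%:~R[%classic.
  apply/seteqP; split => x /=; rewrite in_itv/=.
    by move=> <-; exact: floor_itv.
  by move=> H; apply: floor_def.
rewrite -[X in measurable X]setTI.
have : measurable_fun [set: R] (fun x : R => x * k.+1%:R).
  by apply: measurable_funM => //; exact: measurable_id.
by apply => //; exact: measurable_itv.
Qed.

Definition grid_tuple (k : nat) (m : n.-tuple (int * int)) : T :=
  map_tuple (fun p : int * int => (gridR k p.1, gridR k p.2) : R2) m.

Definition floor_tuple (k : nat) (t : T) : n.-tuple (int * int) :=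
  map_tuple (fun p : R2 => (Num.floor (p.1 * k.+1%:R), Num.floor (p.2 * k.+1%:R))) t.

Lemma measurable_floor_tuple k m : measurable [set t : T | floor_tuple k t = m].
Proof.
have -> : [set t : T | floor_tuple k t = m] =
  \bigcap_(j in [set: 'I_n]) ((fun t : T => tnth t j) @^-1`
    ([set x : measurableTypeR R | Num.floor (x * k.+1%:R) = (tnth m j).1] `*`
     [set x : measurableTypeR R | Num.floor (x * k.+1%:R) = (tnth m j).2])).
  apply/seteqP; split => t.
    by move=> /= <- j _; rewrite tnth_map.
  move=> H; apply: eq_from_tnth => j; rewrite tnth_map.
  by have [/= -> ->] := H j Logic.I; case: (tnth m j).
apply: fin_bigcap_measurable => [|j _]; first exact: finite_finset.
rewrite -[X in measurable X]setTI; apply: measurable_tnth => //.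
by apply: measurableX; exact: measurable_floor_fiber.
Qed.

Lemma measurable_grid k (G : n.-tuple (int * int) -> R) :
  measurable_fun [set: T] (G \o floor_tuple k).
Proof.
move=> _ Y mY; rewrite setTI.
have -> : (G \o floor_tuple k) @^-1` Y =
    \bigcup_m ([set t : T | floor_tuple k t = m] `&` [set t | Y (G m)]).
  apply/seteqP; split => t /=; first by move=> H; exists (floor_tuple k t).
  by move=> [m _ [/= <-]].
apply: countable_bigcupT_measurable => // m.
apply: measurableI; first exact: measurable_floor_tuple.
have [Ym|Ym] := pselect (Y (G m)).
  rewrite (_ : [set t | _] = setT); first exact: measurableT.
  by apply/seteqP; split.
rewrite (_ : [set t | _] = set0); first exact: measurable0.
by apply/seteqP; split.
Qed.

(** The sigma-algebra on tuples is the product one, not defined through open sets of C^n. So f is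
    the pointwise limit of its compositions with rounding to the grid of mesh 1/(k+1), which are
    constant on countably many measurable cells. *)
Lemma continuous_measurable_Cn (f : Cn -> R) : continuous f ->
  measurable_fun [set: T] (fun t => f (Cn_of_R2 t)).
Proof.
move=> /continuous_CnRP cf.
apply: (@measurable_fun_cvg _ _ _ _
  (fun k t => f (Cn_of_R2 (grid_tuple k (floor_tuple k t))))).
  move=> k; exact: (measurable_grid k (fun m => f (Cn_of_R2 (grid_tuple k m)))).
move=> t _; apply/cvgrPdist_lt => e e0.
have [d d0 dP] := cf (Cn_of_R2 t) e e0.
have d2 : 0 < d / 2 by rewrite divr_gt0.
near=> k; apply: dP => j; rewrite !mxE !tnth_map.
have kd : (k.+1%:R)^-1 < d / 2.
  by near: k; exact: (near_infty_natSinv_lt (PosNum d2)).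
apply: le_lt_trans (cabs_le_ReIm _) _; rewrite /=.
by rewrite [ltRHS]splitr; apply: ltrD; apply: le_lt_trans kd; exact: gridR_floor.
Unshelve. all: by end_near. Qed.

End measurability.

Section product_integrals.
Context {R : realType}.
Local Notation R2 := (measurableTypeR R * measurableTypeR R)%type.
Local Notation lambda := (@lebesgue_measure R).

Lemma measurable_prod_tnth n (g : 'I_n -> R2 -> R) :
  (forall j, measurable_fun [set: R2] (g j)) ->
  measurable_fun [set: n.-tuple R2] (fun t => \prod_j g j (tnth t j)).
Proof.
move=> mg; apply: (@measurable_prod _ _ _ _ _ _ (fun j t => g j (tnth t j))) => j _.
by apply: measurableT_comp => //; exact: measurable_tnth.
Qed.

Lemma integral_prod_tnth n (g : 'I_n -> R2 -> R) (a : 'I_n -> R) :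
  (forall j, measurable_fun [set: R2] (g j)) -> (forall j x, 0 <= g j x) ->
  (forall j, (\int[leb_R2 (R := R)]_x (g j x)%:E = (a j)%:E)%E) ->
  (\int[leb_Cn R n]_t (\prod_j g j (tnth t j))%:E = (\prod_j a j)%:E)%E.
Proof.
elim: n g a => [|n IH] g a mg g0 ga.
  rewrite integral_dirac//; last by apply/measurable_EFinP; exact: measurable_prod_tnth.
  by rewrite diracT mul1e !big_ord0.
have prod0 t : 0 <= \prod_j g (lift ord0 j) (tnth (t : n.-tuple R2) j).
  by apply: prodr_ge0.
have mp : measurable_fun [set: n.-tuple R2]
    (fun t => \prod_j g (lift ord0 j) (tnth t j)).
  exact: (measurable_prod_tnth (fun j => mg (lift ord0 j))).
rewrite /= /leb_step ge0_integral_pushforward//; first last.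
- by move=> t _; rewrite lee_fin prodr_ge0.
- by apply/measurable_EFinP; exact: measurable_prod_tnth.
- exact: measurable_tuple_cons.
rewrite preimage_setT.
have E (p : R2) (t : n.-tuple R2) :
    \prod_j g j (tnth (tuple_cons (p, t)) j) =
    g ord0 p * \prod_j g (lift ord0 j) (tnth t j).
  by rewrite big_ord_recl; congr (_ * _); apply: eq_bigr => j _; rewrite tnthS.
pose F (x : R2 * n.-tuple R2) := (g ord0 x.1 * \prod_j g (lift ord0 j) (tnth x.2 j))%:E.
rewrite (eq_integral F); last first.
  by move=> [p t] _; rewrite /F /= E.
rewrite fubini_tonelli1//; first last.
- by move=> x; rewrite /F lee_fin mulr_ge0.
- apply/measurable_EFinP; apply: measurable_funM.
    by apply: measurableT_comp => //; exact: measurable_fst.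
  by apply: (measurableT_comp mp); exact: measurable_snd.
rewrite /fubini_F /F /=.
rewrite (eq_integral (fun p => ((\prod_j a (lift ord0 j))%:E * (g ord0 p)%:E)%E)); last first.
  move=> p _; under eq_integral do rewrite EFinM.
  rewrite ge0_integralZl//; first last.
  - by rewrite lee_fin.
  - by move=> t _; rewrite lee_fin.
  - exact/measurable_EFinP.
  rewrite muleC; congr (_ * _)%E.
  exact: (IH (fun j => g (lift ord0 j)) (fun j => a (lift ord0 j))
    (fun j => mg _) (fun j => g0 _) (fun j => ga _)).
rewrite ge0_integralZl//; first last.
- rewrite lee_fin; apply: prodr_ge0 => j _.
  by rewrite -lee_fin -ga; apply: integral_ge0 => x _; rewrite lee_fin.
- by move=> x _; rewrite lee_fin.
- exact/measurable_EFinP.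
by rewrite ga -EFinM big_ord_recl mulrC.
Qed.

Lemma integral_prod_R2 (f g : R -> R) (a b : R) :
  measurable_fun [set: R] f -> measurable_fun [set: R] g ->
  (forall x, 0 <= f x) -> (forall x, 0 <= g x) ->
  (\int[lambda]_x (f x)%:E = a%:E)%E -> (\int[lambda]_x (g x)%:E = b%:E)%E ->
  (\int[leb_R2 (R := R)]_x (f x.1 * g x.2)%:E = (a * b)%:E)%E.
Proof.
move=> mf mg f0 g0 fa gb.
rewrite /leb_R2 fubini_tonelli1//; first last.
- by move=> x; rewrite lee_fin mulr_ge0.
- apply/measurable_EFinP; apply: measurable_funM.
    by apply: (measurableT_comp mf); exact: measurable_fst.
  by apply: (measurableT_comp mg); exact: measurable_snd.
rewrite /fubini_F /=.
rewrite (eq_integral (fun x : measurableTypeR R => (b%:E * (f x)%:E)%E)); last first.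
  move=> x _; under eq_integral do rewrite EFinM.
  rewrite ge0_integralZl//; first last.
  - by rewrite lee_fin.
  - by move=> y _; rewrite lee_fin.
  - exact/measurable_EFinP.
  by rewrite gb muleC.
rewrite ge0_integralZl//; first last.
- by rewrite -gb; apply: integral_ge0 => x _; rewrite lee_fin.
- by move=> x _; rewrite lee_fin.
- exact/measurable_EFinP.
by rewrite fa -EFinM mulrC.
Qed.

Lemma integral_prodR n (b : 'I_n * bool -> R -> R) (a : 'I_n * bool -> R) :
  (forall d, measurable_fun [set: R] (b d)) -> (forall d x, 0 <= b d x) ->
  (forall d, (\int[lambda]_x (b d x)%:E = (a d)%:E)%E) ->
  (\int[leb_Cn R n]_t (prodR b (Cn_of_R2 t))%:E = (\prod_d a d)%:E)%E.
Proof.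
move=> mb b0 ba.
have pE (F : 'I_n * bool -> R) : \prod_d F d = \prod_j (F (j, false) * F (j, true)).
  rewrite (eq_bigr (fun d => F (d.1, d.2))); last by case.
  rewrite -(pair_big xpredT xpredT (fun j c => F (j, c)))/=.
  by apply: eq_bigr => j _; rewrite big_bool mulrC.
pose g j (x : R2) := b (j, false) x.1 * b (j, true) x.2.
rewrite pE (eq_integral (fun t => (\prod_j g j (tnth t j))%:E)); last first.
  move=> t _; congr EFin; rewrite /prodR pE; apply: eq_bigr => j _.
  by rewrite /coordR /g/= !mxE.
apply: (@integral_prod_tnth n g (fun j => a (j, false) * a (j, true))).
- move=> j; apply: measurable_funM.
    by apply: (measurableT_comp (mb _)); exact: measurable_fst.
  by apply: (measurableT_comp (mb _)); exact: measurable_snd.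
- by move=> j x; rewrite mulr_ge0.
- by move=> j; apply: integral_prod_R2.
Qed.

End product_integrals.

Section bump_integrals.
Context {R : realType}.
Local Notation lambda := (@lebesgue_measure R).

Lemma measurable_smooth_bump : measurable_fun [set: R] (@smooth_bump R).
Proof. by apply: continuous_measurable_fun; exact: (smooth1_continuous (smooth1_bump 0)). Qed.

Lemma integral_indic_itv (a b k : R) : a <= b -> 0 <= k ->
  (\int[lambda]_x (k * \1_(`[a, b]%classic) x)%:E = (k * (b - a))%:E)%E.
Proof.
move=> ab k0; under eq_integral do rewrite EFinM.
rewrite ge0_integralZl//; first last.
  by apply/measurable_EFinP; exact: measurable_indic.
rewrite integral_indic// setIT.
rewrite [X in (_ * X)%E](lebesgue_measure_itv `[a, b])/= lte_fin.
case: ltP => [//|ba]; have -> : b = a by apply/eqP; rewrite eq_le ab ba.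
by rewrite subrr mulr0 mule0.
Qed.

Lemma integral_smooth_bump :
  exists2 beta : R, 0 < beta & (\int[lambda]_x (smooth_bump x)%:E = beta%:E)%E.
Proof.
have [L L0 HL] := @quadratic_bump R.
have bL x : smooth_bump x <= L.
  by have [[h _] _] := HL x Logic.I; apply: le_trans (ler_norm _) h.
have mb := measurable_smooth_bump.
have up : (\int[lambda]_x (smooth_bump x)%:E <= (L * (1 - -1))%:E)%E.
  have h1 : -1 <= 1 :> R by lra.
  rewrite -(integral_indic_itv h1 L0).
  apply: ge0_le_integral => //.
  - by move=> x _; rewrite lee_fin smooth_bump_ge0.
  - exact/measurable_EFinP.
  - by apply/measurable_EFinP; apply: measurable_funM => //; exact: measurable_indic.
  - move=> x _; rewrite lee_fin indicE; case: (boolP (x \in _)) => x1.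
      by rewrite mulr1.
    rewrite mulr0 bump_out// ltW// ltNge; apply: contra x1 => x1.
    by rewrite inE/= in_itv/= -ler_norml.
(* On [-1/2, 1/2] both 1 + x and 1 - x are at least 1/2, where [flat 0] is at least e^-2; this keeps
   the integral away from 0. *)
pose c : R := expR (-2) * expR (-2).
have c0 : 0 < c by rewrite mulr_gt0 ?expR_gt0.
have fl (x : R) : 2^-1 <= x -> expR (-2) <= flat 0 x.
  move=> x2; have x0 : 0 < x by lra.
  rewrite /flat x0 expr0 mul1r ler_expR lerN2.
  by rewrite -[leRHS]invrK lef_pV2 ?posrE ?invr_gt0.
have lo : ((c * (2^-1 - - 2^-1))%:E <= \int[lambda]_x (smooth_bump x)%:E)%E.
  have h1 : - 2^-1 <= 2^-1 :> R by lra.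
  rewrite -(integral_indic_itv h1 (ltW c0)).
  apply: ge0_le_integral => //.
  - by move=> x _; rewrite lee_fin mulr_ge0// ltW.
  - by apply/measurable_EFinP; apply: measurable_funM => //; exact: measurable_indic.
  - exact/measurable_EFinP.
  - move=> x _; rewrite lee_fin indicE; case: (boolP (x \in _)) => x1; last first.
      by rewrite mulr0 smooth_bump_ge0.
    move: x1; rewrite inE/= in_itv/= => /andP[x1 x2].
    by rewrite mulr1 /smooth_bump /c; apply: ler_pM; rewrite ?expR_ge0// fl//; lra.
have fin : (\int[lambda]_x (smooth_bump x)%:E)%E \is a fin_num.
  rewrite ge0_fin_numE; first by apply: le_lt_trans up _; rewrite ltry.
  by apply: integral_ge0 => x _; rewrite lee_fin smooth_bump_ge0.
exists (fine (\int[lambda]_x (smooth_bump x)%:E)); last by rewrite fineK.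
rewrite -lte_fin fineK//; apply: lt_le_trans lo.
by rewrite lte_fin mulr_gt0//; lra.
Qed.

Lemma integral_smooth_bump_affine (beta e k : R) : 0 < e ->
  (\int[lambda]_x (smooth_bump x)%:E = beta%:E)%E ->
  (\int[lambda]_x (smooth_bump (e^-1 * x + k))%:E = (e * beta)%:E)%E.
Proof.
move=> e0 bE; have eV0 : 0 < e^-1 by rewrite invr_gt0.
pose F (x : R) := e^-1 * x + k.
have dF x : is_derive x (1 : R) F e^-1.
  have := is_deriveD (is_deriveZ e^-1 (is_derive_id x (1 : R)))
    (is_derive_cst k x (1 : R)).
  rewrite addr0 [e^-1 *: 1]mulr1; exact.
have F' : derive1 F = cst e^-1.
  by apply/funext => x; rewrite derive1E; have [_ ->] := dF x.
have mb : measurable_fun [set: R] (smooth_bump \o F).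
  apply: measurableT_comp; first exact: measurable_smooth_bump.
  apply: continuous_measurable_fun => x.
  by apply/differentiable_continuous/derivable1_diffP; have [] := dF x.
have := @increasing_ge0_integration_by_substitutionT R F (@smooth_bump R).
rewrite F' bE => H.
have {}H : (beta%:E = \int[lambda]_x (e^-1%:E * (smooth_bump (F x))%:E))%E.
  rewrite H; first by apply: eq_integral => x _; rewrite -EFinM mulrC.
  - by move=> x y xy; rewrite /F ltrD2r ltr_pM2l.
  - exact: cst_continuous.
  - exact: is_cvg_cst.
  - exact: is_cvg_cst.
  - by move=> x; have [] := dF x.
  - apply/cvgrNyPle => A; near=> x.
    rewrite /F -lerBrDr ler_pdivrMl//; near: x; exact: nbhs_ninfty_le.
  - apply/cvgryPge => A; near=> x.
    rewrite /F -lerBlDr ler_pdivlMl//; near: x; exact: nbhs_pinfty_ge.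
  - exact: (smooth1_continuous (smooth1_bump 0)).
  - exact: smooth_bump_ge0.
move: H; rewrite ge0_integralZl//; first last.
- by rewrite lee_fin ltW.
- by move=> x _; rewrite lee_fin smooth_bump_ge0.
- exact/measurable_EFinP.
move=> H; rewrite EFinM H muleA -EFinM mulfV ?gt_eqF// mul1e.
by [].
Unshelve. all: by end_near. Qed.

Context {n : nat}.
Local Notation C := R[i].
Local Notation Cn := 'rV[C]_n.

Lemma continuous_mol e (z : Cn) : continuous (mol e z).
Proof. by apply: continuous_prodR => d; exact: (smooth1_continuous (@smooth1_molb R n 0 _ _ _)). Qed.

Lemma continuous_dmol e d (z : Cn) : continuous (dmol e d z).
Proof.
apply: continuous_prodR => d'; rewrite /upd; case: eqP => _.
  have s1 := @smooth1_molb R n 1 e z d; exact: (smooth1_continuous (k := 0) s1.2).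
exact: (smooth1_continuous (@smooth1_molb R n 0 _ _ _)).
Qed.

Lemma mol_ge0 e (z w : Cn) : 0 <= mol e z w.
Proof. by apply: prodr_ge0 => d _; exact: smooth_bump_ge0. Qed.

(** The integral is a product of 2n translation invariant one-dimensional ones, so a single Z
    normalizes the kernels at all centres. *)
Lemma integral_mol e : 0 < e -> exists2 Z : R, 0 < Z &
  forall z : Cn, (\int[leb_Cn R n]_t (mol e z (Cn_of_R2 t))%:E = Z%:E)%E.
Proof.
move=> e0; have [beta beta0 bE] := integral_smooth_bump.
exists (\prod_(d : 'I_n * bool) (e * beta)).
  by apply: prodr_gt0 => d _; exact: mulr_gt0.
move=> z; apply: (integral_prodR (a := fun=> e * beta)).
- move=> d; apply: continuous_measurable_fun.
  exact: (smooth1_continuous (@smooth1_molb R n 0 _ _ _)).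
- by move=> d x; exact: smooth_bump_ge0.
- by move=> d; exact: integral_smooth_bump_affine.
Qed.

Definition box_indic (r : R) (w : Cn) : R :=
  prodR (fun _ => \1_(`[- r, r]%classic)) w.

Lemma box_indic_ge0 r w : 0 <= box_indic r w.
Proof. exact: prodr_ge0. Qed.

Lemma box_indic1 r w : box 0 r w -> box_indic r w = 1.
Proof.
move=> bw; rewrite /box_indic /prodR big1// => d _; rewrite indicE mem_set//=.
by rewrite in_itv/= -ler_norml; have := bw d; rewrite subr0.
Qed.

Lemma measurable_box_indic r :
  measurable_fun [set: n.-tuple (measurableTypeR R * measurableTypeR R)]
    (fun t => box_indic r (Cn_of_R2 t)).
Proof.
apply: (@measurable_prod _ _ _ _ _ _ (fun d t => \1_(`[- r, r]%classic) (coordR d (Cn_of_R2 t)))) => d _.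
have m1 : measurable_fun [set: R] (\1_(`[- r, r]%classic) : R -> R) by exact: measurable_indic.
have m2 := continuous_measurable_Cn (@continuous_coordR R n d).
exact: (measurableT_comp m1 m2).
Qed.

Lemma integral_box_indic r : 0 <= r -> exists2 v : R, 0 <= v &
  (\int[leb_Cn R n]_t (box_indic r (Cn_of_R2 t))%:E = v%:E)%E.
Proof.
move=> r0; exists (\prod_(d : 'I_n * bool) (1 * (r - - r))).
  by apply: prodr_ge0 => d _; lra.
apply: (integral_prodR (a := fun=> 1 * (r - - r))).
- by move=> d; exact: measurable_indic.
- by [].
- move=> d; have h1 : - r <= r by lra.
  rewrite -(integral_indic_itv h1 ler01).
  by apply: eq_integral => x _; rewrite mul1r.
Qed.

End bump_integrals.

Section ae_integral.
Context d (T : measurableType d) (R : realType) (mu : {measure set T -> \bar R}).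

Import HBNNSimple.

(* No measurability is required here: the library integral of a nonnegative
   function is the supremum over the simple functions below it, and cutting
   these off on a null set does not change their integral. *)
Lemma ge0_ae_eq_integral_nonmeasurable (f g : T -> \bar R) :
  (forall x, (0 <= f x)%E) -> (forall x, (0 <= g x)%E) ->
  (\forall x \ae mu, f x = g x) -> (\int[mu]_x f x = \int[mu]_x g x)%E.
Proof.
move=> f0 g0 fg.
suff H (f1 g1 : T -> \bar R) : (forall x, (0 <= f1 x)%E) -> (forall x, (0 <= g1 x)%E) ->
    (\forall x \ae mu, f1 x = g1 x) -> (\int[mu]_x f1 x <= \int[mu]_x g1 x)%E.
  apply/eqP; rewrite eq_le !H//.
  by apply: filterS fg => x ->.
move=> {}f0 {}g0 [N [mN N0 fgN]].
rewrite !ge0_integralTE//; apply: ub_ereal_sup => _ [h hf <-].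
have mNc : measurable (~` N) by exact: measurableC.
pose k : {nnsfun T >-> R} := proj_nnsfun h mNc.
have -> : sintegral mu h = sintegral mu k.
  rewrite -!integralT_nnsfun; apply: ge0_ae_eq_integral => //.
  - by apply/measurable_EFinP; exact: measurable_funP.
  - by apply/measurable_EFinP; exact: measurable_funP.
  - by move=> x _; rewrite lee_fin.
  - by move=> x _; rewrite lee_fin.
  exists N; split => // x; apply: contraPP => xN; apply/not_implyP => -[_].
  by apply; rewrite /k/= /proj_nnsfun/= mindicE mem_set// mulr1.
apply: ereal_sup_ubound; exists k => // x /=.
rewrite mindicE; case: (boolP (x \in ~` N)) => [xN|_]; last by rewrite mulr0.
rewrite mulr1; apply: le_trans (hf x) _.
have -> : f1 x = g1 x by apply: contrapT => /fgN; rewrite inE in xN.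
exact: lexx.
Qed.

Lemma ae_eq_integral_nonmeasurable (f g : T -> \bar R) :
  (\forall x \ae mu, f x = g x) -> (\int[mu]_x f x = \int[mu]_x g x)%E.
Proof.
move=> fg; rewrite integralE [RHS]integralE; congr (_ - _)%E;
  apply: ge0_ae_eq_integral_nonmeasurable => //; apply: filterS fg => x;
  by rewrite ?funeposE ?funenegE => ->.
Qed.

End ae_integral.

Section complex_integral.
Context {R : realType} {n : nat}.
Local Notation C := R[i].
Local Notation Cn := 'rV[C]_n.
Local Notation mu := (leb_Cn R n).
Implicit Types (f g : Cn -> C) (h : Cn -> R).

(** Used to exchange the merely Lebesgue measurable V for a Borel representative. *)
Lemma Cintegral_ae f g : ae_Cn (fun z => f z = g z) -> Cintegral f = Cintegral g.
Proof.
move=> fg; rewrite /Cintegral /Rintegral; congr (fine _ +i* fine _);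
  apply: ae_eq_integral_nonmeasurable; have [N [mN N0 fgN]] := fg;
  exists N; split => // t /= ft; apply: fgN => /= e; by apply: ft; rewrite e.
Qed.

Lemma borel_CnM f g : borel_Cn f -> borel_Cn g -> borel_Cn (fun z => f z * g z).
Proof.
move=> [f1 f2] [g1 g2].
have E1 z : Re (f z * g z) = Re (f z) * Re (g z) - Im (f z) * Im (g z).
  by case: (f z); case: (g z).
have E2 z : Im (f z * g z) = Re (f z) * Im (g z) + Im (f z) * Re (g z).
  by case: (f z); case: (g z).
split.
- under eq_fun do rewrite E1.
  by apply: measurable_funB; exact: measurable_funM.
- under eq_fun do rewrite E2.
  by apply: measurable_funD; exact: measurable_funM.
Qed.

Lemma borel_CnD f g : borel_Cn f -> borel_Cn g -> borel_Cn (fun z => f z + g z).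
Proof.
move=> [f1 f2] [g1 g2]; split.
- by under eq_fun do rewrite raddfD; exact: measurable_funD.
- by under eq_fun do rewrite raddfD; exact: measurable_funD.
Qed.

Lemma borel_Cn_cst (c : C) : borel_Cn (fun _ : Cn => c).
Proof. by split; exact: measurable_cst. Qed.

Lemma borel_Cn_sum (I : Type) (s : seq I) (f : I -> Cn -> C) :
  (forall i, borel_Cn (f i)) -> borel_Cn (fun z => \sum_(i <- s) f i z).
Proof.
move=> bf; elim: s => [|i s IH].
  by rewrite (_ : (fun z => _) = fun=> 0); [exact: borel_Cn_cst|
    apply/funext => z; rewrite big_nil].
rewrite (_ : (fun z => _) = fun z => f i z + \sum_(j <- s) f j z); last first.
  by apply/funext => z; rewrite big_cons.
exact: borel_CnD.
Qed.

Lemma borel_Cn_real h : continuous h -> borel_Cn (fun z => (h z)%:C).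
Proof.
by move=> ch; split; [exact: continuous_measurable_Cn|exact: measurable_cst].
Qed.

Lemma borel_Cn_continuous f : continuous f -> borel_Cn f.
Proof.
move=> /continuous_CnP cf; split.
- apply: (continuous_measurable_Cn (f := fun z => Re (f z))).
  apply/continuous_CnRP => z e e0; have [d d0 dP] := cf z e e0.
  by exists d => // w /dP; apply: le_lt_trans; rewrite -raddfB norm_Re_le.
- apply: (continuous_measurable_Cn (f := fun z => Im (f z))).
  apply/continuous_CnRP => z e e0; have [d d0 dP] := cf z e e0.
  by exists d => // w /dP; apply: le_lt_trans; rewrite -raddfB norm_Im_le.
Qed.

Definition Cintegrable f :=
  mu.-integrable setT (fun t => (Re (f (Cn_of_R2 t)))%:E) /\
  mu.-integrable setT (fun t => (Im (f (Cn_of_R2 t)))%:E).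

(** The factor 2 comes from estimating real and imaginary parts separately; it is one of the two
    factors 2 in the later bound 4 n |M|. *)
Lemma Cintegrable_dominated f h (H : R) : borel_Cn f ->
  measurable_fun [set: _] (fun t => h (Cn_of_R2 t)) ->
  (\int[mu]_t (h (Cn_of_R2 t))%:E = H%:E)%E ->
  (forall w, cabs (f w) <= h w) ->
  Cintegrable f /\ cabs (Cintegral f) <= 2 * H.
Proof.
move=> [f1 f2] mh hH fh.
have h0 w : 0 <= h w by apply: le_trans (fh w); exact: cabs_ge0.
have inth : mu.-integrable setT (EFin \o (fun t => h (Cn_of_R2 t))).
  apply/integrableP; split; first exact/measurable_EFinP.
  under eq_integral do rewrite gee0_abs ?lee_fin//.
  by rewrite hH ltry.
have aux (g : Cn -> R) : measurable_fun [set: _] (fun t => g (Cn_of_R2 t)) ->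
    (forall w, `|g w| <= cabs (f w)) ->
    mu.-integrable setT (EFin \o (fun t => g (Cn_of_R2 t))) /\
    `|\int[mu]_t g (Cn_of_R2 t)| <= H.
  move=> mg gf.
  have ig : mu.-integrable setT (EFin \o (fun t => g (Cn_of_R2 t))).
    apply: le_integrable inth => //; first exact/measurable_EFinP.
    move=> t _; rewrite !abse_EFin lee_fin (ger0_norm (h0 _)).
    exact: le_trans (gf _) (fh _).
  split => //; apply: le_trans (le_normr_Rintegral _ ig) _ => //.
  have -> : H = \int[mu]_t h (Cn_of_R2 t) by rewrite /Rintegral hH.
  apply: le_Rintegral => //.
    by have := integrable_norm ig.
  by move=> t _; exact: le_trans (gf _) (fh _).
have [i1 n1] := aux _ f1 (fun w => norm_Re_le (f w)).
have [i2 n2] := aux _ f2 (fun w => norm_Im_le (f w)).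
split => //; apply: le_trans (cabs_le_ReIm _) _ => /=; lra.
Qed.

Lemma CintegralD f g : Cintegrable f -> Cintegrable g ->
  Cintegrable (fun z => f z + g z) /\
  Cintegral (fun z => f z + g z) = Cintegral f + Cintegral g.
Proof.
move=> [f1 f2] [g1 g2].
have E1 : (fun t => Re (f (Cn_of_R2 t) + g (Cn_of_R2 t))) =
  (fun t => Re (f (Cn_of_R2 t)) + Re (g (Cn_of_R2 t))).
  by apply/funext => t; rewrite raddfD.
have E2 : (fun t => Im (f (Cn_of_R2 t) + g (Cn_of_R2 t))) =
  (fun t => Im (f (Cn_of_R2 t)) + Im (g (Cn_of_R2 t))).
  by apply/funext => t; rewrite raddfD.
split.
  split.
  - have := integrableD measurableT f1 g1; congr (mu.-integrable _ _).
    by apply/funext => t /=; rewrite raddfD.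
  - have := integrableD measurableT f2 g2; congr (mu.-integrable _ _).
    by apply/funext => t /=; rewrite raddfD.
rewrite /Cintegral E1 E2 !RintegralD//.
Qed.

Lemma CintegralZ c f : Cintegrable f ->
  Cintegrable (fun z => c * f z) /\
  Cintegral (fun z => c * f z) = c * Cintegral f.
Proof.
move=> [f1 f2]; case: c => a b.
have E1 z : Re ((a +i* b) * f z) = a * Re (f z) + (- b) * Im (f z).
  by case: (f z) => x y /=; rewrite mulNr.
have E2 z : Im ((a +i* b) * f z) = a * Im (f z) + b * Re (f z).
  by case: (f z).
have Z (k : R) (g : n.-tuple (measurableTypeR R * measurableTypeR R) -> R) :
    mu.-integrable setT (fun t => (g t)%:E) ->
    mu.-integrable setT (fun t => (k * g t)%:E).
  by move=> ig; have := integrableZl measurableT k ig.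
have D (g1 g2 : n.-tuple (measurableTypeR R * measurableTypeR R) -> R) :
    mu.-integrable setT (fun t => (g1 t)%:E) ->
    mu.-integrable setT (fun t => (g2 t)%:E) ->
    mu.-integrable setT (fun t => (g1 t + g2 t)%:E).
  by move=> i1 i2; have := integrableD measurableT i1 i2.
split.
  split.
  - under eq_fun do rewrite E1; exact: D (Z _ _ f1) (Z _ _ f2).
  - under eq_fun do rewrite E2; exact: D (Z _ _ f2) (Z _ _ f1).
rewrite /Cintegral; apply/eqP; rewrite eq_complex/=; apply/andP; split; apply/eqP.
- under eq_Rintegral do rewrite E1.
  by rewrite RintegralD ?RintegralZl//; [rewrite mulNr|exact: Z|exact: Z].
- under eq_Rintegral do rewrite E2.
  by rewrite RintegralD ?RintegralZl//; [exact: Z|exact: Z].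
Qed.

Lemma CintegralB f g : Cintegrable f -> Cintegrable g ->
  Cintegrable (fun z => f z - g z) /\
  Cintegral (fun z => f z - g z) = Cintegral f - Cintegral g.
Proof.
move=> intf intg; have [ig eg] := CintegralZ (-1) intg.
have [ifg e] := CintegralD intf ig.
have E : (fun z => f z + -1 * g z) = (fun z => f z - g z).
  by apply/funext => z; rewrite mulN1r.
by rewrite E in ifg e; split => //; rewrite e eg mulN1r.
Qed.

Lemma Cintegral_sum (I : Type) (s : seq I) (f : I -> Cn -> C) :
  (forall i, Cintegrable (f i)) ->
  Cintegrable (fun z => \sum_(i <- s) f i z) /\
  Cintegral (fun z => \sum_(i <- s) f i z) = \sum_(i <- s) Cintegral (f i).
Proof.
move=> Hf; elim: s => [|i s [IH1 IH2]].
  rewrite (_ : (fun z => _) = fun=> 0); last by apply/funext => z; rewrite big_nil.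
  split; first by split; exact: integrable0.
  rewrite big_nil /Cintegral/= /Rintegral !integral0; exact: erefl.
rewrite (_ : (fun z => _) = fun z => f i z + \sum_(j <- s) f j z); last first.
  by apply/funext => z; rewrite big_cons.
have [H1 H2] := CintegralD (Hf i) IH1; split => //.
by rewrite H2 IH2 big_cons.
Qed.

End complex_integral.

(** * Restriction of the mollified solution to a line *)

Section mollification.
Context {R : realType} {n : nat}.
Local Notation C := R[i].
Local Notation Cn := 'rV[C]_n.
Local Notation mu := (leb_Cn R n).
Implicit Types (u F G : Cn -> C) (z w v : Cn).

Lemma has_wirtinger_big (I : Type) (s : seq I) (S : C -> Prop) (f p q : I -> C -> C) :
  (forall i, has_wirtinger S (f i) (p i) (q i)) ->
  has_wirtinger S (fun x => \sum_(i <- s) f i x) (fun x => \sum_(i <- s) p i x)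
    (fun x => \sum_(i <- s) q i x).
Proof.
move=> H; elim: s => [|i s IH].
  by apply: has_wirtinger_ext (has_wirtinger_cst S 0) => z; rewrite big_nil.
by apply: has_wirtinger_ext (has_wirtingerD (H i) IH) => z; rewrite big_cons.
Qed.

Lemma cabs_le_cnorm z j : cabs (z 0 j) <= cnorm z.
Proof.
have s0 : 0 <= \sum_j cabs (z 0 j) ^+ 2 by apply: sumr_ge0 => k _; exact: sqr_ge0.
rewrite -(@ler_pXn2r _ 2) ?nnegrE ?cabs_ge0 ?sqrtr_ge0// /cnorm sqr_sqrtr//.
by rewrite (bigD1 j)//= lerDl; apply: sumr_ge0 => k _; exact: sqr_ge0.
Qed.

(** V is bounded, and equal to Borel functions, only almost everywhere. Clipping the real and
    imaginary parts of these functions to [-|M|, |M|] changes them on a null set only and makes the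
    bound hold everywhere, at the cost of a factor 2. *)
Lemma bounded_Borel_form (V : Cn -> Cn) (M : R) :
  measurable_form V -> Linfty_norm V = M%:E ->
  exists G : 'I_n -> Cn -> C, [/\ forall j, borel_Cn (G j),
    forall j w, cabs (G j w) <= 2 * `|M| &
    forall j, ae_Cn (fun z => V z 0 j = G j z)].
Proof.
move=> mV VM.
pose clip (x : R) := Num.max (- `|M|) (Num.min `|M| x).
have M0 := normr_ge0 M.
have clip_le x : `|clip x| <= `|M|.
  rewrite ler_norml /clip le_max lexx/= ge_max ge_min lexx/= andbT; lra.
have clip_id x : `|x| <= `|M| -> clip x = x.
  by rewrite ler_norml /clip => /andP[? ?]; rewrite min_r// max_r.
have VMae : ae_Cn (fun z => cnorm (V z) <= `|M|).
  have [N [mN N0 sub]] := ess_sup_ge mu (fun t => (cnorm (V (Cn_of_R2 t)))%:E).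
  exists N; split => // t /= H; apply: sub => /= H2; apply: H.
  move: H2; rewrite -/(Linfty_norm V) VM lee_fin => H2.
  exact: le_trans H2 (ler_norm _).
have /choice[g gP] : forall j, exists g : Cn -> C,
    borel_Cn g /\ ae_Cn (fun z => V z 0 j = g z).
  by move=> j; have [g bg ag] := mV j; exists g.
exists (fun j w => clip (Re (g j w)) +i* clip (Im (g j w))); split.
- move=> j; have [[g1 g2] _] := gP j.
  split => /=; apply: measurable_maxr => //; apply: measurable_minr => //.
- move=> j w; apply: le_trans (cabs_le_ReIm _) _ => /=.
  have := clip_le (Re (g j w)); have := clip_le (Im (g j w)); lra.
- move=> j; have [_ [N1 [mN1 N10 sub1]]] := gP j; have [N2 [mN2 N20 sub2]] := VMae.
  exists (N1 `|` N2); split; first exact: measurableU.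
    apply/eqP; rewrite eq_le measure_ge0 andbT.
    have e12 : (mu N1 + mu N2 = 0)%E.
      by transitivity (0 + 0 : \bar R)%E; [exact: (congr2 adde N10 N20)|exact: adde0].
    by rewrite -e12; exact: measureU2.
  move=> t /= H; apply: contrapT => /not_orP[t1 t2].
  have e1 : V (Cn_of_R2 t) 0 j = g j (Cn_of_R2 t) by apply: contrapT => /sub1.
  have e2 : cnorm (V (Cn_of_R2 t)) <= `|M| by apply: contrapT => /sub2.
  apply: H; have := le_trans (cabs_le_cnorm _ j) e2; rewrite e1 => gM.
  rewrite !clip_id; first by case: (g j _).
  + exact: le_trans (norm_Im_le _) gM.
  + exact: le_trans (norm_Re_le _) gM.
Qed.

Section convolution.
Variables (v : Cn) (rho e Z vol : R).
Hypothesis v1 : forall j, cabs (v 0 j) <= 1.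
Hypothesis rho0 : 0 <= rho.
Hypothesis e0 : 0 < e.
Hypothesis Z0 : 0 < Z.
Hypothesis intZ : forall z, (\int[mu]_t (mol e z (Cn_of_R2 t))%:E = Z%:E)%E.
Hypothesis vol0 : 0 <= vol.
Hypothesis intvol : (\int[mu]_t (box_indic (rho + e) (Cn_of_R2 t))%:E = vol%:E)%E.

(** As the bump is even, this is the convolution of F with the normalized kernel, evaluated at the
    point zeta v of the line. *)
Definition mollify F (zeta : C) : C :=
  (Z^-1)%:C * Cintegral (fun w => F w * (mol e (zeta *: v) w)%:C).

Let P (zeta : C) w : C := - \sum_d dcoord v d * (dmol e d (zeta *: v) w)%:C.
Let Q (zeta : C) w : C := - \sum_d dbar_coord v d * (dmol e d (zeta *: v) w)%:C.

Lemma borel_mol z : borel_Cn (fun w => (mol e z w)%:C).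
Proof. by apply: borel_Cn_real; exact: continuous_mol. Qed.

Let borel_dsum (k : 'I_n * bool -> C) zeta :
  borel_Cn (fun w => - \sum_d k d * (dmol e d (zeta *: v) w)%:C).
Proof.
rewrite (_ : (fun w => _) = fun w => -1 * \sum_d k d * (dmol e d (zeta *: v) w)%:C).
  apply: borel_CnM; first exact: borel_Cn_cst.
  apply: borel_Cn_sum => d; apply: borel_CnM; first exact: borel_Cn_cst.
  by apply: borel_Cn_real; exact: continuous_dmol.
by apply/funext => w; rewrite mulN1r.
Qed.

Lemma Cintegral_box F B (k : Cn -> C) c : borel_Cn F -> 0 <= B -> 0 <= c ->
  (forall w, box 0 (rho + e) w -> cabs (F w) <= B) -> borel_Cn k ->
  (forall w, cabs (k w) <= c) -> (forall w, ~ box 0 (rho + e) w -> k w = 0) ->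
  Cintegrable (fun w => F w * k w) /\
  cabs (Cintegral (fun w => F w * k w)) <= 2 * (B * c * vol).
Proof.
move=> bF B0 c0 FB bk kc k0.
apply: (Cintegrable_dominated (h := fun w => B * c * box_indic (rho + e) w)).
- exact: borel_CnM.
- by apply: measurable_funM => //; exact: measurable_box_indic.
- under eq_integral do rewrite EFinM.
  rewrite ge0_integralZl//.
  + by rewrite intvol.
  + by apply/measurable_EFinP; exact: measurable_box_indic.
  + by move=> t _; rewrite lee_fin box_indic_ge0.
  + by rewrite lee_fin mulr_ge0.
- move=> w; have [bw|bw] := pselect (box 0 (rho + e) w).
    by rewrite box_indic1// mulr1; apply: cabsM_le => //; exact: FB.
  by rewrite k0// mulr0 cabs0 !mulr_ge0// box_indic_ge0.
Qed.

(** [Cintegral_box] has a constant depending on the volume of a box; here the mass Z of the kernel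
    appears instead, so that after division by Z the bound does not depend on e. *)
Lemma Cintegral_mol F B z : borel_Cn F -> 0 <= B ->
  (forall w, mol e z w != 0 -> cabs (F w) <= B) ->
  Cintegrable (fun w => F w * (mol e z w)%:C) /\
  cabs (Cintegral (fun w => F w * (mol e z w)%:C)) <= 2 * (B * Z).
Proof.
move=> bF B0 FB.
apply: (Cintegrable_dominated (h := fun w => B * mol e z w)).
- by apply: borel_CnM => //; exact: borel_mol.
- by apply: measurable_funM => //; exact: continuous_measurable_Cn (@continuous_mol _ _ _ _).
- under eq_integral do rewrite EFinM.
  rewrite ge0_integralZl//.
  + by rewrite intZ.
  + by apply/measurable_EFinP; exact: continuous_measurable_Cn (@continuous_mol _ _ _ _).
  + by move=> t _; rewrite lee_fin mol_ge0.
- move=> w; have [->|m0] := eqVneq (mol e z w) 0; first by rewrite !mulr0 cabs0.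
  apply: cabsM_le; first exact: FB.
  by rewrite cabs_real ger0_norm// mol_ge0.
Qed.

(** Differentiation under the integral sign without a limit theorem: the inequalities defining
    [wirtinger] hold for the kernel uniformly in w and are integrated against F. The kernel and its
    derivatives vanish outside the box, so F is only bounded there. *)
Lemma mollify_wirtinger F B : borel_Cn F -> 0 <= B ->
  (forall w, box 0 (rho + e) w -> cabs (F w) <= B) ->
  has_wirtinger (disc rho) (mollify F)
    (fun zeta => (Z^-1)%:C * Cintegral (fun w => F w * P zeta w))
    (fun zeta => (Z^-1)%:C * Cintegral (fun w => F w * Q zeta w)).
Proof.
move=> bF B0 FB; have [K K0 HK] := mol_wirtinger e0 v1 rho0.
pose m (zeta : C) w : C := (mol e (zeta *: v) w)%:C.
have bm zeta : borel_Cn (m zeta) by exact: borel_mol.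
have bP zeta : borel_Cn (P zeta) by exact: borel_dsum.
have bQ zeta : borel_Cn (Q zeta) by exact: borel_dsum.
have out zeta w : disc rho zeta -> ~ box 0 (rho + e) w ->
    [/\ m zeta w = 0, P zeta w = 0 & Q zeta w = 0].
  move=> zD wB; have [m0 dm0] := mol_out e0 v1 zD wB.
  by rewrite /m m0 /P /Q !big1 ?oppr0// => d _; rewrite dm0 mulr0.
apply: has_wirtingerZ; exists (2 * (B * K * vol)); first by rewrite !mulr_ge0.
have key k c : 0 <= c -> borel_Cn k -> (forall w, cabs (k w) <= c) ->
   (forall w, ~ box 0 (rho + e) w -> k w = 0) ->
  Cintegrable (fun w => F w * k w) /\
  cabs (Cintegral (fun w => F w * k w)) <= 2 * (B * c * vol).
  by move=> c0 bk kc k0; apply: Cintegral_box.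
have borelB (k l : Cn -> C) : borel_Cn k -> borel_Cn l -> borel_Cn (fun w => k w - l w).
  move=> bk bl; rewrite (_ : (fun w => _) = fun w => k w + -1 * l w).
    by apply: borel_CnD => //; apply: borel_CnM => //; exact: borel_Cn_cst.
  by apply/funext => w; rewrite mulN1r.
have KE (c : R) : 2 * (B * (K * c) * vol) = 2 * (B * K * vol) * c by ring.
move=> zeta zD.
have h1 w := (HK w zeta zD).1; have h2 w h := (HK w zeta zD).2 h.
have [im nm] : _ /\ _ := key (m zeta) K K0 (bm _)
  (fun w => let: And3 x _ _ := h1 w in x) (fun w wB => let: And3 x _ _ := out _ w zD wB in x).
have [iP nP] : _ /\ _ := key (P zeta) K K0 (bP _)
  (fun w => let: And3 _ x _ := h1 w in x) (fun w wB => let: And3 _ x _ := out _ w zD wB in x).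
have [iQ nQ] : _ /\ _ := key (Q zeta) K K0 (bQ _)
  (fun w => let: And3 _ _ x := h1 w in x) (fun w wB => let: And3 _ _ x := out _ w zD wB in x).
split => // h hD.
have Kh : 0 <= K * cabs h by rewrite mulr_ge0// cabs_ge0.
have Kh2 : 0 <= K * cabs h ^+ 2 by rewrite mulr_ge0// exprn_ge0// cabs_ge0.
have [im' _] : _ /\ _ := key (m (zeta + h)) K K0 (bm _)
  (fun w => let: And3 x _ _ := (HK w _ hD).1 in x)
  (fun w wB => let: And3 x _ _ := out _ w hD wB in x).
have [iP' _] : _ /\ _ := key (P (zeta + h)) K K0 (bP _)
  (fun w => let: And3 _ x _ := (HK w _ hD).1 in x)
  (fun w wB => let: And3 _ x _ := out _ w hD wB in x).
have [iQ' _] : _ /\ _ := key (Q (zeta + h)) K K0 (bQ _)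
  (fun w => let: And3 _ _ x := (HK w _ hD).1 in x)
  (fun w wB => let: And3 _ _ x := out _ w hD wB in x).
have diff (k l : Cn -> C) : Cintegrable (fun w => F w * k w) -> Cintegrable (fun w => F w * l w) ->
    borel_Cn k -> borel_Cn l ->
    (forall w, cabs (k w - l w) <= K * cabs h) ->
    (forall w, ~ box 0 (rho + e) w -> k w - l w = 0) ->
    cabs (Cintegral (fun w => F w * k w) - Cintegral (fun w => F w * l w)) <=
    2 * (B * K * vol) * cabs h.
  move=> ik il bk bl kl kl0; have [_ <-] := CintegralB ik il.
  rewrite (_ : (fun w => _) = fun w => F w * (k w - l w)); last first.
    by apply/funext => w; rewrite mulrBr.
  by rewrite -KE; apply: (key _ _ Kh (borelB _ _ bk bl) kl kl0).2.
have d1 w : cabs (m (zeta + h) w - m zeta w) <= K * cabs h by have [] := h2 w h hD.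
have d2 w : cabs (P (zeta + h) w - P zeta w) <= K * cabs h by have [] := h2 w h hD.
have d3 w : cabs (Q (zeta + h) w - Q zeta w) <= K * cabs h by have [] := h2 w h hD.
have z1 w : ~ box 0 (rho + e) w -> m (zeta + h) w - m zeta w = 0.
  by move=> wB; have [-> _ _] := out _ w zD wB; have [-> _ _] := out _ w hD wB; rewrite subrr.
have z2 w : ~ box 0 (rho + e) w -> P (zeta + h) w - P zeta w = 0.
  by move=> wB; have [_ -> _] := out _ w zD wB; have [_ -> _] := out _ w hD wB; rewrite subrr.
have z3 w : ~ box 0 (rho + e) w -> Q (zeta + h) w - Q zeta w = 0.
  by move=> wB; have [_ _ ->] := out _ w zD wB; have [_ _ ->] := out _ w hD wB; rewrite subrr.
split.
- exact: (diff (m (zeta + h)) (m zeta) im' im (bm _) (bm _) d1 z1).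
- exact: (diff (P (zeta + h)) (P zeta) iP' iP (bP _) (bP _) d2 z2).
- exact: (diff (Q (zeta + h)) (Q zeta) iQ' iQ (bQ _) (bQ _) d3 z3).
have [i1 e1] := CintegralB im' im.
have [i2 e2] := CintegralZ h iP; have [i3 e3] := CintegralZ (h^*) iQ.
have [i4 e4] := CintegralB i1 i2; have [i5 e5] := CintegralB i4 i3.
rewrite [X in _ - X - _]mulrC [X in _ - X]mulrC -e1 -e2 -e4 -e3 -e5.
rewrite (_ : (fun w => _) = fun w => F w * (m (zeta + h) w - m zeta w - P zeta w * h - Q zeta w * h^*)).
  rewrite -KE; apply: (key _ _ Kh2 _ _ _).2.
  - have bc (c : C) := @borel_Cn_cst R n c.
    exact: (borelB _ _ (borelB _ _ (borelB _ _ (bm _) (bm _))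
      (borel_CnM (bP _) (bc h))) (borel_CnM (bQ _) (bc h^*))).
  - by move=> w; have [] := h2 w h hD.
  - move=> w wB; have [-> -> ->] := out _ w zD wB; have [-> _ _] := out _ w hD wB.
    by rewrite !mul0r !subrr.
apply/funext => w.
by move: (F w) (m (zeta + h) w) (m zeta w) (P zeta w) (Q zeta w) => x1 x2 x3 x4 x5; ring.
Qed.

End convolution.

End mollification.

Section restriction_to_line.
Context {R : realType} {n : nat}.
Local Notation C := R[i].
Local Notation Cn := 'rV[C]_n.
Local Notation mu := (leb_Cn R n).

Lemma test_function_mol (e : R) (z : Cn) : 0 < e -> test_function (fun w => (mol e z w)%:C).
Proof.
move=> e0; apply: (@test_function_prodR _ _ _ z e).
  by move=> k d; exact: smooth1_molb.
by move=> d x /ltW; exact: molb_out.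
Qed.

Lemma mol_neq0 (e : R) (z w : Cn) : 0 < e -> mol e z w != 0 ->
  forall j, cabs (z 0 j - w 0 j) <= 2 * e.
Proof.
move=> e0 m0 j.
have H d : `|coordR d w - coordR d z| <= e.
  rewrite leNgt; apply: contra m0 => /ltW H.
  by rewrite /mol /prodR (bigD1 d)//= molb_out// mul0r.
apply: le_trans (cabs_le_ReIm _) _.
have -> : Re (z 0 j - w 0 j) = coordR (j, false) z - coordR (j, false) w by rewrite raddfB.
have -> : Im (z 0 j - w 0 j) = coordR (j, true) z - coordR (j, true) w by rewrite raddfB.
rewrite (distrC (coordR _ z)) (distrC (coordR (j, true) z)).
by have := H (j, false); have := H (j, true); lra.
Qed.

(** U is the mollification of u, and a is the sum of conj(v_j) times the mollifications of G_j. The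
    equation tested against the mollifier gives dbar U as the sum of conj(v_j) times the
    mollifications of G_j u; the error thus comes from mollifying G_j (u - U(zeta)), which is small
    by the uniform continuity of u. *)
Lemma mollified_line (u : Cn -> C) (V : Cn -> Cn) (v : Cn) (M rho d : R) :
  continuous u -> measurable_form V -> Linfty_norm V = M%:E -> dbar_eq u V ->
  (forall j, cabs (v 0 j) <= 1) -> 0 <= rho -> 0 < d ->
  exists U pU qU a pa qa,
    [/\ has_wirtinger (disc rho) U pU qU, has_wirtinger (disc rho) a pa qa &
      [/\ forall zeta, disc rho zeta -> cabs (a zeta) <= 4 * n%:R * `|M|,
          forall zeta, disc rho zeta -> cabs (qU zeta - a zeta * U zeta) <= d &
          forall zeta, disc rho zeta -> cabs (U zeta - u (zeta *: v)) <= d]].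
Proof.
move=> cu mV VM uV v1 rho0 d0.
have [G [bG GM VG]] := bounded_Borel_form mV VM.
pose m := 2 * `|M|.
have m0 : 0 <= m by rewrite mulr_ge0.
(* 2 d1 will bound |U - u|, and 6 n m d1 will bound |dbar U - a U|; d is their sum. *)
pose d1 := d / (2 + 6 * n%:R * m).
have nm0 : 0 <= n%:R * m by rewrite mulr_ge0.
have den0 : 0 < 2 + 6 * n%:R * m by rewrite -mulrA; lra.
have d10 : 0 < d1 by rewrite divr_gt0.
have d1E : d1 * (2 + 6 * n%:R * m) = d by rewrite /d1 divfK// gt_eqF.
have nmd : 0 <= n%:R * m * d1 by rewrite mulr_ge0// ltW.
have [eta eta0 ucu] := box_unif_continuous 0 rho cu d10.
(* On the support of the kernel real and imaginary parts differ by at most e, so complex coordinates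
   differ by at most 2e = eta. *)
pose e := eta / 2.
have e0 : 0 < e by rewrite divr_gt0.
have [Z Z0 intZ] := @integral_mol R n e e0.
have re0 : 0 <= rho + e by rewrite addr_ge0// ltW.
have [vol vol0 intvol] := @integral_box_indic R n _ re0.
have [B B0 uB] := box_bounded 0 (rho + e) cu.
have bu := borel_Cn_continuous cu.
have ZV0 : 0 <= Z^-1 by rewrite invr_ge0 ltW.
have zbox zeta : disc rho zeta -> box 0 rho (zeta *: v).
  by move=> zD j; rewrite subr0; exact: coordR_scale_le.
have umol zeta w : disc rho zeta -> mol e (zeta *: v) w != 0 ->
    cabs (u (zeta *: v) - u w) <= d1.
  move=> zD mw; apply: ucu; first exact: zbox.
  by move=> j; have := mol_neq0 e0 mw j; rewrite /e mulrC divfK.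
pose U := mollify v e Z u.
have HU := mollify_wirtinger Z v1 rho0 e0 vol0 intvol bu B0 uB.
have HG j := mollify_wirtinger Z v1 rho0 e0 vol0 intvol (bG j) m0 (fun w _ => GM j w).
have Ha := has_wirtinger_big (index_enum 'I_n)
  (fun j => has_wirtingerZ (v 0 j)^* (HG j)).
have intm zeta F K : borel_Cn F -> 0 <= K ->
    (forall w, mol e (zeta *: v) w != 0 -> cabs (F w) <= K) ->
    Cintegrable (fun w => F w * (mol e (zeta *: v) w)%:C) /\
    cabs (Cintegral (fun w => F w * (mol e (zeta *: v) w)%:C)) <= 2 * (K * Z).
  by move=> bF K0 FK; exact: (Cintegral_mol intZ bF K0 FK).
have int1 zeta : Cintegral (fun w => 1 * (mol e (zeta *: v) w)%:C) = Z%:C.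
  rewrite /Cintegral; apply/eqP; rewrite eq_complex/=; apply/andP; split; apply/eqP.
    under eq_Rintegral do rewrite !mul1r !mul0r subr0.
    by rewrite /Rintegral intZ.
  under eq_Rintegral do rewrite !mul1r !mul0r addr0.
  by rewrite /Rintegral integral0.
have b1 : borel_Cn (fun _ : Cn => 1 : C) by exact: borel_Cn_cst.
have ulocal zeta w : disc rho zeta -> mol e (zeta *: v) w != 0 -> cabs (u w) <= B.
  move=> zD mw; apply: uB => dd; rewrite subr0.
  rewrite leNgt; apply: contra mw => H.
  have wB : ~ box 0 (rho + e) w by move=> /(_ dd); rewrite subr0 leNgt H.
  by have [-> _] := mol_out e0 v1 zD wB.
have Uu zeta : disc rho zeta -> cabs (U zeta - u (zeta *: v)) <= 2 * d1.
  move=> zD.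
  have [iu _] := intm zeta u B bu B0 (fun w => ulocal zeta w zD).
  have [i1 _] := intm zeta (fun=> 1) 1 b1 ler01 (fun w _ => ltac:(rewrite cabs1; exact: lexx)).
  have [ic ec] := CintegralZ (u (zeta *: v)) i1.
  have [_ ed] := CintegralB iu ic.
  have -> : U zeta - u (zeta *: v) =
     (Z^-1)%:C * Cintegral (fun w => (u w - u (zeta *: v)) * (mol e (zeta *: v) w)%:C).
    rewrite (_ : (fun w => _) = (fun w => u w * (mol e (zeta *: v) w)%:C -
      u (zeta *: v) * (1 * (mol e (zeta *: v) w)%:C))); last first.
      by apply/funext => w; ring.
    rewrite ed ec int1 mulrBr; congr (_ - _).
    by rewrite mulrCA -rmorphM/= mulVf ?gt_eqF// mulr1.
  have bd : borel_Cn (fun w => u w - u (zeta *: v)).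
    by apply: borel_CnD => //; exact: borel_Cn_cst.
  have [_ H] := intm zeta _ d1 bd (ltW d10) (fun w mw => ltac:(rewrite cabsBC; exact: umol zD mw)).
  have -> : 2 * d1 = Z^-1 * (2 * (d1 * Z)) by field; rewrite gt_eqF.
  by apply: cabsM_le => //; rewrite cabs_real ger0_norm.
exists U; do 5 eexists; split; [exact: HU|exact: Ha|split].
- move=> zeta zD; cbv beta; apply: le_trans (cabs_sum _ _ _) _.
  have -> : 4 * n%:R * `|M| = \sum_(j < n) 2 * m.
    by rewrite sumr_const card_ord -[RHS]mulr_natr /m; ring.
  apply: ler_sum => j _; rewrite -[2 * m]mul1r.
  apply: cabsM_le; first by rewrite cabsJ.
  have -> : 2 * m = Z^-1 * (2 * (m * Z)) by field; rewrite gt_eqF.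
  apply: cabsM_le; first by rewrite cabs_real ger0_norm.
  exact: (intm zeta _ m (bG j) m0 (fun w _ => GM j w)).2.
- move=> zeta zD; cbv beta.
  pose phi w : C := (mol e (zeta *: v) w)%:C.
  have bphi : borel_Cn phi by exact: borel_mol.
  pose J d := Cintegral (fun w => u w * (dmol e d (zeta *: v) w)%:C).
  have intd dd : Cintegrable (fun w => u w * (dmol e dd (zeta *: v) w)%:C).
    have cd : continuous (fun w => (dmol e dd (zeta *: v) w)%:C).
      apply/continuous_CnP => z k k0.
      have [r r0 rP] := (continuous_CnRP _).1 (@continuous_dmol R n e dd (zeta *: v)) z k k0.
      by exists r => // w /rP; rewrite -rmorphB cabs_real.
    have [K K0 KP] := box_bounded 0 (rho + e) cd.
    apply: (Cintegral_box intvol bu B0 K0 uB _ _ _).1.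
    - by apply: borel_Cn_real; exact: continuous_dmol.
    - move=> w; have [wB|wB] := pselect (box 0 (rho + e) w); first exact: KP.
      by have [_ ->] := mol_out e0 v1 zD wB; rewrite cabs_real normr0.
    - by move=> w wB; have [_ ->] := mol_out e0 v1 zD wB.
  have dzJ j : Cintegral (fun w => u w * dzbar j phi w) = 2^-1 * (J (j, false) + 'i * J (j, true)).
    have [i1 e1] := CintegralZ 'i (intd (j, true)).
    have [i2 e2] := CintegralD (intd (j, false)) i1.
    have [_ e3] := CintegralZ 2^-1 i2.
    rewrite /J -e1 -e2 -e3; congr Cintegral; apply/funext => w.
    rewrite (dzbar_prodR j w (fun d => @smooth1_molb R n 1 e (zeta *: v) d)).
    by rewrite mulrCA mulrDr [u w * ('i * _)]mulrCA.
  have VGu j : - (2^-1 * (J (j, false) + 'i * J (j, true))) =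
      Cintegral (fun w => (G j w * u w) * phi w).
    rewrite -dzJ (uV j phi (test_function_mol _ e0)).
    apply: Cintegral_ae; have [N [mN N0 sub]] := VG j.
    exists N; split => // t /= H; apply: sub => /= E; apply: H.
    by rewrite E.
  (* The coefficients [dbar_coord v (j, false)] and [dbar_coord v (j, true)] are conj(v_j) times the
     1/2 and i/2 of the dbar operator in z_j, so the 2n real directions regroup into n tested
     equations. The minus sign of the kernel derivative is the one of the weak equation. *)
  have QJ : Cintegral (fun w => u w * - \sum_d dbar_coord v d * (dmol e d (zeta *: v) w)%:C) =
      \sum_j (v 0 j)^* * Cintegral (fun w => (G j w * u w) * phi w).
    have intZd dd := CintegralZ (- dbar_coord v dd) (intd dd).
    have [_ es] := Cintegral_sum (index_enum _) (fun dd => (intZd dd).1).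
    rewrite (_ : (fun w => _) = (fun w => \sum_dd - dbar_coord v dd *
        (u w * (dmol e dd (zeta *: v) w)%:C))); last first.
      apply/funext => w; rewrite mulrN mulr_sumr -sumrN; apply: eq_bigr => dd _.
      by rewrite mulNr mulrCA.
    rewrite es (eq_bigr (fun dd => - dbar_coord v (dd.1, dd.2) * J (dd.1, dd.2))); last first.
      by move=> [j c] _; rewrite (intZd _).2.
    rewrite -(pair_big xpredT xpredT (fun j c => - dbar_coord v (j, c) * J (j, c)))/=.
    apply: eq_bigr => j _; rewrite big_bool -VGu /dbar_coord/=.
    by move: (J (j, true)) (J (j, false)) ((v 0 j)^*) ('i : C) => x y c k; ring.
  rewrite QJ.
  have wU w : mol e (zeta *: v) w != 0 -> cabs (u w - U zeta) <= 3 * d1.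
    move=> mw; have -> : u w - U zeta = - (u (zeta *: v) - u w) - (U zeta - u (zeta *: v)) by ring.
    have -> : 3 * d1 = d1 + 2 * d1 by ring.
    by apply: cabsB_le; [rewrite cabsN; exact: umol|exact: Uu].
  (* The commutator for one index: 6 m d1 is 2 m times the bound 3 d1 of |u - U(zeta)| on the
     support of the kernel. *)
  have each j : cabs ((v 0 j)^* * ((Z^-1)%:C * (Cintegral (fun w => (G j w * u w) * phi w) -
      U zeta * Cintegral (fun w => G j w * phi w)))) <= 6 * m * d1.
    have bGu : borel_Cn (fun w => G j w * u w) by exact: borel_CnM.
    have [iGu _] := intm zeta _ (m * B) bGu (mulr_ge0 m0 B0)
      (fun w mw => cabsM_le (GM j w) (ulocal _ _ zD mw)).
    have [iG _] := intm zeta _ m (bG j) m0 (fun w _ => GM j w).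
    have [iUG eUG] := CintegralZ (U zeta) iG.
    have [_ eD] := CintegralB iGu iUG.
    rewrite -eUG -eD.
    rewrite (_ : (fun w => _) = (fun w => (G j w * (u w - U zeta)) * (mol e (zeta *: v) w)%:C)); last first.
      by apply/funext => w; rewrite mulrBr mulrBl mulrA [U zeta * _]mulrC.
    have bd : borel_Cn (fun w => G j w * (u w - U zeta)).
      by apply: borel_CnM => //; apply: borel_CnD => //; exact: borel_Cn_cst.
    have md : 0 <= m * (3 * d1) by rewrite mulr_ge0// mulr_ge0// ltW.
    have [_ H] := intm zeta _ (m * (3 * d1)) bd md
      (fun w mw => cabsM_le (GM j w) (wU w mw)).
    have -> : 6 * m * d1 = 1 * (Z^-1 * (2 * (m * (3 * d1) * Z))) by field; rewrite gt_eqF.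
    apply: cabsM_le; first by rewrite cabsJ.
    by apply: cabsM_le => //; rewrite cabs_real ger0_norm.
  rewrite mulr_sumr mulr_suml -sumrB.
  rewrite (eq_bigr (fun j => (v 0 j)^* * ((Z^-1)%:C *
      (Cintegral (fun w => (G j w * u w) * phi w) - U zeta * Cintegral (fun w => G j w * phi w))))); last first.
    move=> j _; rewrite /mollify -/phi -/(phi _).
    move: (U zeta) (Z^-1)%:C ((v 0 j)^*) (Cintegral _) (Cintegral _) => x y c k l; ring.
  apply: le_trans (cabs_sum _ _ _) _.
  apply: (@le_trans _ _ (\sum_(j < n) 6 * m * d1)); first by apply: ler_sum => j _; exact: each.
  rewrite sumr_const card_ord -[leLHS]mulr_natr -d1E.
  have -> : 6 * m * d1 * n%:R = 6 * (n%:R * m * d1) by ring.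
  have -> : d1 * (2 + 6 * n%:R * m) = 2 * d1 + 6 * (n%:R * m * d1) by ring.
  by rewrite lerDr mulr_ge0// ltW.
- move=> zeta zD; apply: le_trans (Uu _ zD) _.
  rewrite -d1E; have -> : d1 * (2 + 6 * n%:R * m) = 2 * d1 + 6 * (n%:R * m * d1) by ring.
  by rewrite lerDl mulr_ge0.
Qed.

End restriction_to_line.

(** * The lower bound *)

(** With N proportional to r, 2^N beats the exponentials, while (2r)^N <= r^(2N) costs a multiple of
    r ln r that C outweighs. Each of the two terms becomes at most 1/3. *)
Lemma absorb_powers (R : realType) (a b : R) : 0 <= a -> 0 <= b ->
  exists2 C, 0 < C & exists r0, forall r, r0 <= r -> exists N : nat,
    10 * r * expR (a * r) *
      (expR (- (C * r * ln r)) * N%:R * (2 * r) ^+ N + 3 * (2 * expR (b * r)) / 2 ^+ N) < 1.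
Proof.
move=> a0 b0; have l2 : 0 < ln (2 : R) by rewrite ln_gt0// ltr1n.
(* N >= c r gives 2^N >= e^{(a + b + 4) r}; the four spare factors e^{-r} absorb 10, r and 6 and
   leave 1/3. *)
pose c := (a + b + 4) / ln 2.
have c0 : 0 <= c by rewrite divr_ge0 ?(ltW l2)// !addr_ge0.
(* This is 2 (c + 1) + (a + c + 4): the first part pays for (2r)^N, the second for all other
   exponentials, as ln r >= 1. *)
exists (a + 3 * c + 6); first by lra.
exists (10 + expR 1) => r rge.
have e10 := expR_gt0 (1 : R).
have r10 : 10 <= r by apply: le_trans rge; rewrite lerDl ltW.
have r2 : 2 <= r by apply: le_trans r10; rewrite ler_nat.
have r0 : 0 < r by apply: lt_le_trans r2.
have lr1 : 1 <= ln r.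
  by rewrite -ler_expR lnK ?posrE//; apply: le_trans rge; rewrite lerDr.
have re : r <= expR r by apply: le_trans (expR_ge1Dx r); rewrite lerDr.
have cr0 : 0 <= c * r by rewrite mulr_ge0// ltW.
pose N := (Num.truncn (c * r)).+1; exists N.
have Nlo : c * r <= N%:R by exact/ltW/truncnS_gt.
have Nhi : N%:R <= (c + 1) * r.
  have : (Num.truncn (c * r))%:R <= c * r by rewrite truncn_le.
  by rewrite /N -natr1 [(c + 1) * r]mulrDl mul1r; lra.
have pw : expR ((a + b + 4) * r) <= 2 ^+ N.
  have -> : (2 : R) = expR (ln 2) by rewrite lnK ?posrE.
  rewrite -expRM_natl ler_expR.
  have -> : (a + b + 4) * r = (c * r) * ln 2.
    by rewrite mulrAC /c divfK// gt_eqF.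
  by rewrite ler_wpM2r// ltW.
have small x : x <= r -> x * expR (- r) <= 1.
  by move=> xr; rewrite expRN ler_pdivrMr ?expR_gt0// mul1r (le_trans xr).
have small' : expR (- r) <= 3^-1.
  rewrite -[leRHS]mul1r ler_pdivlMr// mulrC small// (le_trans _ r10)// ler_nat//.
have second : 10 * r * expR (a * r) * (3 * (2 * expR (b * r)) / 2 ^+ N) <= 3^-1.
  have -> : 10 * r * expR (a * r) * (3 * (2 * expR (b * r)) / 2 ^+ N) =
      60 * r * expR ((a + b) * r) / 2 ^+ N.
    by rewrite [(a + b) * r]mulrDl expRD; move: (_ ^+ N)^-1 => x; ring.
  apply: (@le_trans _ _ (60 * r * expR ((a + b) * r) / expR ((a + b + 4) * r))).
    rewrite ler_wpM2l ?mulr_ge0 ?expR_ge0//; first exact: ltW.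
    by rewrite lef_pV2 ?posrE ?expR_gt0// exprn_gt0.
  have -> : 60 * r * expR ((a + b) * r) / expR ((a + b + 4) * r) =
      (10 * expR (- r)) * (r * expR (- r)) * (6 * expR (- r)) * expR (- r).
    have -> : (a + b + 4) * r = (a + b) * r + r + r + r + r by ring.
    rewrite -expRN !opprD !expRD [expR (- ((a + b) * r))]expRN.
    by field; rewrite gt_eqF ?expR_gt0.
  apply: le_trans small'; rewrite -[leRHS]mul1r ler_wpM2r ?expR_ge0//.
  have x0 x : 0 <= x -> 0 <= x * expR (- r) by move=> ?; rewrite mulr_ge0 ?expR_ge0.
  have s10 := small _ r10; have s6 : 6 * expR (- r) <= 1.
    by rewrite small// (le_trans _ r10)// ler_nat.
  have r0' := ltW r0.
  have p10 := mulr_ile1 (x0 _ (ler0n R 10)) (x0 _ r0') s10 (small _ (lexx r)).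
  by apply: mulr_ile1 => //; rewrite ?x0// mulr_ge0 ?x0.
have pwr : (2 * r) ^+ N <= expR (2 * ((c + 1) * r) * ln r).
  apply: (@le_trans _ _ ((r ^+ 2) ^+ N)).
    by apply: lerXn2r; rewrite ?nnegrE ?mulr_ge0 ?exprn_ge0// ?expr2 ?ler_wpM2r// ltW.
  have -> : r ^+ 2 = expR (2 * ln r) by rewrite expRM_natl lnK ?posrE.
  rewrite -expRM_natl ler_expR mulrCA -mulrA ler_wpM2l//.
  by rewrite ler_wpM2r// (le_trans _ lr1).
have first : 10 * r * expR (a * r) *
    (expR (- ((a + 3 * c + 6) * r * ln r)) * N%:R * (2 * r) ^+ N) <= 3^-1.
  apply: le_trans small'; have x0 := @expR_ge0 R.
  have NE : N%:R <= expR ((c + 1) * r).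
    by apply: le_trans Nhi _; apply: le_trans (expR_ge1Dx _); rewrite lerDr.
  apply: (@le_trans _ _ (expR r * expR r * expR (a * r) *
      (expR (- ((a + 3 * c + 6) * r * ln r)) * expR ((c + 1) * r) *
       expR (2 * ((c + 1) * r) * ln r)))).
    have r0' := ltW r0; have p2 : 0 <= 2 * r by rewrite mulr_ge0.
    rewrite ler_pM ?mulr_ge0 ?exprn_ge0//.
      by rewrite ler_wpM2r// ler_pM// (le_trans r10).
    by rewrite ler_pM ?mulr_ge0 ?exprn_ge0// ler_wpM2l.
  rewrite -!expRD ler_expR -subr_ge0.
  have -> : - r - (r + r + a * r + (- ((a + 3 * c + 6) * r * ln r) + (c + 1) * r +
      2 * ((c + 1) * r) * ln r)) = r * (a + c + 4) * (ln r - 1) by ring.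
  by rewrite !mulr_ge0 ?subr_ge0 ?addr_ge0// ltW.
by rewrite mulrDr; apply: le_lt_trans (lerD first second) _; clear; lra.
Qed.

Lemma cnormZ (R : realType) n c (z : 'rV[R[i]]_n) : cnorm (c *: z) = cabs c * cnorm z.
Proof.
rewrite /cnorm (eq_bigr (fun j => cabs c ^+ 2 * cabs (z 0 j) ^+ 2)); last first.
  by move=> j _; rewrite mxE cabsM exprMn.
by rewrite -mulr_sumr sqrtrM ?exprn_ge0 ?cabs_ge0// sqrtr_sqr ger0_norm ?cabs_ge0.
Qed.

(** The hypothesis controls u for large |z| only; elsewhere u is bounded by continuity, and the
    extra 1 in the rate absorbs this bound once D is large. The threshold depends on u, the rate
    does not. *)
Lemma growth_bound (R : realType) n (u : 'rV[R[i]]_n -> R[i]) (C0 r0 : R) :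
  0 <= C0 -> continuous u ->
  (forall z, r0 <= cnorm z -> cabs (u z) <= expR (C0 * cnorm z)) ->
  exists B0, forall (D : R) z, B0 <= D -> cnorm z <= 20 * D ->
    cabs (u z) <= expR ((20 * C0 + 1) * D).
Proof.
move=> C00 cu gu; have [B _ uB] := box_bounded 0 r0 cu.
exists `|B| => D z BD zD.
have D0 : 0 <= D by exact: le_trans BD.
have [zr|zr] := leP r0 (cnorm z).
  apply: le_trans (gu _ zr) _; rewrite ler_expR mulrDl mul1r mulrAC [20 * _ * _]mulrC mulrC.
  by rewrite [C0 * _]mulrC (le_trans (ler_wpM2r C00 zD))// lerDl.
have /uB uzB : box 0 r0 z.
  move=> [j c]; rewrite subr0; apply: le_trans (le_trans (cabs_le_cnorm z j) (ltW zr)).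
  by case: c => /=; [exact: norm_Im_le|exact: norm_Re_le].
apply: le_trans uzB (le_trans (ler_norm B) (le_trans BD _)).
apply: (@le_trans _ _ (expR D)); first by apply: le_trans (expR_ge1Dx D); rewrite lerDr.
by rewrite ler_expR mulrDl mul1r lerDr !mulr_ge0.
Qed.

Theorem theorem1p1 (R : realType) (n : nat) (n_ge1 : (1 <= n)%N)
    (C0 : R) (C0_gt0 : 0 < C0) (M : R) :
  exists C : R, 0 < C /\
    forall (u : 'rV[R[i]]_n -> R[i]) (V : 'rV[R[i]]_n -> 'rV[R[i]]_n),
      continuous u ->
      u 0 = 1 ->
      (exists r0 : R, forall z, r0 <= cnorm z ->
        cabs (u z) <= expR (C0 * cnorm z)) ->
      measurable_form V ->
      Linfty_norm V = M%:E ->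
      dbar_eq u V ->
      exists r1 : R, forall r : R, r1 <= r ->
        ((expR (- (C * r * ln r)))%:E <=
         ereal_inf
           [set ereal_sup
                  [set (cabs (u z))%:E | z in [set z | (cnorm (z - z0) < 1)%R]]
           | z0 in [set z0 | cnorm z0 = r]])%E.
Proof.
set A := 4 * n%:R * `|M|.
have A0 : 0 <= A by rewrite !mulr_ge0.
have C0' := ltW C0_gt0.
have b0 : 0 <= 20 * C0 + 1 by rewrite addr_ge0// mulr_ge0.
(* 40 A r is the exponent of E^2 in [planar_inequality], and 20 C0 + 1 the growth rate on |z| <= 20
   r; both are known before u and V are introduced. *)
have [C Cgt0 [r2 absorb]] := absorb_powers (mulr_ge0 (ler0n R 40) A0) b0.
exists C; split=> // u V cu u0 [r0 gu] mV VM uV.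
have [B0 uB] := growth_bound C0' cu gu.
exists (Order.max 1 (Order.max r2 B0)) => r; rewrite !ge_max => /and3P[r1 r2r B0r].
have rgt0 : 0 < r by exact: lt_le_trans r1.
apply/ereal_infP => _ [z0 /= z0r <-]; rewrite leNgt; apply/negP => small.
set tau := expR _ in small.
have u_small z : cnorm (z - z0) < 1 -> cabs (u z) <= tau.
  move=> zz0; rewrite -lee_fin; apply/ltW/(le_lt_trans _ small).
  by apply: ereal_sup_ubound; exists z.
(* As v has norm 1, |zeta v - z0| = |zeta - r|: the unit disc around r is mapped into the unit ball
   around z0. *)
pose v := (r^-1)%:C *: z0.
have v1 : cnorm v = 1 by rewrite cnormZ cabs_real normfV gtr0_norm// z0r mulVf ?gt_eqF.
have rv : r%:C *: v = z0 by rewrite scalerA -rmorphM/= divff ?gt_eqF// scale1r.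
have [N] := absorb _ r2r; apply/negP; rewrite -leNgt.
pose B := 2 * expR ((20 * C0 + 1) * r).
have main : 1 <= 10 * r * expR (20 * r * A) ^+ 2 * (tau * N%:R * (2 * r) ^+ N + 3 * B / 2 ^+ N).
  apply: planar_inequality => //; rewrite ?mulr_ge0 ?expR_ge0// => d d0.
  (* Capping the error at 1 gives |U| <= |u| + 1 <= [B]; this is the reason for the factor 2 in
     [B]. *)
  pose d' := Order.min d 1.
  have d'0 : 0 < d' by rewrite lt_min d0 ltr01.
  have d'd : d' <= d by rewrite ge_min lexx.
  have d'1 : d' <= 1 by rewrite ge_min lexx orbT.
  have vj j : cabs (v 0 j) <= 1 by rewrite -v1; exact: cabs_le_cnorm.
  have [U [pU [qU [a [pa [qa [HU Ha [aA qUa Uu]]]]]]]] :=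
    mollified_line cu mV VM uV vj (mulr_ge0 (ler0n R 20) (ltW rgt0)) d'0.
  have disc_sub z : cabs (z - r%:C) < 1 -> disc (20 * r) z.
    move=> zr; rewrite /disc -(subrK r%:C z); apply: le_trans (cabsD _ _) _.
    by rewrite cabs_real (gtr0_norm rgt0); lra.
  have U_le z : disc (20 * r) z -> cabs (U z) <= cabs (u (z *: v)) + d'.
    by move=> zD; rewrite -[U z](subrK (u (z *: v))) addrC (le_trans (cabsD _ _))// lerD2l Uu.
  exists U, pU, qU, a, pa, qa; split => //; split => //.
  - by move=> z zD; exact: le_trans (qUa _ zD) d'd.
  - move=> z zD; apply: le_trans (U_le _ zD) _.
    rewrite /B mulr_natl mulr2n lerD//; first by apply: uB => //; rewrite cnormZ v1 mulr1.
    by rewrite (le_trans d'1)// -[leLHS]expR0 ler_expR mulr_ge0// ltW.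
  - have D0 : disc (20 * r) (0 : R[i]) by rewrite /disc cabs0 mulr_ge0// ltW.
    have := le_trans (Uu _ D0) d'd; rewrite scale0r u0 => U01.
    rewrite lerBlDr -[leLHS]cabs1 -[X in cabs X](subrK (U 0)) addrC.
    by rewrite (le_trans (cabsD _ _))// lerD2l -cabsN opprB.
  - move=> z zr; apply: le_trans (U_le _ (disc_sub _ zr)) _; rewrite lerD//.
    by apply: u_small; rewrite -rv -scalerBl cnormZ v1 mulr1.
apply: le_trans main _; rewrite -expRM_natl.
by rewrite (_ : 2 * (20 * r * A) = 40 * A * r)//; ring.
Qed.
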